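(* Assume the setting, hypotheses (H) and hypothesis (A) below. Then for every $\mathbf f\in B_b(\mathbb R^d;\mathbb R^m)$, $\mathbf T(t)\mathbf f$ converges to $\mathcal M_{\mathbf f}\xi$ locally uniformly in $\mathbb R^d$ as $t\to+\infty$. Further, if $p\in[1,\infty)$ and $\mathbf f\in L^p_{\boldsymbol\mu}(\mathbb R^d;\mathbb R^m)$, then $\mathbf T(t)\mathbf f$ converges to $\mathcal M_{\mathbf f}\xi$ in $L^p_{\boldsymbol\mu}(\mathbb R^d;\mathbb R^m)$ as $t\to+\infty$.
   Context: Let $d\ge1$, $m\ge2$, $Q=(q_{ij})$, $\mathbf b=(b_1,\dots,b_d)$, $C=(c_{hk})$ functions on $\mathbb R^d$; $\boldsymbol{\mathcal A}\boldsymbol\zeta={\rm Tr}(QD^2\boldsymbol\zeta)+\langle\mathbf b,\nabla\boldsymbol\zeta\rangle+C\boldsymbol\zeta$, $\mathcal A={\rm Tr}(QD^2)+\langle\mathbf b,\nabla\rangle$. Hypotheses (H): (i) $q_{ij}=q_{ji}$, $b_j$, $c_{hk}\in C^\alpha_{\rm loc}(\mathbb R^d)$ for some $\alpha\in(0,1)$, $C\not\equiv0$; (ii) the minimum eigenvalue of $Q(x)$ has positive infimum over $\mathbb R^d$; (iii) $\langle C(x)y,y\rangle\le0$; (iv) there is a positive $\varphi\in C^2(\mathbb R^d)$ with $\varphi(x)\to\infty$ as $|x|\to\infty$ and $a,c>0$ with $\mathcal A\varphi\le a-c\varphi$; (v) off-diagonal entries of $C$ nonnegative; (vi) there is $0\neq\xi\in\mathbb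 R^m$ with $C(x)\xi=0$ for all $x$; (vii) no nonempty proper $K\subset\{1,\dots,m\}$ has $c_{ij}\equiv0$ for all $i\in K,j\notin K$. Hypothesis (A): $q_{ij},b_i,c_{hk}\in C^{1+\alpha}_{\rm loc}(\mathbb R^d)$ and there is $c>0$ with $|q_{ij}(x)|\le c(1+|x|^2)\varphi(x)$ ($i,j=1,\dots,d$) and $\langle\mathbf b(x),x\rangle\le c(1+|x|^2)\varphi(x)$ for all $x$. Under (H), $\bigcap_x{\rm Ker}C(x)$ is one-dimensional and spanned by a vector with positive entries; $\xi=(\xi_1,\dots,\xi_m)$ denotes the one with positive entries and $|\xi|=1$. $\mathbf T(t)\mathbf f$ is the value at $t$ of the unique bounded classical solution of $D_t\mathbf u=\boldsymbol{\mathcal A}\mathbf u$, $\mathbf u(0)=\mathbf f$, for $\mathbf f\in C_b(\mathbb R^d;\mathbb R^m)$; there are finite Borel measures $p_{ij}(t,x,dy)$ with $(\mathbf T(t)\mathbf f)_i(x)=\sum_j\int f_j(y)p_{ij}(t,x,dy)$, and this formula defines $\mathbf T(t)$ on $B_b(\mathbb R^d;\mathbb R^m)$, the bounded Borel measurable functions. $\mu$ is the unique invariant probability measure of the scalar Markov semigroup $T(t)$ associated with $\mathcal A$ on $C_b(\mathbb R^d)$. Set $\mu_j=\xi_j\mu$, $L^p_{\boldsymbol\mu}(\mathbb R^d;\mathbb R^m)=\bigotimes_{j=1}^mL^p_{\mu_j}(\mathbb R^d)$ (on which $\mathbf T(t)$ extends to a strongly continuous semigroup), and $\mathcal M_{\mathbf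 f}=\sum_{j=1}^m\int_{\mathbb R^d}f_j\,d\mu_j$ for $\mathbf f\in L^1_{\boldsymbol\mu}(\mathbb R^d;\mathbb R^m)$. *)

(* Defs.v *)
From mathcomp Require Import all_boot all_order all_algebra.
From mathcomp Require Import all_classical all_reals all_analysis.
Import numFieldNormedType.Exports.
Import Order.TTheory GRing.Theory Num.Theory.

Set Implicit Arguments.
Unset Strict Implicit.
Unset Printing Implicit Defensive.

Local Open Scope ring_scope.
Local Open Scope classical_set_scope.

Section Defs.
Variables (R : realType) (d m : nat).

(* points of R^d are row vectors; values in R^m are column vectors *)
Definition pt := 'rV[R]_d.

Definition Rd := g_sigma_algebraType (@open pt).

Definition enorm (p q : nat) (v : 'M[R]_(p, q)) : R :=
  Num.sqrt (\sum_i \sum_j v i j ^+ 2).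

Definition ei (i : 'I_d) : pt := delta_mx ord0 i.
Definition dpart (i : 'I_d) (f : pt -> R) : pt -> R := fun x => 'D_(ei i) f x.

Definition holder_loc (alpha : R) (f : pt -> R) : Prop :=
  forall r : R, 0 < r -> exists K : R, forall x y : pt,
    enorm x <= r -> enorm y <= r -> `|f x - f y| <= K * (enorm (x - y)) `^ alpha.

Definition C1holder_loc (alpha : R) (f : pt -> R) : Prop :=
  holder_loc alpha f /\ (forall x i, derivable f x (ei i)) /\
  (forall i, holder_loc alpha (dpart i f)).

Definition C2 (f : pt -> R) : Prop :=
  continuous f /\
  (forall x i, derivable f x (ei i)) /\
  (forall i, continuous (dpart i f)) /\
  (forall x i j, derivable (dpart i f) x (ei j)) /\
  (forall i j, continuous (dpart j (dpart i f))).

Definition Aop (Q : pt -> 'M[R]_d) (b : pt -> 'rV[R]_d) (f : pt -> R) : pt -> R :=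
  fun x => \sum_i \sum_j Q x i j * dpart j (dpart i f) x
           + \sum_i b x ord0 i * dpart i f x.

Definition Avec (Q : pt -> 'M[R]_d) (b : pt -> 'rV[R]_d) (C : pt -> 'M[R]_m)
  (u : pt -> 'cV[R]_m) : pt -> 'cV[R]_m :=
  fun x => \col_h (Aop Q b (fun y => u y h ord0) x
                   + \sum_k C x h k * u x k ord0).

Definition C12 (w : R -> pt -> R) : Prop :=
  {within [set q : R * pt | 0 <= q.1], continuous (fun q : R * pt => w q.1 q.2)} /\
  (forall t x, 0 < t -> derivable (fun s => w s x) t 1) /\
  (forall t x i, 0 < t -> derivable (w t) x (ei i)) /\
  (forall t x i j, 0 < t -> derivable (dpart i (w t)) x (ei j)) /\
  (forall q : R * pt, 0 < q.1 ->
     {for q, continuous (fun q : R * pt => 'D_1 (fun s => w s q.2) q.1)}) /\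
  (forall i (q : R * pt), 0 < q.1 ->
     {for q, continuous (fun q : R * pt => dpart i (w q.1) q.2)}) /\
  (forall i j (q : R * pt), 0 < q.1 ->
     {for q, continuous (fun q : R * pt => dpart j (dpart i (w q.1)) q.2)}).

Definition strip_bounded (w : R -> pt -> R) : Prop :=
  forall T : R, exists M : R, forall t x, 0 <= t <= T -> `|w t x| <= M.

Definition scalar_sol (Q : pt -> 'M[R]_d) (b : pt -> 'rV[R]_d)
  (w : R -> pt -> R) (g : pt -> R) : Prop :=
  C12 w /\ strip_bounded w /\ (forall x, w 0 x = g x) /\
  (forall t x, 0 < t -> 'D_1 (fun s => w s x) t = Aop Q b (w t) x).

Definition system_sol (Q : pt -> 'M[R]_d) (b : pt -> 'rV[R]_d) (C : pt -> 'M[R]_m)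
  (u : R -> pt -> 'cV[R]_m) (f : pt -> 'cV[R]_m) : Prop :=
  (forall h, C12 (fun t x => u t x h ord0)) /\
  (forall h, strip_bounded (fun t x => u t x h ord0)) /\
  (forall x, u 0 x = f x) /\
  (forall t x h, 0 < t ->
     'D_1 (fun s => u s x h ord0) t = Avec Q b C (u t) x h ord0).

Definition Cb (g : pt -> R) : Prop :=
  continuous g /\ exists M : R, forall x, `|g x| <= M.
Definition Cbm (f : pt -> 'cV[R]_m) : Prop :=
  forall h, Cb (fun x => f x h ord0).

Definition Bbm (f : pt -> 'cV[R]_m) : Prop :=
  forall h, measurable_fun [set: Rd] (fun x : Rd => f x h ord0) /\
            exists M : R, forall x, `|f x h ord0| <= M.

Definition Tker (p : R -> pt -> 'I_m -> 'I_m -> {measure set Rd -> \bar R})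
  (t : R) (f : pt -> 'cV[R]_m) : pt -> 'cV[R]_m :=
  fun x => \col_i \sum_j fine (\int[p t x i j]_(y in [set: Rd]) (f y j ord0)%:E)%E.

(* M_f = sum_j int f_j d mu_j,  mu_j = xi_j mu *)
Definition Mf (mu : probability Rd R) (xi : 'cV[R]_m) (f : pt -> 'cV[R]_m) : R :=
  \sum_j xi j ord0 * fine (\int[mu]_(y in [set: Rd]) (f y j ord0)%:E)%E.

(* f in L^p_mu(R^d;R^m) (each component in L^p_{mu_j}, equivalently in L^p_mu
   since xi_j > 0) *)
Definition Lpm (mu : probability Rd R) (p : R) (f : pt -> 'cV[R]_m) : Prop :=
  forall h, measurable_fun [set: Rd] (fun x : Rd => f x h ord0) /\
    (\int[mu]_(y in [set: Rd]) ((`|f y h ord0| `^ p)%:E) < +oo)%E.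

(* ||f - g||^p in L^p_{mu}(R^d;R^m) = sum_j int |f_j - g_j|^p d mu_j *)
Definition Lpdist (mu : probability Rd R) (xi : 'cV[R]_m) (p : R)
  (f g : pt -> 'cV[R]_m) : \bar R :=
  (\sum_j (xi j ord0)%:E *
     \int[mu]_(y in [set: Rd]) ((`|f y j ord0 - g y j ord0| `^ p)%:E))%E.

End Defs.

(* Main.v *)
(** Everything rests on the maximum principle. The Lyapunov function [phi] gives
comparison for bounded solutions, hence uniqueness, positivity and [T(t) xi = xi],
and the drift bound [|T(t) f| <= beta xi (exp(-c t) phi + a/c)] when
[|f| <= beta xi phi]. Moving-ball barriers and the irreducibility of [C] spread
positivity to every component and every ball; an Ishii-Lions doubling of
variables with reflection coupling makes solutions equi-Lipschitz near the
origin. Together they give a Doeblin dichotomy on balls: for [0 <= f <= xi], either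
[T(tau) f >= delta xi] or [T(tau) f <= (1 - delta) xi]. As in the Hairer-Mattingly
proof of Harris' theorem, drift and dichotomy make the oscillation of
[(T(t) f)_i / xi_i], weighted by [1 + beta phi], decay geometrically.

Since [xi] also lies in the left kernel of [C], the function [sum_i xi_i (T(t) f)_i]
solves the scalar equation, so [M_f] is invariant and identifies the limit, uniformly
over [|f| <= xi]. Bounded Borel data are approximated by continuous ones in
[L^1(p_ij(t,x,.) + mu)] at each fixed [t] and [x]; this is enough because the rate
does not depend on the approximant. In [L^q], Jensen's inequality for [T(t)] and the
invariance of [M_f] bound [T(t)] on [C_b] uniformly in [t]; the boundedness constant
of the extension is only used at a fixed time, to replace the datum by a continuous
one. *)

Require Import Defs.
From mathcomp Require Import all_boot all_order all_algebra.
From mathcomp Require Import all_classical all_reals all_analysis.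
From mathcomp Require Import measurable_realfun ring lra.
Import numFieldNormedType.Exports.
Import Order.TTheory GRing.Theory Num.Theory.
Set Implicit Arguments.
Unset Strict Implicit.
Unset Printing Implicit Defensive.
Local Open Scope ring_scope.
Local Open Scope classical_set_scope.

(** * Second-order tests at extrema *)

Section Calculus.
Context {R : realType} {V : normedModType R}.

(** Since [C x *m xi = 0] and the off-diagonal entries of [C] are nonnegative, the ratios
    [u_i / xi_i] are coupled by a matrix with zero row sums: dividing by [xi] turns the system into
    a diffusion that switches between [m] components, and [T(t)] into its Markov semigroup. This is
    why comparisons minimise ratios over the component as well as over the point, and why Harris'
    argument runs on pairs of a point and a component. The obstacle is that a dichotomy for all
    [0 <= f <= xi] cannot see where [f] is large. It therefore tests a single number, component [i0]
    at time 1 at the origin, which is at least half of [xi_i0] for [f] or for [xi - f]. A Lipschitz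
    bound uniform in [f] enlarges that point to a ball of fixed radius, from which the barriers
    start. All second-order tests are one-dimensional: once [Q x] is a sum of rank-one matrices, the
    trace term is a sum of second derivatives along lines. Coupling two points then amounts to
    factorising one positive semidefinite block matrix. *)

Lemma is_derive_nearP (f : V -> R) x v l :
  is_derive x v f l <-> forall e, 0 < e ->
    \forall h \near (0 : R), `|f (h *: v + x) - f x - h * l| <= e * `|h|.
Proof.
split=> [[df <-] e e0|H].
  have /derivable_nbhs/eqaddoP/(_ e e0) := df.
  by rewrite /= !near_simpl; apply: filterS => h /=; rewrite opprD addrA.
have cv : (fun h => h^-1 *: ((f \o shift x) (h *: v) - f x)) @ 0^' --> l.
  apply/cvgrPdist_le => e e0; rewrite near_withinE.
  near=> h => h0 /=.
  have : `|f (h *: v + x) - f x - h * l| <= e * `|h| by near: h; exact: H.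
  rewrite distrC => Hh.
  have -> : l - h^-1 *: (f (h *: v + x) - f x) =
     h^-1 * (h * l - (f (h *: v + x) - f x)).
    by rewrite /GRing.scale /=; field.
  by rewrite normrM normfV ler_pdivrMl ?normr_gt0 // (mulrC `|h|).
split; [exact: cvgP cv|exact/cvg_lim].
Unshelve. all: by end_near. Qed.

End Calculus.

Section OneDim.
Context {R : realType}.
Implicit Types f g : R -> R.

(** One-sided on purpose: an extremum over a closed time interval may sit at its right end, where
    only earlier times can be compared. *)
Lemma derive_left_le0 f (t l : R) : is_derive t 1 f l ->
  (\forall s \near t^'-, f t <= f s) -> l <= 0.
Proof.
move=> /is_derive_nearP df mf; rewrite leNgt; apply/negP => l0.
have l20 : 0 < l / 2 by lra.
have /nbhs_ballP[e1 /= e10 H1] := df _ l20.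
have [e2 /= e20 H2] := mf.
pose h := Num.min e1 e2 / 2.
have h0 : 0 < h by rewrite divr_gt0 // lt_min e10.
have he1 : h < e1 by rewrite ltr_pdivrMr // (@le_lt_trans _ _ e1) // ?ge_min ?lexx//; lra.
have he2 : h < e2.
  by rewrite ltr_pdivrMr // (@le_lt_trans _ _ e2) // ?ge_min ?lexx ?orbT//; lra.
have := H1 (- h); rewrite /ball/= sub0r opprK gtr0_norm // => /(_ he1).
have := H2 (t - h); rewrite /ball/= opprB addrC subrK gtr0_norm // => /(_ he2).
have -> : t - h < t by lra.
move=> /(_ isT) Hf; rewrite normrN (gtr0_norm h0) scaler1 (addrC (- h)).
by rewrite ler_norml => /andP[_ ?]; have := mulr_gt0 h0 l0; lra.
Qed.

Lemma near0_lt (e : R) : 0 < e -> \forall h \near (0 : R), `|h| < e.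
Proof.
by move=> e0; apply/nbhs_ballP; exists e => // h; rewrite /ball /= sub0r normrN.
Qed.

Lemma near0_le (e : R) : 0 < e -> \forall h \near (0 : R), `|h| <= e.
Proof. by move=> /near0_lt; apply: filterS => h /ltW. Qed.

Lemma near0_both (P P' : set R) :
  (\forall h \near (0 : R), P h) -> (\forall h \near (0 : R), P' h) ->
  exists2 e : R, 0 < e & forall h, `|h| < e -> P h /\ P' h.
Proof.
move=> nP nP'; have /nbhs_ballP[e /= e0 H] : nbhs (0 : R) (P `&` P') by exact: filterI.
by exists e => // h he; apply: H; rewrite /ball /= sub0r normrN.
Qed.

Lemma is_derive_continuous f (x l : R) : is_derive x 1 f l ->
  {for x, continuous f}.
Proof.
by move=> df; apply/differentiable_continuous/derivable1_diffP; exact: ex_derive.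
Qed.

Lemma mean_value f (df : R -> R) : (forall s : R, is_derive s 1 f (df s)) ->
  forall a b, exists2 c, Num.min a b <= c <= Num.max a b &
    f b - f a = df c * (b - a).
Proof.
move=> Df a b.
have Cf s : {for s, continuous f} by apply: is_derive_continuous (Df s).
have cf (x y : R) : {within `[x, y], continuous f}.
  by apply: continuous_subspaceT => z; exact: Cf.
have [ab|ba] := leP a b.
  have [c] := @MVT_segment _ f df a b ab (fun x _ => Df x) (cf _ _).
  by rewrite in_itv /= => cab E; exists c.
have [c] := @MVT_segment _ f df b a (ltW ba) (fun x _ => Df x) (cf _ _).
by rewrite in_itv /= => cab E; exists c => //; lra.
Qed.

Lemma is_derive_quad (A B x : R) :
  is_derive x 1 (fun t : R => A * t + B * (t * t)) (A + 2 * B * x).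
Proof.
apply/is_derive_nearP => e e0; near=> h.
rewrite scaler1.
have -> : A * (h + x) + B * ((h + x) * (h + x)) - (A * x + B * (x * x)) -
   h * (A + 2 * B * x) = B * h * h by ring.
rewrite normrM ler_wpM2r // normrM.
have Bp : 0 < `|B| + 1 by rewrite ltr_wpDl.
rewrite (@le_trans _ _ ((`|B| + 1) * `|h|)) //.
  by rewrite ler_wpM2r // lerDl.
rewrite -ler_pdivlMl // mulrC.
near: h; apply: near0_le; rewrite divr_gt0 //.
Unshelve. all: by end_near. Qed.

(** The cubic remainder is there for the barrier [theta h^2], a quartic polynomial along a line
    whose cubic term has no sign. The second derivative exists at 0 only, so both claims are
    obtained by contradiction at one explicit small argument. *)
Lemma second_order_test g (dg : R -> R) (l A B E : R) :
  (forall t : R, is_derive t 1 g (dg t)) -> is_derive (0 : R) 1 dg l ->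
  (\forall t \near (0 : R),
     g t <= g 0 + A * t + B * (t * t) + E * `|t| * (t * t)) ->
  dg 0 = A /\ l <= 2 * B.
Proof.
move=> Dg /is_derive_nearP Dl Hg.
have first : dg 0 = A.
  apply/eqP; rewrite -subr_eq0 -normr_le0 leNgt; apply/negP => s0.
  set s := dg 0 - A in s0.
  have s20 : 0 < `|s| / 2 by rewrite divr_gt0.
  have /is_derive_nearP/(_ _ s20) D0 := Dg 0.
  have [e e0 H] := near0_both D0 Hg.
  pose N := `|B| + `|E| + 1.
  have N0 : 0 < N by rewrite ltr_wpDl.
  (* The linear gap is [|s| y]. The derivative error takes half of it, and this [y] keeps the
     quadratic and cubic terms below a further quarter; [h] has the sign of [s], so that
     [s * h = |s| * y]. *)
  pose y := Num.min (Num.min 1 (e / 2)) (`|s| / (2 * N) / 2).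
  have y0 : 0 < y.
    by rewrite !lt_min ltr01 !divr_gt0 // mulr_gt0.
  have y1 : y <= 1 by rewrite !ge_min lexx.
  have ye : y < e.
    rewrite (@le_lt_trans _ _ (e / 2)) //; last by lra.
    by rewrite !ge_min lexx orbT.
  have yN : N * y <= `|s| / 4.
    rewrite -ler_pdivlMl // /y ge_min; apply/orP; right.
    by rewrite le_eqVlt; apply/orP; left; apply/eqP; field; rewrite gt_eqF.
  pose h := Num.sg s * y.
  have ah : `|h| = y by rewrite normrM normr_sg -normr_gt0 s0 mul1r gtr0_norm.
  have hh : h * h = y * y.
    by rewrite -[LHS]expr2 -(real_normK (num_real h)) ah expr2.
  have sh : s * h = `|s| * y by rewrite mulrA (mulrC s) -normrEsg.
  have := H h; rewrite ah => /(_ ye)[].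
  rewrite scaler1 addr0 hh ler_norml => /andP[h1 _] h2.
  have : s * h <= `|s| / 2 * y + B * (y * y) + E * y * (y * y).
    rewrite /s mulrBl; lra.
  rewrite sh.
  have : B * (y * y) <= `|B| * (y * y) by rewrite ler_wpM2r ?ler_norm // mulr_ge0 // (ltW y0).
  have : E * y * (y * y) <= `|E| * (y * y).
    rewrite ler_wpM2r ?mulr_ge0 ?(ltW y0) //.
    by rewrite (le_trans (ler_norm _)) // normrM (gtr0_norm y0) ler_piMr.
  have : (`|B| + `|E|) * (y * y) <= `|s| / 4 * y.
    rewrite mulrA ler_wpM2r ?(ltW y0) // (le_trans _ yN) //.
    by rewrite ler_wpM2r ?(ltW y0) // /N; lra.
  have : 0 < `|s| * y by rewrite mulr_gt0.
  nra.
split => //; rewrite leNgt; apply/negP => lB.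
pose s := (l - 2 * B) / 2.
have s0 : 0 < s by rewrite /s; lra.
have [e e0 H] := near0_both (Dl s s0) Hg.
pose N := `|E| + 1.
have N0 : 0 < N by rewrite ltr_wpDl.
pose t := Num.min (e / 2) (s / (4 * N)).
have t0 : 0 < t.
  have N4 : 0 < 4 * N by rewrite mulr_gt0.
  by rewrite lt_min (divr_gt0 e0) // (divr_gt0 s0).
have te : t < e.
  by rewrite (@le_lt_trans _ _ (e / 2)) //; [rewrite ge_min lexx|lra].
have tN : N * t <= s / 4.
  rewrite -ler_pdivlMl // /t ge_min; apply/orP; right.
  by rewrite le_eqVlt; apply/orP; left; apply/eqP; field; rewrite gt_eqF.
(* After subtraction of a parabola steeper than the bound by [s / 2], the derivative is nonnegative
   between 0 and [t]. The mean value theorem then contradicts the upper bound, whose cubic term is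
   at most [s / 4 * t^2]. *)
have DF (u : R) : is_derive u 1 (fun t : R => g t - (A * t + (B + s / 2) * (t * t)))
     (dg u - (A + 2 * (B + s / 2) * u)).
  by apply: is_deriveB (Dg u) (is_derive_quad _ _ _).
have [c] := mean_value DF 0 t.
rewrite (min_idPl (ltW t0)) (max_idPr (ltW t0)) => /andP[c0 ct].
have := H c; rewrite ger0_norm //.
move=> /(_ (le_lt_trans ct te))[]; rewrite scaler1 addr0 first ler_norml.
move=> /andP[h1 _] _ MV.
have : 0 <= (dg c - (A + 2 * (B + s / 2) * c)) * (t - 0).
  by rewrite mulr_ge0 ?subr_ge0 ?(ltW t0) //; rewrite /s in h1 *; lra.
rewrite -MV.
have := H t; rewrite gtr0_norm // => /(_ te)[_].
have : E * t * (t * t) <= s / 4 * (t * t).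
  rewrite ler_wpM2r ?mulr_ge0 ?(ltW t0) // (le_trans _ tN) //.
  rewrite ler_wpM2r ?(ltW t0) // /N (le_trans (ler_norm _)) //; lra.
have := mulr_gt0 s0 (mulr_gt0 t0 t0).
move: (t * t) => tt; lra.
Qed.

End OneDim.

Section LineDerivative.
Context {R : realType} {V : normedModType R}.
Implicit Types f : V -> R.

Lemma is_derive_line f (y v : V) (s l : R) :
  is_derive (s *: v + y) v f l -> is_derive s 1 (fun s : R => f (s *: v + y)) l.
Proof.
move=> /is_derive_nearP D; apply/is_derive_nearP => e /D.
apply: filterS => h.
by have -> : (h *: 1 + s) *: v + y = h *: v + (s *: v + y)
  by rewrite scaler1 scalerDl addrA.
Qed.

(** The increment is split into a move along [w] followed by one along [e]; the mean value theorem
    on the second leg uses the derivative along [e] off [x] and its continuity at [x]. This is the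
    induction step from partial to directional derivatives. *)
Lemma is_derive_addscale f (x w e : V) (c l : R) (de : V -> R) :
  is_derive x w f l -> (forall y, is_derive y e f (de y)) ->
  {for x, continuous de} -> is_derive x (c *: e + w) f (c * de x + l).
Proof.
move=> /is_derive_nearP Dw De Ce; apply/is_derive_nearP => eps e0.
have e20 : 0 < eps / 2 by lra.
pose C := `|c| + 1; have C0 : 0 < C by rewrite ltr_wpDl.
have eC : 0 < eps / 2 / C by rewrite divr_gt0.
move/cvgrPdist_le: Ce => /(_ _ eC) /nbhs_ballP[r /= r0 Hr].
pose M := `|c| * `|e| + `|w| + 1.
have M0 : 0 < M by rewrite ltr_wpDl // addr_ge0 // mulr_ge0.
near=> h.
have Dwh : `|f (h *: w + x) - f x - h * l| <= eps / 2 * `|h|.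
  by near: h; exact: Dw.
have hM : `|h| < r / M by near: h; apply: near0_lt; rewrite divr_gt0 //.
have D1 s := is_derive_line (De (s *: e + (h *: w + x))).
have [t tc MV] := mean_value D1 0 (h * c).
have th : `|t| <= `|h * c|.
  have [hc|hc] := leP 0 (h * c).
    move: tc; rewrite (min_idPl hc) (max_idPr hc) => /andP[t0 ?].
    by rewrite !ger0_norm.
  move: tc; rewrite (min_idPr (ltW hc)) (max_idPl (ltW hc)) => /andP[? t0].
  by rewrite (ltr0_norm hc) ler0_norm // lerN2.
move: MV; rewrite scale0r add0r subr0 => MV.
have near_z : `|de x - de (t *: e + (h *: w + x))| <= eps / 2 / C.
  apply: Hr; rewrite -ball_normE /= addrA opprD addrCA subrr addr0 normrN.
  rewrite (le_lt_trans (ler_normD _ _)) // !normrZ.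
  rewrite (@le_lt_trans _ _ (`|h| * M)) //; last by rewrite -ltr_pdivlMr.
  rewrite /M !mulrDr !mulrA mulr1 -normrM -addrA lerD //.
    by rewrite ler_wpM2r.
  by rewrite lerDl.
have -> : f (h *: (c *: e + w) + x) - f x - h * (c * de x + l) =
   (f (h *: w + x) - f x - h * l) +
   h * c * (de (t *: e + (h *: w + x)) - de x).
  have -> : h *: (c *: e + w) + x = (h * c) *: e + (h *: w + x).
    by rewrite scalerDr scalerA addrA.
  rewrite mulrBr (mulrC (h * c) (de (_ + _))) -MV; ring.
rewrite (le_trans (ler_normD _ _)) //.
have -> : eps * `|h| = eps / 2 * `|h| + eps / 2 * `|h| by field.
apply: lerD => //; rewrite !normrM distrC -mulrA (mulrC (eps / 2)) ler_wpM2l //.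
rewrite (@le_trans _ _ (C * (eps / 2 / C))) //.
  by apply: ler_pM => //; rewrite /C lerDl.
by rewrite mulrC divfK // gt_eqF.
Unshelve. all: by end_near. Qed.

End LineDerivative.

(** * Positive semidefinite forms as sums of squares *)

Section PSD.
Variables (R : realType) (I : finType).
Implicit Types (M : I -> I -> R) (v : I -> R).

Definition qform M v : R := \sum_i \sum_j v i * M i j * v j.

Lemma qform_shift M v i (s : R) : (forall j k, M j k = M k j) ->
  qform M (fun j => v j + s * (j == i)%:R) =
  qform M v + 2 * s * (\sum_j M i j * v j) + s ^+ 2 * M i i.
Proof.
move=> symM.
have expand j k : (v j + s * (j == i)%:R) * M j k * (v k + s * (k == i)%:R) =
  v j * M j k * v k + s * (j == i)%:R * (M j k * v k) +
  (s * (k == i)%:R * (M k j * v j) + s ^+ 2 * (j == i)%:R * ((k == i)%:R * M j k)).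
  by rewrite (symM k j); ring.
have delta (F : I -> R) : \sum_k (k == i)%:R * F k = F i.
  rewrite (bigD1 i) //= eqxx mul1r big1 ?addr0 // => k /negbTE ->.
  by rewrite mul0r.
rewrite /qform; under eq_bigr => j _ do under eq_bigr => k _ do rewrite expand.
under eq_bigr => j _ do rewrite !big_split /=.
rewrite !big_split /=.
have -> : \sum_j \sum_k s * (j == i)%:R * (M j k * v k) = s * \sum_k M i k * v k.
  under eq_bigr => j _ do rewrite -mulr_sumr -mulrA.
  by rewrite -mulr_sumr (delta (fun j => \sum_k M j k * v k)).
have -> : \sum_j \sum_k s * (k == i)%:R * (M k j * v j) = s * \sum_k M i k * v k.
  under eq_bigr => j _ do under eq_bigr => k _ do rewrite -mulrA.
  under eq_bigr => j _ do rewrite -mulr_sumr (delta (fun k => M k j * v j)).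
  by rewrite mulr_sumr.
have -> : \sum_j \sum_k s ^+ 2 * (j == i)%:R * ((k == i)%:R * M j k) = s ^+ 2 * M i i.
  under eq_bigr => j _ do rewrite -mulr_sumr (delta (M j)) -mulrA.
  by rewrite -mulr_sumr (delta (M^~ i)).
by ring.
Qed.

Lemma psd_diag_ge0 M i : (forall j k, M j k = M k j) ->
  (forall v, 0 <= qform M v) -> 0 <= M i i.
Proof.
move=> symM pM; have := pM (fun j => 0 + 1 * (j == i)%:R).
rewrite qform_shift // /qform.
rewrite !big1 ?(mulr0, expr1n, mul1r, add0r) //.
  by move=> j _; rewrite mulr0.
by move=> j _; rewrite big1 // => k _; rewrite !mul0r.
Qed.

Lemma psd_diag0 M i j : (forall j k, M j k = M k j) ->
  (forall v, 0 <= qform M v) -> M i i = 0 -> M i j = 0.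
Proof.
move=> symM pM Mii; apply/eqP/negPn/negP => Mij.
pose v k : R := 0 + 1 * (k == j)%:R.
have qv : qform M v = M j j.
  rewrite qform_shift // /qform !big1 ?(mulr0, expr1n, mul1r, add0r) //.
    by move=> k _; rewrite mulr0.
  by move=> k _; rewrite big1 // => l _; rewrite !mul0r.
have Mv : \sum_k M i k * v k = M i j.
  rewrite (bigD1 j) //= /v eqxx big1 ?(addr0, add0r, mulr1) //.
  by move=> k /negbTE ->; rewrite mulr0 addr0 mulr0.
(* With [M i i = 0] the form is affine in the shift along coordinate [i]; this shift gives it the
   value -1. *)
have := pM (fun k => v k + (- (M j j + 1) / (2 * M i j)) * (k == i)%:R).
rewrite qform_shift // Mii mulr0 addr0 qv Mv.
have -> : 2 * (- (M j j + 1) / (2 * M i j)) * M i j = - (M j j + 1) by field.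
lra.
Qed.

(* Symmetric Gaussian elimination: each step removes one nonzero diagonal entry. *)
Lemma psd_decomp M : (forall i j, M i j = M j i) -> (forall v, 0 <= qform M v) ->
  exists vs : seq (I -> R), forall i j, M i j = \sum_(v <- vs) v i * v j.
Proof.
have [n] := ubnP #|[set i | M i i != 0]%SET|.
elim: n M => // n IH M; rewrite ltnS => nM symM pM.
have [i iM|M0] := pickP (fun i => M i i != 0); last first.
  exists [::] => i j; rewrite big_nil; apply: psd_diag0 => //.
  by apply/eqP/negPn; rewrite M0.
have Mii : 0 < M i i by rewrite lt_def iM psd_diag_ge0.
pose M' j k := M j k - M i j * M i k / M i i.
have symM' j k : M' j k = M' k j by rewrite /M' symM; ring.
have pM' v : 0 <= qform M' v.
  have -> : qform M' v = qform M v - (\sum_j M i j * v j) ^+ 2 / M i i.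
    rewrite expr2 mulr_suml mulr_suml -sumrB; apply: eq_bigr => j _.
    rewrite mulr_sumr mulr_suml -sumrB; apply: eq_bigr => k _.
    by rewrite /M'; ring.
  (* This shift minimises the form of [M] along coordinate [i]; the minimum is the form of the Schur
     complement [M']. *)
  have := pM (fun j => v j + (- (\sum_j M i j * v j) / M i i) * (j == i)%:R).
  rewrite qform_shift //; set l := \sum_j _.
  suff -> : qform M v + 2 * (- l / M i i) * l + (- l / M i i) ^+ 2 * M i i =
    qform M v - l ^+ 2 / M i i by [].
  by field; rewrite gt_eqF.
have lt : (#|[set j | M' j j != 0%R]%SET| < n)%N.
  apply: leq_trans nM; apply: proper_card; apply/properP; split.
    apply/fintype.subsetP => j; rewrite !inE; apply: contra_neq => Mjj.
    by rewrite /M' Mjj (symM i) (psd_diag0 i symM pM Mjj) !mul0r subr0.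
  exists i; rewrite inE; first by rewrite iM.
  by rewrite negbK /M' mulfK ?iM // subrr eqxx.
have [vs Hvs] := IH M' lt symM' pM'.
exists ((fun j => M i j / Num.sqrt (M i i)) :: vs) => j k.
rewrite big_cons -Hvs /M' mulrACA -invfM -expr2 sqr_sqrtr ?ltW //.
ring.
Qed.

End PSD.

Section Euclid.
Variables (R : realType) (d : nat).
Local Notation pt := (pt R d).
Implicit Types (x y z v w : pt) (f g : pt -> R).

Definition dot x y : R := \sum_i x ord0 i * y ord0 i.

Lemma enorm_dot x : enorm x = Num.sqrt (dot x x).
Proof.
by rewrite /enorm big_ord1; congr Num.sqrt; apply: eq_bigr => i _.
Qed.

Lemma dotC x y : dot x y = dot y x.
Proof. by apply: eq_bigr => i _; rewrite mulrC. Qed.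
Lemma dotDl x y z : dot (x + y) z = dot x z + dot y z.
Proof. by rewrite -big_split; apply: eq_bigr => i _; rewrite mxE mulrDl. Qed.
Lemma dotZl (c : R) x y : dot (c *: x) y = c * dot x y.
Proof. by rewrite mulr_sumr; apply: eq_bigr => i _; rewrite mxE mulrA. Qed.
Lemma dotNl x y : dot (- x) y = - dot x y.
Proof. by rewrite -scaleN1r dotZl mulN1r. Qed.
Lemma dotBl x y z : dot (x - y) z = dot x z - dot y z.
Proof. by rewrite dotDl dotNl. Qed.
Lemma dotDr x y z : dot z (x + y) = dot z x + dot z y.
Proof. by rewrite dotC dotDl !(dotC z). Qed.
Lemma dotZr (c : R) x y : dot y (c *: x) = c * dot y x.
Proof. by rewrite dotC dotZl dotC. Qed.
Lemma dotBr x y z : dot z (x - y) = dot z x - dot z y.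
Proof. by rewrite dotC dotBl !(dotC z). Qed.
Lemma dot_ge0 x : 0 <= dot x x.
Proof. by apply: sumr_ge0 => i _; rewrite -expr2 sqr_ge0. Qed.

Lemma enorm_ge0 x : 0 <= enorm x.
Proof. by rewrite enorm_dot sqrtr_ge0. Qed.
Lemma enorm2 x : enorm x ^+ 2 = dot x x.
Proof. by rewrite enorm_dot sqr_sqrtr // dot_ge0. Qed.
Lemma enorm0 : enorm (0 : pt) = 0.
Proof.
by rewrite enorm_dot /dot big1 ?sqrtr0 // => i _; rewrite mxE mul0r.
Qed.

Lemma enormZ (c : R) x : enorm (c *: x) = `|c| * enorm x.
Proof.
by rewrite !enorm_dot dotZl dotZr mulrA -expr2 sqrtrM ?sqr_ge0 // sqrtr_sqr.
Qed.

Lemma enormN x : enorm (- x) = enorm x.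
Proof. by rewrite -scaleN1r enormZ normrN1 mul1r. Qed.

Lemma coord_le_enorm x i : `|x ord0 i| <= enorm x.
Proof.
rewrite -[leLHS]sqrtr_sqr enorm_dot ler_wsqrtr //.
rewrite /dot (bigD1 i) //= -expr2 lerDl; apply: sumr_ge0 => j _.
by rewrite -expr2 sqr_ge0.
Qed.

Lemma enorm_eq0 x : enorm x = 0 -> x = 0.
Proof.
move=> x0; apply/rowP => i; rewrite mxE; apply/eqP; rewrite -normr_le0.
by rewrite -x0 coord_le_enorm.
Qed.

Lemma cauchy_schwarz x y : dot x y <= enorm x * enorm y.
Proof.
have [/enorm_eq0 ->|y0] := eqVneq (enorm y) 0.
  rewrite enorm0 mulr0 /dot big1 // => i _; by rewrite mxE mulr0.
have yp : 0 < enorm y by rewrite lt_def y0 enorm_ge0.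
rewrite -(ler_pM2r yp) -mulrA -expr2 enorm2.
have [d0|d0] := leP (dot x y) 0.
  by rewrite (@le_trans _ _ 0) ?mulr_ge0 ?mulr_le0_ge0 ?enorm_ge0 ?dot_ge0.
have d2 : 0 < dot y y by rewrite -enorm2 exprn_gt0.
have := dot_ge0 (dot y y *: x - dot x y *: y).
rewrite !(dotBl, dotBr, dotZl, dotZr) (dotC y x) => H.
have {}H : dot x y ^+ 2 <= dot x x * dot y y.
  rewrite -subr_ge0 -(pmulr_rge0 _ d2); move: H; congr (0 <= _); ring.
rewrite mulrC -ler_pdivlMl // mulrC.
have : dot x y <= Num.sqrt (dot x x * dot y y).
  by rewrite -[leLHS]gtr0_norm // -sqrtr_sqr ler_wsqrtr.
rewrite sqrtrM ?dot_ge0 // -!enorm_dot => /le_trans; apply.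
by rewrite -enorm2 expr2 mulrA mulrK ?unitfE.
Qed.

Lemma enormD x y : enorm (x + y) <= enorm x + enorm y.
Proof.
rewrite -(@ler_pXn2r _ 2) ?nnegrE ?addr_ge0 ?enorm_ge0 //.
rewrite enorm2 sqrrD !enorm2 !(dotDl, dotDr) (dotC y x).
have := cauchy_schwarz x y; lra.
Qed.

Lemma enormB x y : enorm (x - y) <= enorm x + enorm y.
Proof. by rewrite (le_trans (enormD _ _)) // enormN. Qed.

Lemma enormBC x y : enorm (x - y) = enorm (y - x).
Proof. by rewrite -enormN opprB. Qed.

Lemma enorm_line x v (t : R) :
  dot (t *: v + x) (t *: v + x) = dot x x + 2 * t * dot x v + t * t * dot v v.
Proof. by rewrite !(dotDl, dotDr, dotZl, dotZr) (dotC v x); ring. Qed.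

End Euclid.

(** * Compactness, directional derivatives, and the operator along lines *)

Section Topo.
Variables (R : realType) (d : nat).
Local Notation pt := (pt R d).
Implicit Types (x y z v w : pt) (f g : pt -> R).

Lemma cvg_sumr (I : finType) (T : Type) (F : set_system T) (FF : Filter F)
  (h : I -> T -> R) (l : I -> R) :
  (forall i, h i x @[x --> F] --> l i) ->
  \sum_i h i x @[x --> F] --> \sum_i l i.
Proof.
move=> H; apply: (@cvg_big _ _ _ _ _ _ _ F) => //.
by move=> [a b]; apply: cvgD; [exact: cvg_fst|exact: cvg_snd].
Qed.

Lemma cvg_coord (T : Type) (F : set_system T) (FF : Filter F)
  (h : T -> pt) x i : h @ F --> x -> h t ord0 i @[t --> F] --> x ord0 i.
Proof.
move=> H; apply: (cvg_comp h (fun M : pt => M ord0 i) H); exact: coord_continuous.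
Qed.

Lemma cvg_dot (T : Type) (F : set_system T) (FF : Filter F)
  (h k : T -> pt) x y : h @ F --> x -> k @ F --> y ->
  dot (h t) (k t) @[t --> F] --> dot x y.
Proof.
by move=> Hh Hk; apply: cvg_sumr => i; apply: cvgM; exact: cvg_coord.
Qed.

Lemma cvg_enorm (T : Type) (F : set_system T) (FF : Filter F)
  (h : T -> pt) x : h @ F --> x -> enorm (h t) @[t --> F] --> enorm x.
Proof.
move=> H; rewrite enorm_dot; under eq_cvg do rewrite enorm_dot.
apply: (cvg_comp (fun t => dot (h t) (h t)) (@Num.sqrt R) (cvg_dot FF H H)).
exact: sqrt_continuous.
Qed.

Lemma enorm_continuous : continuous (fun x : pt => enorm x).
Proof. by move=> x; apply: (@cvg_enorm pt (nbhs x) _ id x); exact: cvg_id. Qed.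

Lemma mxnorm_le v (r : R) : 0 <= r -> (forall i, `|v ord0 i| <= r) -> `|v| <= r.
Proof.
move=> r0 H; rewrite [leLHS]/Num.norm /= mx_normrE.
by apply: bigmax_le => // -[i j] _ /=; rewrite (ord1 i); exact: H.
Qed.

(** The topology of row vectors is that of the sup norm, so boundedness is checked coordinatewise
    and closedness comes from continuity of [enorm]. *)
Lemma compact_eball (x0 : pt) (r : R) : compact [set x : pt | enorm (x - x0) <= r].
Proof.
apply: bounded_closed_compact.
  exists (enorm x0 + `|r|); split; first exact: num_real.
  move=> M hM v /= hv; apply: le_trans (ltW hM).
  apply: mxnorm_le => [|i]; first by rewrite addr_ge0 ?enorm_ge0.
  rewrite (le_trans (coord_le_enorm _ _)) // -(subrK x0 v) addrC.
  by rewrite (le_trans (enormD _ _)) // lerD2l (le_trans hv) // ler_norm.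
have : continuous (fun x : pt => enorm (x - x0)).
    move=> x; apply: (@cvg_enorm pt (nbhs x) _ (fun x => x - x0)).
    by apply: cvgB; [exact: cvg_id|exact: cvg_cst].
  move=> /continuous_closedP /(_ [set s | s <= r] (@closed_le R r)); exact.
Qed.

Lemma compact_eball0 (r : R) : compact [set x : pt | enorm x <= r].
Proof.
by have := @compact_eball 0 r; congr compact; apply/seteqP; split=> x /=;
  rewrite subr0.
Qed.

Lemma EVT_within (T : topologicalType) (K : set T) (F : T -> R) :
  K !=set0 -> compact K -> (forall q, K q -> F @ within K (nbhs q) --> F q) ->
  exists2 q, K q & forall q', K q' -> F q <= F q'.
Proof.
move=> K0 cK cF; have /(compact_EVT_min K0 cK)[c] : {within K, continuous F}.
  exact/subspace_continuousP.
by rewrite inE => Kc H; exists c => // q' Kq'; apply: H; rewrite inE.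
Qed.

Definition Dv f x v : R := \sum_i v ord0 i * dpart i f x.
Definition Hv f x v : R := \sum_i \sum_j v ord0 i * v ord0 j * dpart j (dpart i f) x.

Lemma C1_is_derive f : (forall x i, derivable f x (ei R i)) ->
  (forall i, continuous (dpart i f)) -> forall x v, is_derive x v f (Dv f x v).
Proof.
move=> df cf x v.
have key (s : seq 'I_d) : is_derive x (\sum_(i <- s) v ord0 i *: ei R i) f
    (\sum_(i <- s) v ord0 i * dpart i f x).
  elim: s => [|i s IH]; first by rewrite !big_nil; exact: is_derive0.
  rewrite !big_cons; apply: is_derive_addscale IH _ _ => //; last exact: cf.
have -> : v = \sum_(i <- index_enum 'I_d) v ord0 i *: ei R i.
  exact: row_sum_delta.
have -> : Dv f x (\sum_(i <- index_enum 'I_d) v ord0 i *: ei R i) =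
  \sum_(i <- index_enum 'I_d) v ord0 i * dpart i f x.
  by rewrite /Dv -row_sum_delta.
exact: key.
Qed.

Lemma C2_line f x v (s : R) : C2 f ->
  is_derive s 1 (fun s : R => f (s *: v + x)) (Dv f (s *: v + x) v).
Proof.
by move=> [_ [df [cf _]]]; apply: is_derive_line; exact: C1_is_derive.
Qed.

Lemma C2_line2 f x v : C2 f ->
  is_derive (0 : R) 1 (fun s : R => Dv f (s *: v + x) v) (Hv f x v).
Proof.
move=> [_ [df [cf [ddf cdf]]]].
have -> : Hv f x v = \sum_(i < d) v ord0 i * Dv (dpart i f) x v.
  apply: eq_bigr => i _; rewrite mulr_sumr; apply: eq_bigr => j _.
  by rewrite mulrA.
have -> : (fun s : R => Dv f (s *: v + x) v) =
  \sum_(i < d) (fun s : R => v ord0 i * dpart i f (s *: v + x)).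
  by apply/funext => s; rewrite fct_sumE.
apply: is_derive_sum => i.
apply: (@is_deriveZ _ _ _ (fun s : R => dpart i f (s *: v + x))).
apply: is_derive_line; rewrite scale0r add0r.
by apply: C1_is_derive; [move=> y j; exact: ddf|move=> j; exact: cdf].
Qed.

Lemma C2_cst (k : R) : C2 (fun _ : pt => k).
Proof.
have d0 i : dpart i (fun _ : pt => k) = (fun _ => 0).
  by apply/funext => x; rewrite /dpart derive_cst.
split; first exact: cst_continuous.
split; first by move=> x i; exact: derivable_cst.
split; first by move=> i; rewrite d0; exact: cst_continuous.
split; first by move=> x i j; rewrite d0; exact: derivable_cst.
move=> i j; rewrite d0.
have -> : dpart j (fun _ : pt => 0) = (fun _ => 0 : R).
  by apply/funext => x; rewrite /dpart derive_cst.
exact: cst_continuous.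
Qed.

(** The points may move in different directions [v] and [w]: doubling of variables takes weights 1
    and -1 and lets a coupling choose the pair. Equal points and directions, or a zero weight, give
    the ordinary tests at an extremum. *)
Lemma two_point_test f g x y v w (k l A B E : R) : C2 f -> C2 g ->
  (\forall t \near (0 : R), k * f (t *: v + x) + l * g (t *: w + y) <=
    k * f x + l * g y + A * t + B * (t * t) + E * `|t| * (t * t)) ->
  k * Dv f x v + l * Dv g y w = A /\ k * Hv f x v + l * Hv g y w <= 2 * B.
Proof.
move=> Cf Cg H.
have D1 (t : R) : is_derive t 1
    (fun t : R => k * f (t *: v + x) + l * g (t *: w + y))
    (k * Dv f (t *: v + x) v + l * Dv g (t *: w + y) w).
  apply: (@is_deriveD _ _ _ (fun t : R => k * f (t *: v + x))
    (fun t : R => l * g (t *: w + y))).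
    by apply: (@is_deriveZ _ _ _ (fun t : R => f (t *: v + x))); exact: C2_line.
  by apply: (@is_deriveZ _ _ _ (fun t : R => g (t *: w + y))); exact: C2_line.
have D2 : is_derive (0 : R) 1
    (fun t : R => k * Dv f (t *: v + x) v + l * Dv g (t *: w + y) w)
    (k * Hv f x v + l * Hv g y w).
  apply: (@is_deriveD _ _ _ (fun t : R => k * Dv f (t *: v + x) v)
    (fun t : R => l * Dv g (t *: w + y) w)).
    by apply: (@is_deriveZ _ _ _ (fun t : R => Dv f (t *: v + x) v)); exact: C2_line2.
  by apply: (@is_deriveZ _ _ _ (fun t : R => Dv g (t *: w + y) w)); exact: C2_line2.
have /= := @second_order_test _ _ _ _ A B E D1 D2.
by rewrite !scale0r !add0r => /(_ H).
Qed.

Lemma one_point_test f x v (k A B E : R) : C2 f ->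
  (\forall t \near (0 : R), k * f (t *: v + x) <=
    k * f x + A * t + B * (t * t) + E * `|t| * (t * t)) ->
  k * Dv f x v = A /\ k * Hv f x v <= 2 * B.
Proof.
move=> Cf H; have := @two_point_test f f x x v 0 k 0 A B E Cf Cf.
rewrite !mul0r !addr0; apply; apply: filterS H => t.
by rewrite !mul0r !addr0.
Qed.

(** Splitting [Q x] into rank-one terms reduces the trace to second derivatives along lines through
    [x], where the one-dimensional tests apply. *)
Lemma Aop_decomp (Q : pt -> 'M[R]_d) b f x (vs : seq pt) :
  (forall i j, Q x i j = \sum_(v <- vs) v ord0 i * v ord0 j) ->
  Aop Q b f x = \sum_(v <- vs) Hv f x v + Dv f x (b x).
Proof.
move=> HQ; rewrite /Aop; congr (_ + _).
under eq_bigr => i _ do under eq_bigr => j _ do rewrite HQ mulr_suml.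
under eq_bigr => i _ do rewrite exchange_big.
by rewrite exchange_big.
Qed.

Lemma psd_vectors (M : 'M[R]_d) : M^T = M ->
  (forall v, 0 <= qform M (v ord0)) ->
  exists vs : seq pt, forall i j, M i j = \sum_(v <- vs) v ord0 i * v ord0 j.
Proof.
move=> sM pM; have symM i j : M i j = M j i by rewrite -{1}sM mxE.
have [v|vs Hvs] := psd_decomp symM.
  have := pM (\row_i v i); congr (0 <= qform _ _); apply/funext => i.
  by rewrite mxE.
exists (map (fun v : 'I_d -> R => \row_i v i) vs) => i j.
by rewrite Hvs big_map; apply: eq_bigr => v _; rewrite !mxE.
Qed.

(* The minimum of the quadratic form over the unit sphere is an eigenvalue. *)
Lemma eigenvalue_lower_bound (M : 'M[R]_d) (kappa : R) : M^T = M ->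
  (forall l, eigenvalue M l -> kappa <= l) ->
  forall v, kappa * dot v v <= qform M (v ord0).
Proof.
move=> sM Hk v.
have qE (u w : pt) (s : R) : qform M ((u + s *: w) ord0) =
   qform M (u ord0) + 2 * s * dot (u *m M) w + s ^+ 2 * qform M (w ord0).
  have E1 : dot (u *m M) w = \sum_i \sum_j u ord0 i * M i j * w ord0 j.
    rewrite exchange_big /dot /=; apply: eq_bigr => j _.
    by rewrite mxE mulr_suml; apply: eq_bigr => i _.
  have E2 : dot (u *m M) w = \sum_i \sum_j w ord0 i * M i j * u ord0 j.
    rewrite E1 exchange_big /=; apply: eq_bigr => j _; apply: eq_bigr => i _.
    by rewrite -{1}sM mxE; ring.
  have -> : 2 * s * dot (u *m M) w = s * dot (u *m M) w + s * dot (u *m M) w by ring.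
  rewrite {1}E1 E2 /qform !mulr_sumr -!big_split /=; apply: eq_bigr => i _.
  rewrite !mulr_sumr -!big_split /=; apply: eq_bigr => j _; rewrite !mxE; ring.
have qZ (s : R) (u : pt) : qform M ((s *: u) ord0) = s ^+ 2 * qform M (u ord0).
  rewrite /qform mulr_sumr; apply: eq_bigr => i _; rewrite mulr_sumr.
  by apply: eq_bigr => j _; rewrite !mxE; ring.
have [->|v0] := eqVneq v 0.
  rewrite -(scale0r 0) qZ dotZl; lra.
have nz (u : pt) : u != 0 -> 0 < enorm u.
  by move=> u0; rewrite lt_def enorm_ge0 andbT; apply: contra_neq u0; exact: enorm_eq0.
pose K := [set x : pt | enorm x = 1].
have K0 : K !=set0.
  exists ((enorm v)^-1 *: v); rewrite /K /= enormZ ger0_norm ?invr_ge0 ?enorm_ge0 //.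
  by rewrite mulVf // gt_eqF // nz.
have cK : compact K.
  apply: subclosed_compact (@compact_eball0 1) _; last by move=> x /= ->.
  have /continuous_closedP /(_ [set 1] (@closed_eq R 1)) := enorm_continuous.
  exact.
have [x|e Ke emin] := EVT_within (F := fun x => qform M (x ord0)) K0 cK.
  move=> Kx; apply: cvg_within_filter; apply: cvg_sumr => i; apply: cvg_sumr => j.
  apply: cvgM; last by apply: cvg_coord; exact: cvg_id.
  by apply: cvgM; [apply: cvg_coord; exact: cvg_id|exact: cvg_cst].
pose l := qform M (e ord0).
have de : dot e e = 1 by rewrite -enorm2 Ke expr1n.
have lmin (u : pt) : l * dot u u <= qform M (u ord0).
  have [->|u0] := eqVneq u 0; first by rewrite -(scale0r 0) qZ dotZl; lra.
  have up := nz u u0.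
  have := emin ((enorm u)^-1 *: u).
  rewrite /K /= enormZ ger0_norm ?invr_ge0 ?enorm_ge0 // mulVf ?gt_eqF //.
  move=> /(_ erefl); rewrite qZ -enorm2 exprVn -/l ler_pdivlMl ?exprn_gt0 //.
  by rewrite mulrC.
(* Lagrange condition: for the residual [w] of the eigenvalue equation, moving from [e] to [e + s w]
   changes the form minus [l |.|^2] by [2 s |w|^2 + O(s^2)]. This stays nonnegative for both signs
   of [s] only if [w = 0]. *)
have eM : e *m M = l *: e.
  apply/eqP; rewrite -subr_eq0; apply/eqP/enorm_eq0.
  have [w wE] : exists w, w = e *m M - l *: e by eexists.
  rewrite -wE.
  have H (s : R) : 0 <= 2 * s * dot w w + s ^+ 2 * (qform M (w ord0) - l * dot w w).
    have := lmin (e + s *: w); rewrite qE -/l.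
    have -> : dot (e *m M) w = dot w w + l * dot e w.
      by rewrite {2}wE dotBl dotZl subrK.
    rewrite !(dotDl, dotDr, dotZl, dotZr) de (dotC w e); lra.
  have [|dw] := eqVneq (dot w w) 0.
    by rewrite enorm_dot => ->; rewrite sqrtr0.
  have dw0 : 0 < dot w w by rewrite lt_def dw dot_ge0.
  exfalso; set p := qform M (w ord0) - l * dot w w in H.
  have p0 : 0 <= p by rewrite subr_ge0.
  have := H (- dot w w / (p + 1)).
  have -> : 2 * (- dot w w / (p + 1)) * dot w w + (- dot w w / (p + 1)) ^+ 2 * p =
     - (dot w w / (p + 1)) ^+ 2 * (p + 2).
    by field; rewrite gt_eqF //; lra.
  have : 0 < (dot w w / (p + 1)) ^+ 2 * (p + 2).
    by rewrite mulr_gt0 ?exprn_gt0 ?divr_gt0 //; lra.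
  lra.
have : kappa <= l.
  apply: Hk; apply/eigenvalueP; exists e => //.
  apply/negP => /eqP e0; move: Ke; rewrite /K /= e0 enorm0; lra.
by move=> kl; apply: le_trans (lmin v); rewrite ler_wpM2r // dot_ge0.
Qed.

End Topo.

(** * Calculus of functions that are once differentiable in time and twice in space *)

Section C12Facts.
Variables (R : realType) (d : nat).
Local Notation pt := (pt R d).
Implicit Types (w : R -> pt -> R) (f g : pt -> R).

Lemma C12_cvg w (K : set (R * pt)) (q : R * pt) : C12 w ->
  (forall q, K q -> 0 <= q.1) -> 0 <= q.1 ->
  w q'.1 q'.2 @[q' --> within K (nbhs q)] --> w q.1 q.2.
Proof.
move=> [/subspace_continuousP cw _] K0 q0.
apply: cvg_trans (cw q q0); apply: cvg_app.
by apply: within_subset => q' /K0.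
Qed.

Lemma cvg_pair_slice (T : topologicalType) (h : R * pt -> T) (t : R) (x : pt) :
  {for (t, x), continuous h} -> h (t, y) @[y --> x] --> h (t, x).
Proof.
move=> ch; apply: (cvg_comp (fun y : pt => (t, y)) h _ ch).
exact: (cvg_pair (cvg_cst t) (@cvg_id _ (nbhs x))).
Qed.

Lemma near_fst_gt0 (q : R * pt) : 0 < q.1 -> \forall q' \near q, 0 < q'.1.
Proof.
move=> q0; have /cvgrPdist_lt/(_ _ q0) : q'.1 @[q' --> q] --> q.1.
  exact: cvg_fst.
by apply: filterS => q'; rewrite ltr_norml => /andP[_]; lra.
Qed.

Lemma C12_C2 w t : C12 w -> 0 < t -> C2 (w t).
Proof.
move=> Cw t0.
have cw := Cw; case: Cw => _ [_ [d1 [d2 [_ [c1 c2]]]]].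
split.
  move=> x.
  have := @C12_cvg w [set q | 0 <= q.1] (t, x) cw (fun _ => id) (ltW t0).
  move=> H; apply: (cvg_comp (fun y : pt => (t, y)) (fun q => w q.1 q.2) _ H).
  move=> A [/= B Bt BA].
  have ct : (t, y) @[y --> x] --> (t, x).
    exact: (cvg_pair (cvg_cst t) (@cvg_id _ (nbhs x))).
  have nA : nbhs (t, x) (fun q => 0 <= q.1 -> A q) by exists B.
  have nB : nbhs x (fun y => 0 <= t -> A (t, y)) by exact: ct nA.
  by apply: filterS nB => y; apply; exact: ltW.
split; first by move=> x i; exact: d1.
split; first by move=> i x; apply: (cvg_pair_slice (c1 i (t, x) t0)).
split; first by move=> x i j; exact: d2.
by move=> i j x; apply: (cvg_pair_slice (c2 i j (t, x) t0)).
Qed.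

Lemma C12_is_derive w (t : R) x : C12 w -> 0 < t ->
  is_derive t 1 (fun s => w s x) ('D_1 (fun s => w s x) t).
Proof. by move=> [_ [dw _]] t0; apply/derivableP; exact: dw. Qed.

Lemma is_derive_lin (V : normedModType R) (h1 h2 : V -> R) (x v : V) (k l D1 D2 : R) :
  is_derive x v h1 D1 -> is_derive x v h2 D2 ->
  is_derive x v (fun y => k * h1 y + l * h2 y) (k * D1 + l * D2).
Proof.
by move=> H1 H2; apply: (@is_deriveD _ _ _ (fun y => k * h1 y) (fun y => l * h2 y)).
Qed.

Lemma dpart_lin f g (k l : R) i : (forall x i, derivable f x (ei R i)) ->
  (forall x i, derivable g x (ei R i)) ->
  dpart i (fun x => k * f x + l * g x) = fun x => k * dpart i f x + l * dpart i g x.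
Proof.
move=> df dg; apply/funext => x.
have := is_derive_lin k l (derivableP (df x i)) (derivableP (dg x i)).
by move=> [_ E]; rewrite /dpart E.
Qed.

Lemma dpart2_lin f g (k l : R) i j : C2 f -> C2 g ->
  dpart j (dpart i (fun x => k * f x + l * g x)) =
  fun x => k * dpart j (dpart i f) x + l * dpart j (dpart i g) x.
Proof.
move=> [_ [f1 [_ [f2 _]]]] [_ [g1 [_ [g2 _]]]]; rewrite dpart_lin //.
by apply/funext => x; have [_ E] := is_derive_lin k l
  (derivableP (f2 x i j)) (derivableP (g2 x i j)); rewrite /dpart E.
Qed.

Lemma Aop_lin (Q : pt -> 'M[R]_d) b f g (k l : R) x : C2 f -> C2 g ->
  Aop Q b (fun x => k * f x + l * g x) x = k * Aop Q b f x + l * Aop Q b g x.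
Proof.
move=> Cf Cg; rewrite /Aop !mulrDr addrACA; congr (_ + _).
  rewrite !mulr_sumr -big_split; apply: eq_bigr => i _.
  rewrite !mulr_sumr -big_split; apply: eq_bigr => j _.
  rewrite dpart2_lin // /=.
  by move: (Q x i j) (dpart j _ x) (dpart j _ x) => q0 f0 g0; ring.
rewrite !mulr_sumr -big_split; apply: eq_bigr => i _.
by rewrite dpart_lin /=; [ring|case: Cf => _ []|case: Cg => _ []].
Qed.

Lemma cvg_lin (T : Type) (F : set_system T) (FF : Filter F) (h1 h2 : T -> R)
  (k l l1 l2 : R) : h1 @ F --> l1 -> h2 @ F --> l2 ->
  k * h1 t + l * h2 t @[t --> F] --> k * l1 + l * l2.
Proof.
by move=> H1 H2; apply: cvgD; apply: cvgM => //; exact: cvg_cst.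
Qed.

(** Agreement near [q] is the right hypothesis because the formulas for derivatives of [C12]
    functions are available at positive times only. *)
Lemma near_lin_continuous (T : topologicalType) (h h1 h2 : T -> R) (q : T) (k l : R) :
  {for q, continuous h1} -> {for q, continuous h2} ->
  (\forall q' \near q, h q' = k * h1 q' + l * h2 q') -> {for q, continuous h}.
Proof.
move=> c1 c2 E.
have : k * h1 q' + l * h2 q' @[q' --> q] --> k * h1 q + l * h2 q.
  exact: cvg_lin.
rewrite -(nbhs_singleton E) => H; apply: cvg_trans H; apply: near_eq_cvg.
by apply: filterS E => q' ->.
Qed.

Lemma C12_lin w1 w2 (k l : R) : C12 w1 -> C12 w2 ->
  C12 (fun t x => k * w1 t x + l * w2 t x).
Proof.
move=> C1 C2'.
have C2t1 t (t0 : 0 < t) := C12_C2 C1 t0.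
have C2t2 t (t0 : 0 < t) := C12_C2 C2' t0.
have nearpos (q : R * pt) : 0 < q.1 -> \forall q' \near q, 0 < q'.1.
  exact: near_fst_gt0.
split.
  apply/subspace_continuousP => q q0; apply: cvg_lin; exact: C12_cvg.
split.
  move=> t x t0; have [] := is_derive_lin k l (C12_is_derive x C1 t0)
    (C12_is_derive x C2' t0); by [].
split.
  move=> t x i t0; have [_ [d1 _]] := C2t1 t t0; have [_ [d2 _]] := C2t2 t t0.
  by have [] := is_derive_lin k l (derivableP (d1 x i)) (derivableP (d2 x i)).
split.
  move=> t x i j t0; have [_ [d1 [_ [e1 _]]]] := C2t1 t t0.
  have [_ [d2 [_ [e2 _]]]] := C2t2 t t0; rewrite dpart_lin //.
  by have [] := is_derive_lin k l (derivableP (e1 x i j)) (derivableP (e2 x i j)).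
have [_ [_ [_ [_ [ct1 [cx1 cxx1]]]]]] := C1.
have [_ [_ [_ [_ [ct2 [cx2 cxx2]]]]]] := C2'.
split.
  move=> q q0.
  have E s y : 0 < s -> 'D_1 (fun s => k * w1 s y + l * w2 s y) s =
    k * 'D_1 (w1^~ y) s + l * 'D_1 (w2^~ y) s.
    move=> s0; have [_] := is_derive_lin k l (C12_is_derive y C1 s0)
      (C12_is_derive y C2' s0); by [].
  apply: (near_lin_continuous (ct1 q q0) (ct2 q q0)).
  by apply: filterS (nearpos q q0) => q' q0'; rewrite E.
split.
  move=> i q q0.
  have E s y : 0 < s -> dpart i (fun x => k * w1 s x + l * w2 s x) y =
    k * dpart i (w1 s) y + l * dpart i (w2 s) y.
    move=> s0; have [_ [d1 _]] := C2t1 s s0; have [_ [d2 _]] := C2t2 s s0.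
    by rewrite dpart_lin.
  apply: (near_lin_continuous (cx1 i q q0) (cx2 i q q0)).
  by apply: filterS (nearpos q q0) => q' q0'; rewrite E.
move=> i j q q0.
have E s y : 0 < s -> dpart j (dpart i (fun x => k * w1 s x + l * w2 s x)) y =
    k * dpart j (dpart i (w1 s)) y + l * dpart j (dpart i (w2 s)) y.
  by move=> s0; rewrite dpart2_lin //; [exact: C2t1|exact: C2t2].
apply: (near_lin_continuous (cxx1 i j q q0) (cxx2 i j q q0)).
by apply: filterS (nearpos q q0) => q' q0'; rewrite E.
Qed.

Lemma strip_bounded_lin w1 w2 (k l : R) : strip_bounded w1 -> strip_bounded w2 ->
  strip_bounded (fun t x => k * w1 t x + l * w2 t x).
Proof.
move=> B1 B2 T; have [M1 H1] := B1 T; have [M2 H2] := B2 T.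
exists (`|k| * M1 + `|l| * M2) => t x tT.
rewrite (le_trans (ler_normD _ _)) // !normrM.
by rewrite lerD // ler_wpM2l // ?H1 ?H2.
Qed.

Lemma C12_cst (k : R) : C12 (fun (_ : R) (_ : pt) => k).
Proof.
have Ck := C2_cst d k.
case: (Ck) => c0 [c1 [c2 [c3 c4]]].
have d0 i : dpart i (fun _ : pt => k) = (fun _ => 0).
  by apply/funext => x; rewrite /dpart derive_cst.
have d00 j : dpart j (fun _ : pt => 0) = (fun _ => 0 : R).
  by apply/funext => x; rewrite /dpart derive_cst.
split; first by apply/subspace_continuousP => q _; exact: cvg_cst.
split; first by move=> t x _; exact: derivable_cst.
split; first by move=> t x i _; exact: c1.
split; first by move=> t x i j _; exact: c3.
split.
  move=> q _.
  have -> : (fun q : R * pt => 'D_1 (fun _ : R => k) q.1) = (fun=> 0).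
    by apply/funext => q'; exact: derive_cst.
  exact: cst_continuous.
split; first by move=> i q _; rewrite d0; exact: cst_continuous.
by move=> i j q _; rewrite d0 d00; exact: cst_continuous.
Qed.

Lemma C12_shift w (s : R) : 0 < s -> C12 w -> C12 (fun t => w (s + t)).
Proof.
move=> s0 Cw; have := Cw; move=> [_ [dt [dx [dxx [ct [cx cxx]]]]]].
have pos t : 0 < t -> 0 < s + t by move=> t0; rewrite addr_gt0.
have cs (q : R * pt) : (s + q'.1, q'.2) @[q' --> q] --> (s + q.1, q.2).
  have H1 : s + q'.1 @[q' --> q] --> s + q.1.
    by apply: cvgD; [exact: cvg_cst|exact: cvg_fst].
  have H2 : q'.2 @[q' --> q] --> q.2 by exact: cvg_snd.
  exact: (cvg_pair H1 H2).
have Dt (t : R) x : 0 < t -> is_derive t 1 (fun r => w (s + r) x)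
    ('D_1 (fun r => w r x) (s + t)).
  move=> t0; have /is_derive_nearP H := C12_is_derive x Cw (pos t t0).
  apply/is_derive_nearP => e /H; apply: filterS => h.
  by rewrite addrCA.
split.
  apply/subspace_continuousP => q q0.
  have H := @C12_cvg w [set q | 0 <= q.1] (s + q.1, q.2) Cw (fun _ => id)
    (addr_ge0 (ltW s0) q0).
  apply: (cvg_comp (fun q' : R * pt => (s + q'.1, q'.2))
    (fun q => w q.1 q.2) _ H).
  move=> A nA.
  have nB : nbhs q (fun q' : R * pt => 0 <= s + q'.1 -> A (s + q'.1, q'.2)).
    exact: cs q _ nA.
  apply: filterS nB => q' HA q0'; apply: HA.
  by rewrite addr_ge0 // ltW.
split; first by move=> t x t0; have [] := Dt t x t0.
split; first by move=> t x i t0; apply: dx; exact: pos.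
split; first by move=> t x i j t0; apply: dxx; exact: pos.
split.
  move=> q q0; have := ct (s + q.1, q.2) (pos _ q0).
  move=> /(cvg_comp _ _ (cs q)) H.
  apply: (@near_lin_continuous _ _ _ (fun=> 0) q 1 0 H); first exact: cst_continuous.
  apply: filterS (near_fst_gt0 q0) => q' q0'.
  by rewrite mul0r addr0 mul1r /= (@derive_val _ _ _ _ _ _ _ (Dt _ _ q0')).
split.
  by move=> i q q0; have := cx i (s + q.1, q.2) (pos _ q0);
    move=> /(cvg_comp _ _ (cs q)).
by move=> i j q q0; have := cxx i j (s + q.1, q.2) (pos _ q0);
  move=> /(cvg_comp _ _ (cs q)).
Qed.

End C12Facts.

Lemma is_derive_expR_scale (R : realType) (k x : R) :
  is_derive x 1 (fun s : R => expR (k * s)) (k * expR (k * x)).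
Proof.
have D1 : is_derive x 1 (fun s : R => k * s) k.
  have := is_derive_quad k 0 x; rewrite mulr0 mul0r addr0.
  by congr (is_derive _ _ _ _); apply/funext => s; rewrite mul0r addr0.
have := is_derive1_comp (is_derive_expR (k * x)) D1.
by rewrite mulrC.
Qed.

Lemma finite_bound (R : realType) (I : finType) (P : I -> R -> Prop) :
  (forall i, exists M, P i M) ->
  (forall i M M', M <= M' -> P i M -> P i M') -> exists2 M, 0 <= M & forall i, P i M.
Proof.
move=> /choice[M HM] mono; exists (\sum_i `|M i|); first exact: sumr_ge0.
move=> i; apply: mono (HM i); rewrite (le_trans (ler_norm _)) //.
by rewrite (bigD1 i) //= lerDl sumr_ge0.
Qed.

Lemma min_Aop_ge0 (R : realType) (d : nat) (Q : pt R d -> 'M[R]_d) b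
  (f g : pt R d -> R) (k l : R) x : (Q x)^T = Q x ->
  (forall v : pt R d, 0 <= qform (Q x) (v ord0)) -> C2 f -> C2 g ->
  (forall y, k * f x + l * g x <= k * f y + l * g y) ->
  0 <= k * Aop Q b f x + l * Aop Q b g x.
Proof.
move=> sQ pQ Cf Cg mn.
have space v : k * Dv f x v + l * Dv g x v = 0 /\ 0 <= k * Hv f x v + l * Hv g x v.
  have H : \forall t \near (0 : R), - k * f (t *: v + x) + - l * g (t *: v + x) <=
    - k * f x + - l * g x + 0 * t + 0 * (t * t) + 0 * `|t| * (t * t).
    by apply/nbhs_ballP; exists 1 => //= t _; have := mn (t *: v + x); lra.
  have [h1 h2] := @two_point_test _ _ _ _ x x v v (- k) (- l) 0 0 0 Cf Cg H.
  move: (Dv f x v) (Dv g x v) (Hv f x v) (Hv g x v) h1 h2 => f1 g1 f2 g2.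
  by clear=> h1 h2; split; lra.
have [vs Hvs] := psd_vectors sQ pQ.
rewrite !(Aop_decomp _ _ Hvs) !mulrDr addrACA (space (b x)).1 addr0.
by rewrite !mulr_sumr -big_split /=; apply: sumr_ge0 => v _; exact: (space v).2.
Qed.

(** * Maximum principle with a Lyapunov function, and uniqueness *)

Section Comparison.
Variables (R : realType) (d m : nat).
Local Notation pt := (pt R d).
Variables (Q : pt -> 'M[R]_d) (b : pt -> 'rV[R]_d) (C : pt -> 'M[R]_m).
Variables (phi : pt -> R) (a c : R) (xi : 'cV[R]_m).
Hypothesis symQ : forall x, (Q x)^T = Q x.
Hypothesis psdQ : forall x (v : pt), 0 <= qform (Q x) (v ord0).
Hypothesis phi_gt0 : forall x, 0 < phi x.
Hypothesis C2phi : C2 phi.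
Hypothesis phi_inf : forall M : R, exists r : R, forall x, r <= enorm x -> M <= phi x.
Hypothesis a_gt0 : 0 < a.
Hypothesis c_gt0 : 0 < c.
Hypothesis Aphi : forall x, Aop Q b phi x <= a - c * phi x.
Hypothesis coop : forall x h k, h != k -> 0 <= C x h k.
Hypothesis xi_gt0 : forall h, 0 < xi h ord0.
Hypothesis Cxi : forall x h, \sum_k C x h k * xi k ord0 = 0.

(** [C xi = 0] allows [F h] to be subtracted from every ratio. This kills the diagonal term and
    leaves off-diagonal entries times nonnegative differences. *)
Lemma coupling_ge0 x h (F : 'I_m -> R) : (forall k, F h <= F k) ->
  0 <= \sum_k C x h k * (xi k ord0 * F k).
Proof.
move=> Fh.
have -> : \sum_k C x h k * (xi k ord0 * F k) =
    \sum_k C x h k * (xi k ord0 * (F k - F h)).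
  apply/eqP; rewrite -subr_eq0 -sumrB; apply/eqP.
  rewrite (eq_bigr (fun k => C x h k * xi k ord0 * F h)) => [|k _]; last by ring.
  by rewrite -mulr_suml Cxi mul0r.
apply: sumr_ge0 => k _; have [->|kh] := eqVneq k h; first by rewrite subrr !mulr0.
by rewrite mulr_ge0 ?coop 1?eq_sym // mulr_ge0 ?subr_ge0 // ltW.
Qed.

(* The term eps (phi + (a + 1) t) forces the minimum over the strip to be
   attained and makes the differential inequality strict. *)
Lemma lyapunov_comparison u f (beta : R) : system_sol Q b C u f -> 0 <= beta ->
  (forall x i, - (beta * xi i ord0 * phi x) <= f x i ord0) ->
  forall t x i, 0 <= t ->
    - (beta * xi i ord0 * (expR (- c * t) * phi x + a / c * (1 - expR (- c * t))))
    <= u t x i ord0.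
Proof.
move=> [C12u [Bu [u0 Du]]] beta0 Hf t0 x0 i0 t00; rewrite leNgt; apply/negP => neg.
(* [e t * phi + a / c * (1 - e t)] solves [y' = a - c y] with [y(0) = phi], the equation behind the
   Lyapunov inequality. *)
pose e t := expR (- c * t).
have e_ge0 t : 0 <= e t by exact: expR_ge0.
(* [eta] is the amount by which the bound fails, in units of [xi]. Below, [eps] is so small that the
   perturbation consumes less than half of it and [F] stays negative at [(t0, x0)]. *)
pose eta := - (u t0 x0 i0 ord0 / xi i0 ord0 +
   beta * (e t0 * phi x0 + a / c * (1 - e t0))).
have eta0 : 0 < eta.
  rewrite oppr_gt0 -(pmulr_llt0 _ (xi_gt0 i0)) mulrDl mulfVK ?gt_eqF //.
  by rewrite /e; lra.
pose Z := phi x0 + (a + 1) * t0 + 1.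
have Z0 : 0 < Z.
  have h1 := phi_gt0 x0.
  have h2 : 0 <= (a + 1) * t0 by apply: mulr_ge0 => //; rewrite addr_ge0 // ltW.
  by rewrite /Z; lra.
have [eps eps0 epsZ] : exists2 eps, 0 < eps & eps * Z = eta / 2.
  exists (eta / (2 * Z)); first by rewrite divr_gt0 // mulr_gt0.
  by field; rewrite gt_eqF.
pose F i t x := u t x i ord0 / xi i ord0 + (beta * e t + eps) * phi x +
  (beta * (a / c) * (1 - e t) + eps * (a + 1) * t).
have F0 : F i0 t0 x0 < 0.
  have -> : F i0 t0 x0 = - eta + eps * (Z - 1) by rewrite /F /eta /Z; ring.
  lra.
have [N N0 HN] : exists2 N, 0 <= N & forall i t x, 0 <= t <= t0 ->
    `|u t x i ord0 / xi i ord0| <= N.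
  apply: finite_bound => [i|i M M' MM' H t x tt]; last first.
    exact: le_trans (H t x tt) MM'.
  have [M HM] := Bu i t0; exists (M / xi i ord0) => t x tt.
  by rewrite normrM normfV (gtr0_norm (xi_gt0 i)) ler_pM2r ?invr_gt0 // HM.
have [r Hr] := phi_inf (N / eps).
pose rho := Num.max r (enorm x0).
have Fout i t x : 0 <= t <= t0 -> rho < enorm x -> 0 <= F i t x.
  move=> tt rx.
  have h1 : N <= eps * phi x.
    rewrite mulrC -ler_pdivrMr //; apply: Hr.
    by rewrite ltW // (le_lt_trans _ rx) // /rho le_max lexx.
  have := HN i t x tt; rewrite ler_norml => /andP[h2 _].
  have /andP[tp _] := tt.
  have h3 : 0 <= beta * e t * phi x by rewrite !mulr_ge0 // ltW.
  have h4 : 0 <= beta * (a / c) * (1 - e t).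
    apply: mulr_ge0; first by rewrite mulr_ge0 // divr_ge0 // ltW.
    by rewrite subr_ge0 /e -expR0 ler_expR mulNr oppr_le0 mulr_ge0 // ltW.
  have h5 : 0 <= eps * (a + 1) * t by rewrite !mulr_ge0 ?addr_ge0 ?(ltW eps0) ?(ltW a_gt0).
  rewrite /F; lra.
pose K : set (R * pt) := `[0, t0] `*` [set x : pt | enorm x <= rho].
have cK : compact K by apply: compact_setX; [exact: segment_compact|exact: compact_eball0].
have Kx0 : K (t0, x0).
  by split; rewrite /= ?in_itv /= ?t00 ?lexx // /rho le_max lexx orbT.
have Kpos q : K q -> 0 <= q.1 by case; rewrite /= in_itv /= => /andP[].
have /choice[q Hq] i : exists q : R * pt, K q /\ forall q', K q' -> F i q.1 q.2 <= F i q'.1 q'.2.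
  have [q|q Kq Hq] := @EVT_within _ _ K (fun q => F i q.1 q.2) (ex_intro _ _ Kx0) cK.
    move=> Kq.
    have ce : e q'.1 @[q' --> within K (nbhs q)] --> e q.1.
      apply: cvg_within_filter; apply: (cvg_comp (fun q' : R * pt => - c * q'.1) expR).
        by apply: cvgM; [exact: cvg_cst|exact: cvg_fst].
      exact: continuous_expR.
    have cphi : phi q'.2 @[q' --> within K (nbhs q)] --> phi q.2.
      apply: cvg_within_filter; apply: (cvg_comp snd phi); first exact: cvg_snd.
      exact: C2phi.1.
    have ct : q'.1 @[q' --> within K (nbhs q)] --> q.1.
      by apply: cvg_within_filter; exact: cvg_fst.
    apply: cvgD; first apply: cvgD.
    - apply: cvgM; last exact: cvg_cst.
      by apply: (@C12_cvg _ _ (fun t x => u t x i ord0)) => //; exact: Kpos.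
    - apply: cvgM => //; apply: cvgD; last exact: cvg_cst.
      by apply: cvgM => //; exact: cvg_cst.
    - apply: cvgD; last by apply: cvgM => //; exact: cvg_cst.
      apply: cvgM; first exact: cvg_cst.
      by apply: cvgB => //; exact: cvg_cst.
  by exists q.
(* The [F k] differ from the ratios [u_k / xi_k] by a common term. Minimising over the component as
   well makes [i] the smallest ratio at the minimum point, as [coupling_ge0] requires. *)
pose i := [arg min_(i < i0) F i (q i).1 (q i).2]%O.
have Hi k : F i (q i).1 (q i).2 <= F k (q k).1 (q k).2.
  by rewrite /i; case: Order.TotalTheory.arg_minP => // j _; apply.
set th := (q i).1; set xh := (q i).2.
have Fneg : F i th xh < 0.
  by apply: le_lt_trans F0; apply: le_trans (Hi i0) _; exact: (Hq i0).2 Kx0.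
have Fmin k t x : 0 <= t <= t0 -> F i th xh <= F k t x.
  move=> tt; have [xr|xr] := leP (enorm x) rho.
    by apply: le_trans (Hi k) _; apply: ((Hq k).2 (t, x)); split => //=; rewrite in_itv.
  by rewrite (le_trans (ltW Fneg)) // Fout.
have [[]] := Hq i; rewrite /= in_itv /= -/th -/xh => tht0 xhr _.
have th0 : 0 < th.
  rewrite lt_def (andP tht0).1 andbT; apply/negP => /eqP th0.
  move: Fneg; rewrite /F th0 /e u0 mulr0 expR0.
  have := Hf xh i; rewrite -(ler_pM2r (x := (xi i ord0)^-1)) ?invr_gt0 //.
  have -> : - (beta * xi i ord0 * phi xh) / xi i ord0 = - (beta * phi xh).
    by field; rewrite gt_eqF.
  have : 0 < eps * phi xh by rewrite mulr_gt0.
  lra.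
have C2u : C2 (fun x => u th x i ord0) by exact: (C12_C2 (C12u i)).
have spaceA : 0 <= (xi i ord0)^-1 * Aop Q b (fun x => u th x i ord0) xh +
    (beta * e th + eps) * Aop Q b phi xh.
  apply: min_Aop_ge0 => // y; have := Fmin i th y tht0; rewrite /F; lra.
have Dt := C12_is_derive xh (C12u i) th0.
have timeD : is_derive th 1 (fun s => F i s xh)
   ((xi i ord0)^-1 * 'D_1 (fun s => u s xh i ord0) th +
    (- (c * beta * e th) * phi xh + (beta * a * e th + eps * (a + 1)))).
  have H1 := is_derive_lin (xi i ord0)^-1 (beta * phi xh - beta * (a / c)) Dt
    (is_derive_expR_scale (- c) th).
  have H2 := is_deriveD H1 (is_derive_quad (eps * (a + 1)) 0 th).
  have H3 := is_deriveD H2 (is_derive_cst (eps * phi xh + beta * (a / c)) th 1).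
  have -> : (fun s => F i s xh) = (fun y => (xi i ord0)^-1 * u y xh i ord0 +
     (beta * phi xh - beta * (a / c)) * expR (- c * y)) +
     (fun t => eps * (a + 1) * t + 0 * (t * t)) + cst (eps * phi xh + beta * (a / c)).
    by apply/funext => s; rewrite /F /e !fctE /=; ring.
  by apply: is_derive_eq H3 _; rewrite /e; field; rewrite !gt_eqF.
have time := derive_left_le0 timeD.
have {}time : (xi i ord0)^-1 * 'D_1 (fun s => u s xh i ord0) th +
    (- (c * beta * e th) * phi xh + (beta * a * e th + eps * (a + 1))) <= 0.
  apply: time; near=> s; apply: Fmin; apply/andP; split.
    by apply: ltW; near: s; exact: nbhs_left_gt.
  by rewrite (le_trans _ (andP tht0).2) //; near: s; exact: nbhs_left_le.
have PDE := Du th xh i th0; rewrite mxE in PDE.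
have coupl : 0 <= \sum_k C xh i k * u th xh k ord0.
  have := @coupling_ge0 xh i (fun k => F k th xh) (fun k => Fmin k th xh tht0).
  have -> // : \sum_k C xh i k * (xi k ord0 * F k th xh) = \sum_k C xh i k * u th xh k ord0.
  pose G := (beta * e th + eps) * phi xh +
    (beta * (a / c) * (1 - e th) + eps * (a + 1) * th).
  rewrite (eq_bigr (fun k => C xh i k * u th xh k ord0 + C xh i k * xi k ord0 * G)).
    by rewrite big_split /= -mulr_suml Cxi mul0r addr0.
  by move=> k _; rewrite /F /G; field; rewrite !gt_eqF.
move: time; rewrite PDE mulrDr.
have : 0 <= (xi i ord0)^-1 * (\sum_k C xh i k * u th xh k ord0).
  by rewrite mulr_ge0 // invr_ge0 ltW.
have : (beta * e th + eps) * Aop Q b phi xh <= (beta * e th + eps) * (a - c * phi xh).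
  by rewrite ler_wpM2l // addr_ge0 ?mulr_ge0 // ltW.
have : 0 < eps * (c * phi xh) by rewrite !mulr_gt0.
move: spaceA; lra.
Unshelve. all: by end_near. Qed.

End Comparison.

Section SystemSol.
Variables (R : realType) (d m : nat).
Local Notation pt := (pt R d).
Variables (Q : pt -> 'M[R]_d) (b : pt -> 'rV[R]_d) (C : pt -> 'M[R]_m).

Lemma system_sol_lin u v f g (k l : R) : system_sol Q b C u f -> system_sol Q b C v g ->
  system_sol Q b C (fun t x => k *: u t x + l *: v t x) (fun x => k *: f x + l *: g x).
Proof.
move=> [Cu [Bu [u0 Du]]] [Cv [Bv [v0 Dv']]].
have E h : (fun t (x : pt) => (k *: u t x + l *: v t x) h ord0) =
    (fun t x => k * u t x h ord0 + l * v t x h ord0).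
  by apply/funext => t; apply/funext => x; rewrite !mxE.
split; first by move=> h; rewrite E; exact: C12_lin.
split; first by move=> h; rewrite E; exact: strip_bounded_lin.
split; first by move=> x; rewrite u0 v0.
move=> t x h t0.
have [_] := is_derive_lin k l (C12_is_derive x (Cu h) t0) (C12_is_derive x (Cv h) t0).
have -> : (fun s : R => (k *: u s x + l *: v s x) h ord0) =
    (fun s => k * u s x h ord0 + l * v s x h ord0).
  by apply/funext => s; rewrite !mxE.
move=> ->; rewrite Du // Dv' // !mxE.
have -> : (fun y => (k *: u t y + l *: v t y) h ord0) =
    (fun y => k * u t y h ord0 + l * v t y h ord0).
  by apply/funext => s; rewrite !mxE.
rewrite (Aop_lin _ _ _ _ _ (C12_C2 (Cu h) t0) (C12_C2 (Cv h) t0)).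
rewrite !mulrDr addrACA; congr (_ + _); rewrite !mulr_sumr -big_split.
by apply: eq_bigr => i _; rewrite !mxE /=; ring.
Qed.

Lemma system_sol_shift u f (s : R) : 0 < s -> system_sol Q b C u f ->
  system_sol Q b C (fun t => u (s + t)) (u s).
Proof.
move=> s0 [Cu [Bu [u0 Du]]].
split; first by move=> h; exact: (C12_shift s0 (Cu h)).
split.
  move=> h T; have [M HM] := Bu h (s + T); exists M => t x /andP[t0 tT].
  by apply: HM; rewrite addr_ge0 ?(ltW s0) //= lerD2l.
split; first by move=> x; rewrite addr0.
move=> t x h t0; rewrite -Du; last by rewrite addr_gt0.
have st0 : 0 < s + t by rewrite addr_gt0.
have /is_derive_nearP H := C12_is_derive x (Cu h) st0.
have [] // : is_derive t 1 (fun r => u (s + r) x h ord0)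
  ('D_1 (fun r => u r x h ord0) (s + t)).
by apply/is_derive_nearP => e /H; apply: filterS => r; rewrite addrCA.
Qed.

Lemma system_sol_Cbm u f (t : R) : 0 < t -> system_sol Q b C u f -> Cbm (u t).
Proof.
move=> t0 [Cu [Bu _]] h; split; first exact: (C12_C2 (Cu h) t0).1.
have [M HM] := Bu h t; exists M => x; apply: HM; by rewrite (ltW t0) lexx.
Qed.

Lemma Aop_cst (k : R) x : Aop Q b (fun _ => k) x = 0.
Proof.
have d0 i (l : R) : dpart i (fun _ : pt => l) = (fun _ => 0).
  by apply/funext => y; rewrite /dpart derive_cst.
rewrite /Aop !big1 ?addr0 // => i _; rewrite d0 ?mulr0 //.
by rewrite big1 // => j _; rewrite d0 mulr0.
Qed.

Lemma system_sol_cst (v : 'cV[R]_m) : (forall x, C x *m v = 0) ->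
  system_sol Q b C (fun _ _ => v) (fun _ => v).
Proof.
move=> Cv; split; first by move=> h; exact: C12_cst.
split; first by move=> h T; exists `|v h ord0|.
split=> // t x h t0; transitivity (0 : R); first exact: derive_cst.
rewrite mxE Aop_cst add0r; have := Cv x; move=> /matrixP/(_ h ord0).
by rewrite !mxE => ->.
Qed.

End SystemSol.

Section Uniqueness.
Variables (R : realType) (d m : nat).
Local Notation pt := (pt R d).
Variables (Q : pt -> 'M[R]_d) (b : pt -> 'rV[R]_d) (C : pt -> 'M[R]_m).
Variables (phi : pt -> R) (a c : R) (xi : 'cV[R]_m).
Hypothesis symQ : forall x, (Q x)^T = Q x.
Hypothesis psdQ : forall x (v : pt), 0 <= qform (Q x) (v ord0).
Hypothesis phi_gt0 : forall x, 0 < phi x.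
Hypothesis C2phi : C2 phi.
Hypothesis phi_inf : forall M : R, exists r : R, forall x, r <= enorm x -> M <= phi x.
Hypothesis a_gt0 : 0 < a.
Hypothesis c_gt0 : 0 < c.
Hypothesis Aphi : forall x, Aop Q b phi x <= a - c * phi x.
Hypothesis coop : forall x h k, h != k -> 0 <= C x h k.
Hypothesis xi_gt0 : forall h, 0 < xi h ord0.
Hypothesis Cxi : forall x, C x *m xi = 0.

Lemma Cxi_sum x h : \sum_k C x h k * xi k ord0 = 0.
Proof. by have := Cxi x; move=> /matrixP/(_ h ord0); rewrite !mxE. Qed.

Let comparison := lyapunov_comparison symQ psdQ phi_gt0 C2phi phi_inf a_gt0 c_gt0
  Aphi coop xi_gt0 Cxi_sum.

Lemma system_sol_ge0 u f : system_sol Q b C u f -> (forall x i, 0 <= f x i ord0) ->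
  forall t x i, 0 <= t -> 0 <= u t x i ord0.
Proof.
move=> su f0 t x i t0; have := @comparison u f 0 su (lexx 0) _ t x i t0.
by rewrite !mul0r oppr0; apply=> y j; rewrite !mul0r oppr0.
Qed.

Lemma system_sol_le u v f g : system_sol Q b C u f -> system_sol Q b C v g ->
  (forall x i, f x i ord0 <= g x i ord0) ->
  forall t x i, 0 <= t -> u t x i ord0 <= v t x i ord0.
Proof.
move=> su sv fg t x i t0.
have := @system_sol_ge0 _ _ (system_sol_lin 1 (-1) sv su) _ t x i t0.
rewrite !mxE mul1r mulN1r subr_ge0; apply => y j.
by rewrite !mxE mul1r mulN1r subr_ge0.
Qed.

Lemma system_sol_unique u v f : system_sol Q b C u f -> system_sol Q b C v f ->
  forall t x, 0 <= t -> u t x = v t x.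
Proof.
move=> su sv t x t0; apply/matrixP => i j; rewrite (ord1 j); apply/eqP.
by rewrite eq_le !(@system_sol_le _ _ f f).
Qed.

Lemma system_sol_lyapunov u f (beta : R) : system_sol Q b C u f -> 0 <= beta ->
  (forall x i, `|f x i ord0| <= beta * xi i ord0 * phi x) ->
  forall t x i, 0 <= t -> `|u t x i ord0| <=
    beta * xi i ord0 * (expR (- c * t) * phi x + a / c * (1 - expR (- c * t))).
Proof.
move=> su beta0 Hf t x i t0; rewrite ler_norml; apply/andP; split.
  by apply: (@comparison u f) => // y j; have := Hf y j; rewrite ler_norml => /andP[].
have := @comparison _ _ beta (system_sol_lin (-1) 0 su su) beta0 _ t x i t0.
rewrite !mxE mul0r addr0 mulN1r lerN2; apply => y j.
by rewrite !mxE mul0r addr0 mulN1r lerN2; have := Hf y j; rewrite ler_norml => /andP[].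
Qed.

Lemma system_sol_le_xi u f (M : R) : system_sol Q b C u f ->
  (forall x i, f x i ord0 <= M * xi i ord0) ->
  forall t x i, 0 <= t -> u t x i ord0 <= M * xi i ord0.
Proof.
move=> su Hf t x i t0.
have CM y : C y *m (M *: xi) = 0 by rewrite -scalemxAr Cxi scaler0.
have := @system_sol_le _ _ _ _ su (system_sol_cst Q b CM) _ t x i t0.
by rewrite !mxE; apply => y j; rewrite !mxE.
Qed.

Lemma system_sol_ge_xi u f (M : R) : system_sol Q b C u f ->
  (forall x i, M * xi i ord0 <= f x i ord0) ->
  forall t x i, 0 <= t -> M * xi i ord0 <= u t x i ord0.
Proof.
move=> su Hf t x i t0.
have CM y : C y *m (M *: xi) = 0 by rewrite -scalemxAr Cxi scaler0.
have := @system_sol_le _ _ _ _ (system_sol_cst Q b CM) su _ t x i t0.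
by rewrite !mxE; apply => y j; rewrite !mxE.
Qed.

End Uniqueness.

(** * Propagation of positivity *)

Section Barrier.
Variables (R : realType) (d : nat).
Local Notation pt := (pt R d).
Variables (Q : pt -> 'M[R]_d) (b : pt -> 'rV[R]_d) (kappa : R).
Hypothesis symQ : forall x, (Q x)^T = Q x.
Hypothesis kappa_gt0 : 0 < kappa.
Hypothesis ellQ : forall x (v : pt), kappa * dot v v <= qform (Q x) (v ord0).

Lemma psdQ_of_elliptic x (v : pt) : 0 <= qform (Q x) (v ord0).
Proof. by apply: le_trans (ellQ x v); rewrite mulr_ge0 ?dot_ge0 // ltW. Qed.

Lemma trace_decomp x (vs : seq pt) :
  (forall i j, Q x i j = \sum_(v <- vs) v ord0 i * v ord0 j) ->
  \tr (Q x) = \sum_(v <- vs) dot v v.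
Proof.
move=> H; rewrite /mxtrace; under eq_bigr do rewrite H.
by rewrite exchange_big.
Qed.

Lemma qform_decomp x (vs : seq pt) (p : pt) :
  (forall i j, Q x i j = \sum_(v <- vs) v ord0 i * v ord0 j) ->
  qform (Q x) (p ord0) = \sum_(v <- vs) dot p v ^+ 2.
Proof.
move=> H; rewrite /qform.
under eq_bigr => i _ do under eq_bigr => j _ do rewrite H mulr_sumr mulr_suml.
under eq_bigr => i _ do rewrite exchange_big.
rewrite exchange_big /=; apply: eq_bigr => v _.
rewrite expr2 /dot mulr_suml; apply: eq_bigr => i _.
by rewrite mulr_sumr; apply: eq_bigr => j _; ring.
Qed.

(* h is positive on a ball whose centre moves with constant velocity e; the
   comparison function is theta h^2. *)
Lemma barrier_comparison (w z : R -> pt -> R) (t1 t2 rho : R) (x1 e : pt)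
    (theta dtheta : R -> R)
    (p := fun (t : R) (x : pt) => x - x1 - (t - t1) *: e)
    (h := fun t x => rho ^+ 2 - dot (p t x) (p t x)) :
  C12 w -> 0 <= t1 -> (forall s : R, is_derive s 1 theta (dtheta s)) ->
  (forall t, t1 <= t <= t2 -> 0 <= theta t) ->
  (forall t x, t1 <= t <= t2 -> 0 <= w t x) ->
  (forall x, 0 <= h t1 x -> theta t1 * h t1 x ^+ 2 <= w t1 x) ->
  (forall t x, t1 < t <= t2 -> 0 < h t x -> w t x < theta t * h t x ^+ 2 ->
     Aop Q b (w t) x + z t x <= 'D_1 (fun s => w s x) t /\
     dtheta t * h t x ^+ 2 + 4 * theta t * h t x * dot (p t x) e <
       theta t * (8 * qform (Q x) (p t x ord0) -
         4 * h t x * (\tr (Q x) + dot (p t x) (b x))) + z t x) ->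
  forall t x, t1 <= t <= t2 -> 0 <= h t x -> theta t * h t x ^+ 2 <= w t x.
Proof.
move=> Cw t10 Dth th_ge0 w_ge0 init main ts xs tts hs.
rewrite leNgt; apply/negP => neg.
pose K : set (R * pt) := [set q | t1 <= q.1 <= t2 /\ 0 <= h q.1 q.2].
have cp (F : set_system (R * pt)) (FF : Filter F) (q : R * pt) :
    F --> q -> p q'.1 q'.2 @[q' --> F] --> p q.1 q.2.
  move=> Fq; rewrite /p; apply: cvgB; last first.
    apply: cvgZ; last exact: cvg_cst.
    apply: cvgB; last exact: cvg_cst.
    by apply: (cvg_comp id fst Fq); exact: cvg_fst.
  apply: cvgB; last exact: cvg_cst.
  by apply: (cvg_comp id snd Fq); exact: cvg_snd.
have ch (F : set_system (R * pt)) (FF : Filter F) (q : R * pt) :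
    F --> q -> h q'.1 q'.2 @[q' --> F] --> h q.1 q.2.
  move=> Fq; apply: cvgB; first exact: cvg_cst.
  by apply: cvg_dot; exact: cp.
have clK : closed K.
  have -> : K = (fun q : R * pt => q.1) @^-1` [set s | t1 <= s] `&`
     ((fun q : R * pt => q.1) @^-1` [set s | s <= t2] `&`
      (fun q : R * pt => h q.1 q.2) @^-1` [set s | 0 <= s]).
    by apply/seteqP; split=> q /=; rewrite /K /=; [move=> [/andP[]]|move=> [-> [->]]].
  apply: closedI; [|apply: closedI].
  - by apply: preimage_closed; [move=> q _; exact: cvg_fst|exact: closed_ge].
  - by apply: preimage_closed; [move=> q _; exact: cvg_fst|exact: closed_le].
  - apply: preimage_closed; last exact: closed_ge.
    by move=> q _; apply: ch.
have cK : compact K.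
  apply: (@subclosed_compact _ _ (`[t1, t2] `*`
     [set x | enorm (x - x1) <= `|rho| + (t2 - t1) * enorm e])) => //.
    by apply: compact_setX; [exact: segment_compact|exact: compact_eball].
  move=> [t x] [/= tt ht]; split; rewrite /= ?in_itv //.
  have -> : x - x1 = p t x + (t - t1) *: e by rewrite /p subrK.
  rewrite (le_trans (enormD _ _)) // lerD //.
    rewrite -sqrtr_sqr enorm_dot ler_wsqrtr //; move: ht; rewrite /h; lra.
  have /andP[tl tr] := tt.
  rewrite enormZ ger0_norm; last by rewrite subr_ge0.
  by rewrite ler_wpM2r ?enorm_ge0 // lerD2r.
(* A negative minimum of [F] over the tube lies neither at the initial time, by [init], nor on the
   lateral boundary, where [h = 0] and [w >= 0]. It is therefore interior in space. *)
pose F (q : R * pt) := w q.1 q.2 - theta q.1 * (h q.1 q.2 * h q.1 q.2).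
have Kpos q : K q -> 0 <= q.1.
  by move=> [/andP[? _] _]; apply: le_trans t10 _.
have [q Kq|[th xh] [/= tth hh] Fmin] := @EVT_within _ _ K F (ex_intro _ (ts, xs) (conj tts hs)) cK.
  apply: cvgB; first by apply: C12_cvg => //; exact: Kpos.
  apply: cvgM.
    apply: cvg_within_filter; apply: (cvg_comp fst theta); first exact: cvg_fst.
    exact: is_derive_continuous (Dth _).
  by apply: cvgM; apply: ch; apply: cvg_within.
have Fneg : F (th, xh) < 0.
  apply: le_lt_trans (Fmin (ts, xs) (conj tts hs)) _.
  by rewrite /F /= -expr2 subr_lt0.
have th_gt : t1 < th.
  rewrite lt_def (andP tth).1 andbT; apply/negP => /eqP E; move: Fneg hh.
  rewrite /F /= E subr_lt0 -expr2 => + hh; rewrite ltNge => /negP; apply.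
  exact: init.
have h_gt : 0 < h th xh.
  rewrite lt_def hh andbT; apply/negP => /eqP E; move: Fneg.
  rewrite /F /= E mulr0 mulr0 subr0 ltNge => /negP; apply; exact: w_ge0.
have th0 : 0 < th by apply: le_lt_trans t10 th_gt.
have tht : t1 < th <= t2 by rewrite th_gt (andP tth).2.
have wlt : w th xh < theta th * h th xh ^+ 2 by move: Fneg; rewrite /F /= subr_lt0 expr2.
have [PDE strict] := main th xh tht h_gt wlt.
set P := p th xh in strict; set H := h th xh in strict h_gt.
have thp := th_ge0 th tth.
(* On a line, [theta h^2] is a quartic polynomial. Its cubic term goes into the remainder of the
   test; its quartic term has a favourable sign and is dropped. *)
have space (v : pt) : - Dv (w th) xh v = 4 * theta th * H * dot P v /\
   - Hv (w th) xh v <= 2 * (- (theta th * (4 * dot P v ^+ 2 - 2 * H * dot v v))).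
  have hline (t : R) : h th (t *: v + xh) = H - 2 * t * dot P v - t * t * dot v v.
    rewrite /h; have -> : p th (t *: v + xh) = t *: v + P by rewrite /P /p !addrA.
    by rewrite enorm_line /H /h -/P; ring.
  have nearh : \forall t \near (0 : R), 0 < h th (t *: v + xh).
    have : h th (t *: v + xh) @[t --> (0 : R)] --> h th xh.
      have c1 : t *: v + xh @[t --> (0 : R)] --> xh.
        rewrite -{2}(add0r xh); apply: cvgD; last exact: cvg_cst.
        rewrite -[X in _ --> X](scale0r v).
        by apply: cvgZ; [exact: cvg_id|exact: cvg_cst].
      exact: (@ch ((th, t *: v + xh) @[t --> (0 : R)]) _ (th, xh)
        (cvg_pair (cvg_cst th) c1)).
    move=> /cvgrPdist_lt/(_ _ h_gt); apply: filterS => t.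
    by rewrite ltr_norml => /andP[_]; rewrite /H; lra.
  have N : \forall t \near (0 : R), -1 * w th (t *: v + xh) <= -1 * w th xh +
     (4 * theta th * H * dot P v) * t +
     (- (theta th * (4 * dot P v ^+ 2 - 2 * H * dot v v))) * (t * t) +
     (4 * theta th * `|dot P v| * dot v v) * `|t| * (t * t).
    apply: filterS nearh => t ht.
    have := Fmin (th, t *: v + xh) (conj tth (ltW ht)); rewrite /F /= hline -/H => FF.
    have bd : - (4 * theta th * `|dot P v| * dot v v * `|t| * (t * t)) <=
       4 * theta th * (dot P v * t) * dot v v * (t * t).
      have := ler_norm (- (dot P v * t)); rewrite normrN normrM => nb.
      have tv : 0 <= 4 * theta th * dot v v * (t * t).
        have tt0 : 0 <= t * t by rewrite -expr2 sqr_ge0.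
        by rewrite (mulr_ge0 _ tt0) // (mulr_ge0 _ (dot_ge0 v)) // mulr_ge0.
      have := ler_wpM2l tv nb; lra.
    have q4 : 0 <= theta th * (t * t * dot v v) ^+ 2.
      by rewrite mulr_ge0 // sqr_ge0.
    move: FF bd q4; set PV := dot P v; set VV := dot v v; set TH := theta th.
    set W1 := w th _; set W0 := w th _; nra.
  have [h1 h2] := @one_point_test _ _ (w th) xh v (-1) _ _ _ (C12_C2 Cw th0) N.
  by split; [rewrite -h1|]; lra.
have [vs Hvs] := psd_vectors (symQ xh) (psdQ_of_elliptic xh).
have Alow : theta th * (8 * qform (Q xh) (P ord0) -
      4 * H * (\tr (Q xh) + dot P (b xh))) <= Aop Q b (w th) xh.
  rewrite (Aop_decomp _ _ Hvs) (trace_decomp Hvs) (qform_decomp _ Hvs).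
  have -> : Dv (w th) xh (b xh) = - (4 * theta th * H * dot P (b xh)).
    by rewrite -(space (b xh)).1 opprK.
  have : \sum_(v <- vs) theta th * (8 * dot P v ^+ 2 - 4 * H * dot v v) <=
     \sum_(v <- vs) Hv (w th) xh v.
    by apply: ler_sum => v _; have := (space v).2; lra.
  rewrite -mulr_sumr sumrB -!mulr_sumr; lra.
have Dh : is_derive th 1 (h^~ xh) (2 * dot P e).
  pose y := xh - x1 + t1 *: e.
  have -> : h^~ xh = (fun s => 2 * dot y e * s + (- dot e e) * (s * s)) +
      cst (rho ^+ 2 - dot y y).
    apply/funext => s; rewrite fctE /= /h.
    have -> : p s xh = y - s *: e by rewrite /p /y scalerBl opprB !addrA addrAC.
    by rewrite !(dotBl, dotBr, dotZl, dotZr) (dotC e y); ring.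
  have D1 := is_deriveD (is_derive_quad (2 * dot y e) (- dot e e) th)
    (is_derive_cst (rho ^+ 2 - dot y y) th 1).
  apply: is_derive_eq D1 _.
  have -> : P = y - th *: e by rewrite /P /p /y scalerBl opprB !addrA addrAC.
  by rewrite dotBl dotZl; ring.
have DF : is_derive th 1 (fun s => F (s, xh))
   ('D_1 (fun s => w s xh) th - (dtheta th * H ^+ 2 + 4 * theta th * H * dot P e)).
  have D1 := is_deriveM Dh Dh.
  have D2 := is_deriveM (Dth th) D1.
  have D3 := is_deriveB (C12_is_derive xh Cw th0) D2.
  apply: is_derive_eq D3 _; rewrite /GRing.scale /= fctE /= -/H; ring.
have time : 'D_1 (fun s => w s xh) th -
    (dtheta th * H ^+ 2 + 4 * theta th * H * dot P e) <= 0.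
  apply: derive_left_le0 DF _; near=> s; apply: Fmin; split => /=.
    apply/andP; split; first by apply: ltW; near: s; exact: nbhs_left_gt.
    by rewrite (le_trans _ (andP tth).2) //; near: s; exact: nbhs_left_le.
  apply: ltW; near: s.
  have := is_derive_continuous Dh.
  move=> /cvgrPdist_lt/(_ _ h_gt) nh; apply: cvg_within; apply: filterS nh => s.
  by rewrite ltr_norml => /andP[_]; rewrite /H; lra.
move: PDE strict Alow time; lra.
Unshelve. all: by end_near. Qed.

End Barrier.

Definition locally_bounded (R : realType) (d : nat) (g : pt R d -> R) : Prop :=
  forall r : R, exists M : R, forall x, enorm x <= r -> `|g x| <= M.

Section Positivity.
Variables (R : realType) (d : nat).
Local Notation pt := (pt R d).
Variables (Q : pt -> 'M[R]_d) (b : pt -> 'rV[R]_d) (kappa : R) (g : pt -> R).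
Hypothesis symQ : forall x, (Q x)^T = Q x.
Hypothesis kappa_gt0 : 0 < kappa.
Hypothesis ellQ : forall x (v : pt), kappa * dot v v <= qform (Q x) (v ord0).
Hypothesis bndQ : locally_bounded (fun x => \tr (Q x)).
Hypothesis bndb : locally_bounded (fun x => enorm (b x)).
Hypothesis bndg : locally_bounded g.

Lemma local_constants (r : R) : exists N, [/\ 0 <= N,
  (forall x, enorm x <= r -> \tr (Q x) <= N),
  (forall x, enorm x <= r -> enorm (b x) <= N) &
  (forall x, enorm x <= r -> `|g x| <= N)].
Proof.
have [M1 H1] := bndQ r; have [M2 H2] := bndb r; have [M3 H3] := bndg r.
have m1 := ler_norm M1; have m2 := ler_norm M2; have m3 := ler_norm M3.
have n1 := normr_ge0 M1; have n2 := normr_ge0 M2; have n3 := normr_ge0 M3.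
exists (`|M1| + `|M2| + `|M3|); split => [|x /H1|x /H2|x /H3]; first by lra.
- by have := ler_norm (\tr (Q x)); lra.
- by have := ler_norm (enorm (b x)); lra.
- by lra.
Qed.

Lemma dot_le_norm (x y : pt) : `|dot x y| <= enorm x * enorm y.
Proof.
by rewrite ler_norml cauchy_schwarz andbT lerNl -dotNl -(enormN x) cauchy_schwarz.
Qed.

Lemma discriminant_pos (k D y : R) : 0 < k -> 0 < k - D * y + D ^+ 2 / k * y ^+ 2.
Proof.
move=> k0; have -> : k - D * y + D ^+ 2 / k * y ^+ 2 =
  k * ((D * y / k - 1 / 2) ^+ 2 + 3 / 4) by field; rewrite gt_eqF.
by rewrite mulr_gt0 // ltr_wpDl ?sqr_ge0 //; lra.
Qed.

(** To reach [(t, x)] a ball of radius [rho] travels from [x1] to [x] during [[t1, t]]; its speed is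
    at most [V] because at least one unit of time is available. Only the decay rate of [theta]
    enters [delta], so [delta] serves all solutions, starting times and levels [eta]. *)
Lemma positivity_spreads (x1 : pt) (rho r T : R) : 0 < rho ->
  exists2 delta : R, 0 < delta & forall w t1 eta,
    C12 w -> 0 <= t1 -> 0 < eta -> (forall t x, t1 <= t -> 0 <= w t x) ->
    (forall t x, t1 < t -> Aop Q b (w t) x + g x * w t x <= 'D_1 (fun s => w s x) t) ->
    (forall x, enorm (x - x1) <= rho -> eta <= w t1 x) ->
    forall t x, t1 + 1 <= t <= t1 + T -> enorm x <= r -> delta * eta <= w t x.
Proof.
move=> rho0.
pose V := `|r| + enorm x1.
have V0 : 0 <= V by rewrite addr_ge0 ?enorm_ge0.
have [N [N0 NQ Nb Ng]] := local_constants (enorm x1 + V + rho).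
pose C1 := 4 * rho * V + 4 * N + 4 * rho * N.
have k0 : 0 < 8 * kappa * rho ^+ 2 by rewrite !mulr_gt0 // exprn_gt0.
(* Near the edge of the ball the ellipticity term [8 kappa |p|^2] wins, well inside it the decay of
   [theta]. With [|p|^2 = rho^2 - h] the balance is a quadratic polynomial in [h], and this [lam]
   makes it positive by [discriminant_pos]. *)
pose lam := N + (8 * kappa + C1) ^+ 2 / (8 * kappa * rho ^+ 2).
have lam0 : 0 <= lam by rewrite addr_ge0 // divr_ge0 ?sqr_ge0 // ltW.
exists (expR (- lam * T)); first exact: expR_gt0.
move=> w t1 eta Cw t10 eta0 w0 PDE init t x /andP[tl tr] xr.
have tt1 : 0 < t - t1 by lra.
pose e := (t - t1)^-1 *: (x - x1).
have xV : enorm (x - x1) <= V.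
  by rewrite (le_trans (enormB _ _)) // lerD2r (le_trans xr) // ler_norm.
have eV : enorm e <= V.
  rewrite enormZ gtr0_norm ?invr_gt0 // ler_pdivrMl //.
  by rewrite (le_trans xV) // ler_peMl //; lra.
(* Normalised so that [theta t1 = eta / rho^4]; then [theta h^2 <= eta] at the start, since
   [h <= rho^2]. *)
pose K0 := eta / rho ^+ 4 * expR (lam * t1).
have K00 : 0 < K0 by rewrite mulr_gt0 ?divr_gt0 ?exprn_gt0 ?expR_gt0.
pose theta s := K0 * expR (- lam * s).
have theta_gt0 s : 0 < theta s by rewrite mulr_gt0 ?expR_gt0.
have Dtheta (s : R) : is_derive s 1 theta (- lam * theta s).
  have H := is_derive_lin K0 0 (is_derive_expR_scale (- lam) s) (is_derive_expR_scale (- lam) s).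
  have -> : theta = fun y => K0 * expR (- lam * y) + 0 * expR (- lam * y).
    by apply/funext => y; rewrite mul0r addr0.
  by apply: is_derive_eq H _; rewrite /theta; ring.
have th1 : theta t1 = eta / rho ^+ 4.
  by rewrite /theta /K0 -mulrA -expRD mulNr subrr expR0 mulr1.
have := @barrier_comparison R d Q b kappa symQ kappa_gt0 ellQ w
  (fun s y => g y * w s y) t1 t rho x1 e theta _ Cw t10 Dtheta _ _ _ _ t x.
have -> : x - x1 - (t - t1) *: e = 0.
  by rewrite /e scalerA mulfV ?gt_eqF // scale1r subrr.
have d0 : dot (0 : pt) 0 = 0 by rewrite -enorm2 enorm0 expr0n.
rewrite d0 subr0 -exprM => H.
apply: le_trans (H _ _ _ _ _ _).
- rewrite /theta /K0.
  have -> : eta / rho ^+ 4 * expR (lam * t1) * expR (- lam * t) * rho ^+ (2 * 2) =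
     expR (lam * t1 + - lam * t) * eta.
    by rewrite expRD; field; rewrite gt_eqF.
  rewrite ler_wpM2r ?(ltW eta0) // ler_expR.
  by have := ler_wpM2l lam0 tr; lra.
- by move=> s _; exact: ltW.
- by move=> s y /andP[? _]; exact: w0.
- move=> y; rewrite subrr scale0r subr0 th1 => hy.
  have yr : enorm (y - x1) <= rho.
    rewrite -(@ler_pXn2r _ 2) ?nnegrE ?enorm_ge0 ?(ltW rho0) // enorm2; lra.
  apply: le_trans (init y yr).
  rewrite mulrAC -mulrA ler_piMr ?(ltW eta0) // ler_pdivrMr ?exprn_gt0 // mul1r.
  have -> : rho ^+ 4 = (rho ^+ 2) ^+ 2 by rewrite -exprM.
  rewrite ler_pXn2r ?nnegrE ?sqr_ge0 //; have := dot_ge0 (y - x1); lra.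
- move=> s y /andP[s1 st]; set p := y - x1 - (s - t1) *: e.
  set h := rho ^+ 2 - dot p p => h0 wlt; split; first exact: PDE.
  have pp : dot p p = rho ^+ 2 - h by rewrite /h; ring.
  have pr : enorm p <= rho.
    rewrite -(@ler_pXn2r _ 2) ?nnegrE ?enorm_ge0 ?(ltW rho0) // enorm2; lra.
  have yr : enorm y <= enorm x1 + V + rho.
    have -> : y = x1 + (s - t1) *: e + p.
      by rewrite /p -[y - x1 - _]addrA -opprD [RHS]addrC subrK.
    rewrite (le_trans (enormD _ _)) // lerD // (le_trans (enormD _ _)) // lerD2l.
    rewrite (le_trans _ xV) // /e !enormZ (gtr0_norm (_ : 0 < s - t1)) ?subr_gt0 //.
    rewrite gtr0_norm ?invr_gt0 // mulrA ler_piMl ?enorm_ge0 //.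
    by rewrite ler_pdivrMr // mul1r lerD2r.
  have hp : 0 <= dot p p by exact: dot_ge0.
  have := ellQ y p => el.
  have b1 : `|dot p e| <= rho * V.
    by rewrite (le_trans (dot_le_norm _ _)) // ler_pM ?enorm_ge0.
  have b2 : `|dot p (b y)| <= rho * N.
    by rewrite (le_trans (dot_le_norm _ _)) // ler_pM ?enorm_ge0 // Nb.
  have b3 := NQ y yr.
  have b4 : - (N * (theta s * h ^+ 2)) <= g y * w s y.
    have gy := Ng y yr.
    have ws := w0 s y (ltW s1).
    have gn : - `|g y| <= g y by rewrite lerNl -normrN ler_norm.
    apply: le_trans (ler_wpM2r ws gn); rewrite mulNr lerN2.
    by apply: ler_pM => //; exact: ltW.
  have key : - lam * h ^+ 2 + 4 * h * dot p e + N * h ^+ 2 <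
      8 * qform (Q y) (p ord0) - 4 * h * (\tr (Q y) + dot p (b y)).
    have := @discriminant_pos _ (8 * kappa + C1) h k0.
    have : 4 * h * (dot p e + \tr (Q y) + dot p (b y)) <= C1 * h.
      have := ler_norm (dot p e); have := ler_norm (dot p (b y)) => n1 n2.
      have le1 : dot p e + \tr (Q y) + dot p (b y) <= rho * V + N + rho * N by lra.
      have := ler_wpM2l (ltW h0) le1; rewrite /C1; lra.
    have : 8 * kappa * (rho ^+ 2 - h) <= 8 * qform (Q y) (p ord0).
      by rewrite -pp; lra.
    rewrite /lam; move: ((_ + C1) ^+ 2 / _) => L; lra.
  have := theta_gt0 s; move: b4 key; set th := theta s => b4 key th0.
  by move: key; rewrite -(ltr_pM2l th0) => key; lra.
- by lra.
- exact: sqr_ge0.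
Qed.

(** No initial positivity is available, so the ball stays at rest and [theta] grows linearly from
    zero, its growth being paid for by the source [s0]. *)
Lemma source_positivity (x1 : pt) (rho : R) : 0 < rho ->
  exists2 delta : R, 0 < delta & forall w t1 s0,
    C12 w -> 0 <= t1 -> 0 < s0 -> (forall t x, t1 <= t -> 0 <= w t x) ->
    (forall t x, t1 < t <= t1 + 1 -> enorm (x - x1) <= rho ->
      Aop Q b (w t) x + (g x * w t x + s0) <= 'D_1 (fun s => w s x) t) ->
    forall x, enorm (x - x1) <= rho / 2 -> delta * s0 <= w (t1 + 1) x.
Proof.
move=> rho0.
have [N [N0 NQ Nb Ng]] := local_constants (enorm x1 + rho).
(* Each summand bounds one loss per unit of [eps]: the growth of [theta], the trace and drift terms,
   and [g w] where [w < theta h^2]. The added 1 in [eps * (D + 1) = s0] gives strictness, and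
   [9 / 16 * rho^4] bounds [h^2] from below on the half ball. *)
pose D := rho ^+ 4 + 4 * rho ^+ 2 * (N + rho * N) + N * rho ^+ 4.
have D0 : 0 <= D by rewrite !addr_ge0 // ?mulr_ge0 ?addr_ge0 ?exprn_ge0 ?mulr_ge0 ?(ltW rho0).
exists (9 / 16 * rho ^+ 4 / (D + 1)).
  by rewrite divr_gt0 ?mulr_gt0 ?exprn_gt0 //; lra.
move=> w t1 s0 Cw t10 s00 w0 PDE x xr.
have [eps eps0 epsD] : exists2 eps, 0 < eps & eps * (D + 1) = s0.
  by exists (s0 / (D + 1)); [rewrite divr_gt0 //; lra|rewrite mulfVK // gt_eqF //; lra].
pose theta s := eps * (s - t1).
have Dtheta (s : R) : is_derive s 1 theta ((fun=> eps) s).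
  have H := is_deriveD (is_derive_quad eps 0 s) (is_derive_cst (- (eps * t1)) s 1).
  have -> : theta = (fun t => eps * t + 0 * (t * t)) + cst (- (eps * t1)).
    by apply/funext => y; rewrite fctE /theta /=; ring.
  by apply: is_derive_eq H _; ring.
have := @barrier_comparison R d Q b kappa symQ kappa_gt0 ellQ w
  (fun s y => g y * w s y + s0) t1 (t1 + 1) rho x1 0 theta (fun=> eps) Cw t10 Dtheta _ _ _ _ (t1 + 1) x.
have -> : x - x1 - (t1 + 1 - t1) *: (0 : pt) = x - x1 by rewrite scaler0 subr0.
rewrite -enorm2 => H.
have q0 : enorm (x - x1) ^+ 2 <= rho ^+ 2 / 4.
  have -> : rho ^+ 2 / 4 = (rho / 2) ^+ 2 by field.
  by rewrite ler_pXn2r ?nnegrE ?enorm_ge0 //; lra.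
have r20 : 0 < rho ^+ 2 by rewrite exprn_gt0.
apply: le_trans (H _ _ _ _ _ _).
- rewrite /theta; have -> : eps * (t1 + 1 - t1) = eps by ring.
  rewrite -epsD.
  have -> : 9 / 16 * rho ^+ 4 / (D + 1) * (eps * (D + 1)) = eps * (3 / 4 * rho ^+ 2) ^+ 2.
    by field; rewrite gt_eqF //; lra.
  by rewrite ler_pM2l // ler_pXn2r ?nnegrE //; lra.
- by move=> s /andP[? _]; rewrite mulr_ge0 ?subr_ge0 // ltW.
- by move=> s y /andP[? _]; exact: w0.
- by move=> y _; rewrite /theta subrr mulr0 mul0r; exact: w0.
- move=> s y /andP[s1 st]; rewrite scaler0 subr0; set p := y - x1.
  set h := rho ^+ 2 - dot p p => h0 wlt.
  have pr : enorm p <= rho.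
    rewrite -(@ler_pXn2r _ 2) ?nnegrE ?enorm_ge0 ?(ltW rho0) // enorm2; move: h0; rewrite /h; lra.
  split; first by apply: PDE => //; rewrite s1.
  have yr : enorm y <= enorm x1 + rho.
    by have -> : y = x1 + p; [rewrite /p subrKC|rewrite (le_trans (enormD _ _)) // lerD2l].
  have b2 : `|dot p (b y)| <= rho * N.
    by rewrite (le_trans (dot_le_norm _ _)) // ler_pM ?enorm_ge0 // Nb.
  have b3 := NQ y yr.
  have ws := w0 s y (ltW s1).
  have th0 : 0 <= theta s <= eps.
    rewrite /theta mulr_ge0 ?(ltW eps0) ?subr_ge0 ?(ltW s1) //= ler_piMr ?(ltW eps0) //; lra.
  have /andP[tha thb] := th0.
  have hr : h <= rho ^+ 2 by have := dot_ge0 p; rewrite /h; lra.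
  have h2r : h ^+ 2 <= rho ^+ 4.
    by have -> : rho ^+ 4 = (rho ^+ 2) ^+ 2; [rewrite -exprM|rewrite ler_pXn2r ?nnegrE ?(ltW h0) ?(ltW r20)].
  have thh : theta s * h ^+ 2 <= eps * rho ^+ 4 by rewrite ler_pM ?sqr_ge0.
  have b4 : - (N * (eps * rho ^+ 4)) <= g y * w s y.
    have gy := Ng y yr.
    have gn : - `|g y| <= g y by rewrite lerNl -normrN ler_norm.
    apply: le_trans (ler_wpM2r ws gn); rewrite mulNr lerN2.
    by apply: ler_pM => //; rewrite (le_trans (ltW wlt)).
  have dot0 : dot p (0 : pt) = 0 by rewrite -(scale0r (0 : pt)) dotZr mul0r.
  rewrite dot0 mulr0 addr0.
  have qf := psdQ_of_elliptic kappa_gt0 ellQ y p.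
  have eh : eps * h ^+ 2 <= eps * rho ^+ 4 by rewrite ler_wpM2l // ltW.
  have br : theta s * (4 * h * (\tr (Q y) + dot p (b y))) <=
     eps * (4 * rho ^+ 2 * (N + rho * N)).
    have n1 := ler_norm (dot p (b y)).
    have l1 : 4 * h * (\tr (Q y) + dot p (b y)) <= 4 * h * (N + rho * N).
      by rewrite ler_wpM2l ?mulr_ge0 ?(ltW h0) //; lra.
    have l2 : 4 * h * (N + rho * N) <= 4 * rho ^+ 2 * (N + rho * N).
      by rewrite ler_wpM2r ?addr_ge0 ?mulr_ge0 ?(ltW rho0) //; lra.
    have l3 : 0 <= 4 * rho ^+ 2 * (N + rho * N).
      by rewrite !mulr_ge0 ?addr_ge0 ?mulr_ge0 ?(ltW rho0) ?(ltW r20).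
    apply: le_trans (ler_wpM2l tha (le_trans l1 l2)) _.
    by rewrite ler_wpM2r.
  have qq : 0 <= theta s * (8 * qform (Q y) (p ord0)).
    by apply: mulr_ge0 => //; apply: mulr_ge0.
  move: epsD; rewrite /D; lra.
- by lra.
- move: q0; lra.
Qed.

End Positivity.

(** * Interior Lipschitz estimate *)

Section Coupling.
Variables (R : realType) (d : nat).
Local Notation pt := (pt R d).
Implicit Types (u v s e n : pt).

Lemma sum_delta (F : 'I_d -> 'I_d -> R) :
  \sum_i \sum_j (i == j)%:R * F i j = \sum_i F i i.
Proof.
apply: eq_bigr => i _; rewrite (bigD1 i) //= eqxx mul1r big1 ?addr0 // => j.
by rewrite eq_sym => /negbTE ->; rewrite mul0r.
Qed.

Lemma qform_reflect (eps k : R) n v :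
  \sum_i \sum_j v ord0 i * (eps * (i == j)%:R + k * n ord0 i * n ord0 j) * v ord0 j =
  eps * dot v v + k * dot n v ^+ 2.
Proof.
rewrite (eq_bigr (fun i => \sum_j ((i == j)%:R * (eps * (v ord0 i * v ord0 j)) +
    k * ((n ord0 i * v ord0 i) * (n ord0 j * v ord0 j))))); last first.
  by move=> i _; apply: eq_bigr => j _; ring.
under eq_bigr => i _ do rewrite big_split /=.
rewrite big_split /= sum_delta /dot mulr_sumr; congr (_ + _).
rewrite expr2 mulr_suml mulr_sumr; apply: eq_bigr => i _.
by rewrite !mulr_sumr.
Qed.

(** Entries of size at most [e] give operator norm at most [e d]; Young's inequality with weight [k]
    is applied entry by entry. The weights divide by [d], whence the separate case [d = 0]. *)
Lemma young_bilinear (E : 'I_d -> 'I_d -> R) (e k : R) s v : 0 < e -> 0 < k ->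
  (forall i j, `|E i j| <= e) ->
  - (k / 2 * dot s s + (e * d%:R) ^+ 2 / (2 * k) * dot v v) <=
  \sum_i \sum_j s ord0 i * E i j * v ord0 j.
Proof.
move=> e0 k0 HE.
have [d0|d0] := posnP d.
  have z (F : 'I_d -> R) : \sum_i F i = 0.
    by apply: big1 => i; case: i => i' hi; exfalso; move: hi; rewrite d0.
  by rewrite /dot !z !mulr0 addr0 oppr0.
have dR : (0 : R) < d%:R by rewrite ltr0n.
have term i j : - (k / (2 * d%:R) * (s ord0 i * s ord0 i) +
    e ^+ 2 * d%:R / (2 * k) * (v ord0 j * v ord0 j)) <= s ord0 i * E i j * v ord0 j.
  set S := s ord0 i; set W := v ord0 j.
  have n1 : - (e * (`|S| * `|W|)) <= S * E i j * W.
    rewrite lerNl (le_trans (ler_norm _)) // normrN !normrM.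
    by rewrite -mulrA mulrCA ler_wpM2r ?mulr_ge0.
  apply: le_trans n1; rewrite lerN2.
  have ns : S * S = `|S| * `|S| by rewrite -expr2 -real_normK ?num_real // expr2.
  have nw : W * W = `|W| * `|W| by rewrite -expr2 -real_normK ?num_real // expr2.
  rewrite ns nw; rewrite -subr_ge0.
  have -> : k / (2 * d%:R) * (`|S| * `|S|) + e ^+ 2 * d%:R / (2 * k) * (`|W| * `|W|) -
     e * (`|S| * `|W|) =
     (k * `|S| - e * d%:R * `|W|) ^+ 2 / (2 * d%:R * k).
    by field; rewrite !gt_eqF.
  by rewrite divr_ge0 ?sqr_ge0 // !mulr_ge0 // ltW.
have -> : k / 2 * dot s s + (e * d%:R) ^+ 2 / (2 * k) * dot v v =
   \sum_i \sum_j (k / (2 * d%:R) * (s ord0 i * s ord0 i) +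
    e ^+ 2 * d%:R / (2 * k) * (v ord0 j * v ord0 j)).
  under eq_bigr => i _ do
    rewrite big_split /= sumr_const card_ord -mulr_sumr -/(dot v v).
  rewrite big_split /= sumr_const card_ord -(mulr_natl _ d).
  congr (_ + _); last by field; rewrite gt_eqF.
  rewrite /dot mulr_sumr; apply: eq_bigr => i _; rewrite -mulr_natl.
  by field; rewrite gt_eqF.
rewrite -sumrN; apply: ler_sum => i _; rewrite -sumrN; apply: ler_sum => j _.
exact: term.
Qed.

(* Q1, Q2 are the diffusion matrices at the two points and e bounds the
   entries of their difference; N = eps Id + kappa n n^T is the reflection part of
   the coupling, i.e. the vectors z = x - y satisfy sum z z^T = 2 N. *)
Lemma reflection_coupling (Q1 Q2 : 'M[R]_d) (kappa e eps : R) n :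
  Q1^T = Q1 -> Q2^T = Q2 -> 0 < kappa -> 0 < e -> dot n n = 1 ->
  (forall v, kappa * dot v v <= qform Q1 (v ord0)) ->
  (forall v, kappa * dot v v <= qform Q2 (v ord0)) ->
  (forall i j, `|Q1 i j - Q2 i j| <= e) ->
  eps = (e * d%:R) ^+ 2 / (2 * kappa) -> eps <= kappa / 2 ->
  exists vs : seq (pt * pt), [/\
    forall i j, Q1 i j = \sum_(v <- vs) v.1 ord0 i * v.1 ord0 j,
    forall i j, Q2 i j = \sum_(v <- vs) v.2 ord0 i * v.2 ord0 j,
    \sum_(v <- vs) dot (v.1 - v.2) (v.1 - v.2) = 2 * (eps * d%:R + kappa) &
    \sum_(v <- vs) dot n (v.1 - v.2) ^+ 2 = 2 * (eps + kappa)].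
Proof.
move=> sQ1 sQ2 k0 e0 nn el1 el2 HE epsE epsk.
pose N (i j : 'I_d) := eps * (i == j)%:R + kappa * n ord0 i * n ord0 j.
pose P i j := (Q1 i j + Q2 i j) / 2 - N i j.
have symN i j : N i j = N j i by rewrite /N eq_sym; ring.
have s1 i j : Q1 i j = Q1 j i by rewrite -{1}sQ1 mxE.
have s2 i j : Q2 i j = Q2 j i by rewrite -{1}sQ2 mxE.
have symP i j : P i j = P j i by rewrite /P symN s1 s2.
(* Covariance of the coupled pair: the diagonal blocks prescribe the marginals [Q1] and [Q2], and
   [P] is chosen so that the difference has covariance [Q1 + Q2 - 2 P = 2 N]. *)
pose M (i j : 'I_d + 'I_d) : R := match i, j with
  | inl i, inl j => Q1 i j | inl i, inr j => P i j
  | inr i, inl j => P i j | inr i, inr j => Q2 i j end.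
have symM i j : M i j = M j i by case: i => i; case: j => j /=; auto.
have eps0 : 0 <= eps by rewrite epsE divr_ge0 ?sqr_ge0 // mulr_ge0 // ltW.
have psdM (v : 'I_d + 'I_d -> R) : 0 <= qform M v.
  (* In sum and difference variables the cross term is the bilinear one in [Q1 - Q2]. Young's
     inequality charges it to [kappa / 4 |s|^2], left over from ellipticity, and to [eps / 2 |t|^2];
     this is why [N] contains [eps] times the identity. *)
  pose s : pt := \row_i (v (inl i) + v (inr i)).
  pose t : pt := \row_i (v (inl i) - v (inr i)).
  pose E i j := (Q1 i j - Q2 i j) / 2.
  have -> : qform M v = qform Q1 (s ord0) / 2 + qform Q2 (s ord0) / 2 -
     (eps * dot s s + kappa * dot n s ^+ 2) / 2 +
     (eps * dot t t + kappa * dot n t ^+ 2) / 2 +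
     \sum_i \sum_j s ord0 i * E i j * t ord0 j.
    have sw : \sum_i \sum_j s ord0 i * E i j * t ord0 j =
      \sum_i \sum_j (s ord0 i * E i j * t ord0 j + t ord0 i * E i j * s ord0 j) / 2.
      have sw' : \sum_i \sum_j s ord0 i * E i j * t ord0 j =
         \sum_i \sum_j t ord0 i * E i j * s ord0 j.
        rewrite exchange_big; apply: eq_bigr => i _; apply: eq_bigr => j _.
        by rewrite /E s1 s2; ring.
      under [RHS]eq_bigr => i _ do rewrite -mulr_suml big_split /=.
      by rewrite -mulr_suml big_split /= -sw'; field.
    rewrite sw -!(qform_reflect eps kappa) /qform.
    rewrite big_sumType /=.
    under eq_bigr => i _ do rewrite big_sumType /=.
    under [X in _ + X = _]eq_bigr => i _ do rewrite big_sumType /=.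
    rewrite !mulr_suml -sumrN -!big_split /=; apply: eq_bigr => i _.
    rewrite !mulr_suml -sumrN -!big_split /=; apply: eq_bigr => j _.
    by rewrite !mxE /P /E /N; field.
  have cs : dot n s ^+ 2 <= dot s s.
    have := dot_le_norm n s.
    have -> : enorm n = 1 by rewrite enorm_dot nn sqrtr1.
    by rewrite mul1r -enorm2 -(real_normK (num_real (dot n s))) ler_pXn2r ?nnegrE ?enorm_ge0.
  have e20 : 0 < e / 2 by lra.
  have k20 : 0 < kappa / 2 by lra.
  have HE2 i j : `|E i j| <= e / 2.
    by rewrite /E normrM (@gtr0_norm _ 2^-1) ?invr_gt0 // ler_pM2r ?invr_gt0.
  have := @young_bilinear E (e / 2) (kappa / 2) s t e20 k20 HE2.
  have -> : (e / 2 * d%:R) ^+ 2 / (2 * (kappa / 2)) = eps / 2.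
    by rewrite epsE; field; rewrite gt_eqF.
  have := el1 s; have := el2 s; have := dot_ge0 t; have := dot_ge0 s.
  have q0 : 0 <= kappa * dot n t ^+ 2 by rewrite mulr_ge0 ?sqr_ge0 // ltW.
  move: (\sum_i _) => B; move=> h1 h2 h3 h4 h5.
  have : kappa * dot n s ^+ 2 <= kappa * dot s s by rewrite ler_wpM2l // ltW.
  have : eps * dot s s <= kappa / 2 * dot s s by rewrite ler_wpM2r.
  lra.
have [vs Hvs] := psd_decomp symM psdM.
pose X (v : 'I_d + 'I_d -> R) : pt * pt := (\row_i v (inl i), \row_i v (inr i)).
have H11 i j : Q1 i j = \sum_(v <- vs) (X v).1 ord0 i * (X v).1 ord0 j.
  by have /= -> := Hvs (inl i) (inl j); apply: eq_bigr => v _; rewrite !mxE.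
have H22 i j : Q2 i j = \sum_(v <- vs) (X v).2 ord0 i * (X v).2 ord0 j.
  by have /= -> := Hvs (inr i) (inr j); apply: eq_bigr => v _; rewrite !mxE.
have H12 i j : P i j = \sum_(v <- vs) (X v).1 ord0 i * (X v).2 ord0 j.
  by have /= -> := Hvs (inl i) (inr j); apply: eq_bigr => v _; rewrite !mxE.
have HN i j : \sum_(v <- vs) ((X v).1 - (X v).2) ord0 i * ((X v).1 - (X v).2) ord0 j =
   2 * N i j.
  have -> : 2 * N i j = Q1 i j + Q2 i j - P i j - P j i.
    by rewrite (symP j i) /P; field.
  rewrite H11 H22 !H12 -big_split -!sumrB /=; apply: eq_bigr => v _.
  by rewrite !mxE; ring.
exists (map X vs); split.
- by move=> i j; rewrite big_map.
- by move=> i j; rewrite big_map.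
- rewrite big_map /dot exchange_big /=; under eq_bigr => i _ do rewrite HN.
  rewrite -mulr_sumr; congr (_ * _); rewrite big_split /=.
  under eq_bigr => i _ do rewrite eqxx mulr1.
  rewrite sumr_const card_ord; congr (_ + _); first by rewrite mulr_natr.
  transitivity (kappa * dot n n); last by rewrite nn mulr1.
  by rewrite /dot mulr_sumr; apply: eq_bigr => i _; rewrite mulrA.
- rewrite big_map.
  have -> : 2 * (eps + kappa) = 2 * (eps * dot n n + kappa * dot n n ^+ 2).
    by rewrite nn expr1n !mulr1.
  rewrite -qform_reflect mulr_sumr.
  have E (v : 'I_d + 'I_d -> R) : dot n ((X v).1 - (X v).2) ^+ 2 = \sum_i \sum_j n ord0 i *
     (((X v).1 - (X v).2) ord0 i * ((X v).1 - (X v).2) ord0 j) * n ord0 j.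
    rewrite expr2 {1}/dot mulr_suml; apply: eq_bigr => i _.
    by rewrite /dot mulr_sumr; apply: eq_bigr => j _; ring.
  under eq_bigr => v _ do rewrite E.
  rewrite exchange_big /=; apply: eq_bigr => i _.
  rewrite exchange_big mulr_sumr /=; apply: eq_bigr => j _.
  by rewrite -mulr_suml -mulr_sumr HN /N; ring.
Qed.

End Coupling.

Section InteriorLipschitz.
Variables (R : realType) (d : nat).
Local Notation pt := (pt R d).

(* Second-order upper bound touching the Euclidean norm at r0 n. *)
Lemma enorm_touch (n w : pt) (r0 : R) : dot n n = 1 -> 0 < r0 ->
  r0 / 2 <= dot n w ->
  enorm w <= dot n w + (dot w w - dot n w ^+ 2) / r0.
Proof.
move=> nn r00 pw.
have q0 : 0 <= dot w w - dot n w ^+ 2.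
  have := dot_le_norm n w; rewrite {1}enorm_dot nn sqrtr1 mul1r => h.
  rewrite subr_ge0 -enorm2 -(real_normK (num_real (dot n w))).
  by rewrite ler_pXn2r ?nnegrE ?enorm_ge0.
have p0 : 0 < dot n w by lra.
rewrite -(@ler_pXn2r _ 2) ?nnegrE ?enorm_ge0 //; last first.
  by rewrite addr_ge0 ?(ltW p0) // divr_ge0 // ltW.
rewrite enorm2; set q := dot w w - _ in q0 *; set p := dot n w in pw p0 *.
have -> : dot w w = p ^+ 2 + q by rewrite /q /p; ring.
rewrite sqrrD -addrA lerD2l; have : 0 <= (q / r0) ^+ 2 by exact: sqr_ge0.
have -> : (p * (q / r0)) *+ 2 = q * (2 * p / r0) by rewrite -mulr_natl; field; rewrite gt_eqF.
have : q * 1 <= q * (2 * p / r0).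
  by rewrite ler_wpM2l // ler_pdivlMr // mul1r; lra.
lra.
Qed.

Lemma doubling_arith (K r0 t nz zz xu yv xx yy uu vv w1 w2 w1' w2' eW th q : R) :
  w1' - w2' - K * (eW - (r0 ^+ 2 + 2 * t * r0 * nz + t * t * zz) / 4) -
    2 * (xx + 2 * t * xu + t * t * uu) - 2 * (yy + 2 * t * yv + t * t * vv) -
    2 * (1 - th) <=
    w1 - w2 - K * (r0 - r0 ^+ 2 / 4) - 2 * xx - 2 * yy - 2 * (1 - th) ->
  K * eW <= K * (r0 + t * nz + t * t * q) ->
  1 * w1' + -1 * w2' <= 1 * w1 + -1 * w2 +
    (K * (1 - r0 / 2) * nz + 4 * xu + 4 * yv) * t +
    (K * (q - zz / 4) + 2 * uu + 2 * vv) * (t * t) + 0 * `|t| * (t * t).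
Proof. lra. Qed.

Lemma drift_arith (S1 S2 k nb1 nb2 xb yb E M t1 t2 KL : R) :
  S1 - S2 <= E + 4 * (t1 + t2) -> t1 <= M -> t2 <= M ->
  k * (nb1 - nb2) <= KL -> xb <= M -> yb <= M ->
  S1 + (k * nb1 + 4 * xb) - (S2 + (k * nb2 - 4 * yb)) <= E + 8 * M + KL + 8 * M.
Proof. lra. Qed.

Variables (Q : pt -> 'M[R]_d) (b : pt -> 'rV[R]_d) (kappa Lam N : R).
Hypothesis symQ : forall x, (Q x)^T = Q x.
Hypothesis kappa_gt0 : 0 < kappa.
Hypothesis ellQ : forall x (v : pt), kappa * dot v v <= qform (Q x) (v ord0).
Hypothesis Lam_gt0 : 0 < Lam.
Hypothesis lipQ : forall x y, enorm x <= 1 -> enorm y <= 1 ->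
  forall i j, `|Q x i j - Q y i j| <= Lam * enorm (x - y).
Hypothesis lipb : forall x y, enorm x <= 1 -> enorm y <= 1 ->
  enorm (b x - b y) <= Lam * enorm (x - y).
Hypothesis N_ge0 : 0 <= N.
Hypothesis trQ : forall x, enorm x <= 1 -> \tr (Q x) <= N.
Hypothesis bN : forall x, enorm x <= 1 -> enorm (b x) <= N.

(* Doubling of variables: the maximum of
   w(t,x) - w(t,y) - K (r - r^2/4) - 2|x|^2 - 2|y|^2 - 2(1-t), r = |x - y|,
   is tested against the reflection coupling, along which r has no
   second-order contribution of order 1/r. *)
Lemma interior_lipschitz (G : R) : exists2 K : R, 0 < K & forall w z : R -> pt -> R,
  C12 w -> (forall t x, 0 <= t <= 1 -> `|w t x| <= 1) ->
  (forall t x, 0 < t <= 1 -> enorm x <= 1 ->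
     'D_1 (fun s => w s x) t = Aop Q b (w t) x + z t x) ->
  (forall t x, 0 < t <= 1 -> enorm x <= 1 -> `|z t x| <= G) ->
  forall x, enorm x <= 1 -> w 1 0 - w 1 x <= K * enorm x.
Proof.
have [dR dRE dR0] : exists2 dR : R, d%:R = dR & 0 <= dR.
  by exists d%:R => //; rewrite ler0n.
(* [Z] collects the errors of the final inequality, against which the concavity of [r - r^2 / 4]
   yields the gain [K kappa = Z]. The 3 exceeds the time penalty 2 for strictness; the last summand
   secures [eps <= kappa / 2], the condition of the coupling. *)
pose Z := 3 + 8 * Lam ^+ 2 * dR ^+ 3 / kappa + 16 * N + 4 * Lam + 2 * `|G| + 4 * Lam * dR.
have pos1 : 0 <= 8 * Lam ^+ 2 * dR ^+ 3 / kappa.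
  apply: divr_ge0; last exact: ltW.
  by apply: mulr_ge0; [apply: mulr_ge0 => //; exact: sqr_ge0|exact: exprn_ge0].
have pos2 : 0 <= 4 * Lam * dR by rewrite !mulr_ge0 // ltW.
have G0 := normr_ge0 G.
have Lam0 := Lam_gt0; have N0 := N_ge0.
have Z0 : 0 < Z by rewrite /Z; lra.
have Z1 : 4 * Lam * dR <= Z by rewrite /Z; lra.
pose K := Z / kappa.
have K0 : 0 < K by rewrite divr_gt0.
have Kk : K * kappa = Z by rewrite /K mulfVK // gt_eqF.
(* The extra 2 absorbs the penalty [2 |x|^2 <= 2 |x|] at the point [(1, (0, x))]. *)
exists (K + 2); first by lra.
move=> w z Cw w1 PDE zG x0 x01.
pose F (q : R * (pt * pt)) := w q.1 q.2.1 - w q.1 q.2.2 -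
  K * (enorm (q.2.1 - q.2.2) - dot (q.2.1 - q.2.2) (q.2.1 - q.2.2) / 4) -
  2 * dot q.2.1 q.2.1 - 2 * dot q.2.2 q.2.2 - 2 * (1 - q.1).
pose D : set (R * (pt * pt)) := `[0, 1] `*` ([set x | enorm x <= 1] `*` [set x | enorm x <= 1]).
suff F0 qs : D qs -> F qs <= 0.
  have : D (1, (0, x0)).
    by split; [rewrite /= in_itv /= ler01 lexx|split; rewrite /= ?enorm0].
  move=> /F0; rewrite /F /= sub0r enormN subrr mulr0 subr0.
  have -> : dot (0 : pt) 0 = 0 by rewrite -enorm2 enorm0 expr0n.
  rewrite -!enorm2 enormN => H.
  have r2 : enorm x0 ^+ 2 <= enorm x0 by rewrite expr2 ler_piMr ?enorm_ge0.
  have : 0 <= K * enorm x0 ^+ 2 by rewrite mulr_ge0 ?sqr_ge0 // ltW.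
  lra.
move=> Dq; rewrite leNgt; apply/negP => Fq0.
have cD : compact D.
  apply: compact_setX; first exact: segment_compact.
  by apply: compact_setX; exact: compact_eball0.
have cvg1 (q : R * (pt * pt)) : q'.1 @[q' --> within D (nbhs q)] --> q.1.
  by apply: cvg_within_filter; exact: cvg_fst.
have cvg21 (q : R * (pt * pt)) : q'.2.1 @[q' --> within D (nbhs q)] --> q.2.1.
  by apply: cvg_within_filter; apply: (cvg_comp snd fst); [exact: cvg_snd|exact: cvg_fst].
have cvg22 (q : R * (pt * pt)) : q'.2.2 @[q' --> within D (nbhs q)] --> q.2.2.
  by apply: cvg_within_filter; apply: (cvg_comp snd snd); [exact: cvg_snd|exact: cvg_snd].
have cw (q : R * (pt * pt)) (h : R * (pt * pt) -> pt) : D q ->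
    h q' @[q' --> within D (nbhs q)] --> h q ->
    w q'.1 (h q') @[q' --> within D (nbhs q)] --> w q.1 (h q).
  move=> Dq' ch.
  have q10 : 0 <= q.1 by case: Dq'; rewrite /= in_itv /= => /andP[].
  have H := @C12_cvg _ _ w [set q | 0 <= q.1] (q.1, h q) Cw (fun _ => id) q10.
  apply: (cvg_comp (fun q' : R * (pt * pt) => (q'.1, h q')) (fun q => w q.1 q.2) _ H).
  move=> A nA.
  have nB : within D (nbhs q) (fun q' : R * (pt * pt) => 0 <= q'.1 -> A (q'.1, h q')).
    exact: (cvg_pair (cvg1 q) ch nA).
  have nC : within D (nbhs q) D by exact: withinT.
  apply: filterS2 nB nC => q' HA [+ _]; rewrite /= in_itv /= => /andP[? _].
  exact: HA.
have [q' Dq'|[th [xh yh]] Dh Fmax] := @EVT_within _ _ D (fun q => - F q) (ex_intro _ qs Dq) cD.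
  apply: cvgN; apply: cvgB; last first.
    by apply: cvgM; [exact: cvg_cst|apply: cvgB => //; exact: cvg_cst].
  apply: cvgB; last by apply: cvgM; [exact: cvg_cst|exact: cvg_dot].
  apply: cvgB; last by apply: cvgM; [exact: cvg_cst|exact: cvg_dot].
  have c12 : q''.2.1 - q''.2.2 @[q'' --> within D (nbhs q')] --> q'.2.1 - q'.2.2.
    exact: cvgB.
  apply: cvgB; last first.
    apply: cvgM; first exact: cvg_cst.
    apply: cvgB; first exact: cvg_enorm.
    by apply: cvgM; [exact: cvg_dot|exact: cvg_cst].
  apply: cvgB.
    exact: (cw q' (fun q => q.2.1)).
  exact: (cw q' (fun q => q.2.2)).
have {}Fmax q' : D q' -> F q' <= F (th, (xh, yh)) by move=> /Fmax; rewrite lerN2.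
have Fpos : 0 < F (th, (xh, yh)) by exact: lt_le_trans Fq0 (Fmax _ Dq).
case: Dh; rewrite /= in_itv /= => th01 [/= xh1 yh1].
pose r0 := enorm (xh - yh).
have r0_ge0 : 0 <= r0 by exact: enorm_ge0.
have r02 : r0 <= 2 by rewrite /r0 (le_trans (enormB _ _)) //; lra.
have k1 : 0 <= 1 - r0 / 2 by lra.
have k2 : 1 - r0 / 2 <= 1 by lra.
have r20 : 0 < r0 -> 0 < r0 / 2 by move=> ?; lra.
have rr : dot (xh - yh) (xh - yh) = r0 ^+ 2 by rewrite -enorm2.
have om : r0 / 2 <= r0 - r0 ^+ 2 / 4.
  by have : r0 ^+ 2 <= 2 * r0; [rewrite expr2 ler_wpM2r|lra].
have Kom : K * (r0 / 2) <= K * (r0 - r0 ^+ 2 / 4) by rewrite ler_pM2l.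
have Kr0 : 0 <= K * r0 by rewrite mulr_ge0 // ltW.
have wx := w1 th xh th01; have wy := w1 th yh th01.
have wd : w th xh - w th yh <= 2.
  by move: wx wy; rewrite !ler_norml => /andP[? ?] /andP[? ?]; lra.
have dx := dot_ge0 xh; have dy := dot_ge0 yh.
move: (Fpos); rewrite /F /= -/r0 rr => FP.
have t1 : 0 <= 1 - th by have /andP[] := th01; lra.
(* The penalties match the oscillation bound 2 of [w]: a positive value of [F] excludes time 0,
   keeps both points in the open unit ball, separates them, and gives [K r0 <= 4]. *)
have th0 : 0 < th.
  rewrite lt_def (andP th01).1 andbT; apply/negP => /eqP E; rewrite E in FP wd; lra.
have small (y : pt) : enorm y <= 1 -> dot y y < 1 -> enorm y < 1.
  move=> y1 yd; rewrite lt_def y1 andbT; apply/negP => /eqP E.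
  by move: yd; rewrite -enorm2 -E expr1n ltxx.
have xs : enorm xh < 1 by apply: small => //; lra.
have ys : enorm yh < 1 by apply: small => //; lra.
have r0_gt0 : 0 < r0.
  rewrite lt_def r0_ge0 andbT; apply/negP => /eqP E.
  have xy : xh = yh by apply/eqP; rewrite -subr_eq0; apply/eqP/enorm_eq0.
  move: FP; rewrite E xy; move: dy; lra.
have Kr : K * r0 <= 4 by lra.
pose n := r0^-1 *: (xh - yh).
have nn : dot n n = 1.
  rewrite /n dotZl dotZr rr; field; by rewrite gt_eqF.
have xyn : xh - yh = r0 *: n by rewrite /n scalerA mulfV ?scale1r // gt_eqF.
have th1 : 0 < th <= 1 by rewrite th0 (andP th01).2.
have C2w := C12_C2 Cw th0.
pose A (u v : pt) := K * (1 - r0 / 2) * dot n (u - v) + 4 * dot xh u + 4 * dot yh v.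
pose B (u v : pt) := K * ((dot (u - v) (u - v) - dot n (u - v) ^+ 2) / r0 -
   dot (u - v) (u - v) / 4) + 2 * dot u u + 2 * dot v v.
have space (u v : pt) : Dv (w th) xh u - Dv (w th) yh v = A u v /\
    Hv (w th) xh u - Hv (w th) yh v <= 2 * B u v.
  have cvl (y e : pt) : t *: e + y @[t --> (0 : R)] --> y.
    rewrite -{2}(add0r y); apply: cvgD; last exact: cvg_cst.
    rewrite -[X in _ --> X](scale0r e).
    by apply: cvgZ; [exact: cvg_id|exact: cvg_cst].
  have nlt (y e : pt) : enorm y < 1 -> \forall t \near (0 : R), enorm (t *: e + y) < 1.
    move=> y1; have y10 : 0 < 1 - enorm y by rewrite subr_gt0.
    have /cvgrPdist_lt/(_ _ y10) : enorm (t *: e + y) @[t --> (0 : R)] --> enorm y.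
      by apply: cvg_enorm; exact: cvl.
    by apply: filterS => t; rewrite ltr_norml => /andP[]; lra.
  have nn1 := nlt xh u xs; have nn2 := nlt yh v ys.
  have nn3 : \forall t \near (0 : R), r0 / 2 <= dot n (t *: (u - v) + (xh - yh)).
    have E : dot n (xh - yh) = r0 by rewrite xyn dotZr nn mulr1.
    have /cvgrPdist_lt/(_ _ (r20 r0_gt0)) : dot n (t *: (u - v) + (xh - yh)) @[t --> (0 : R)]
        --> dot n (xh - yh).
      by apply: cvg_dot; [exact: cvg_cst|exact: cvl].
    by apply: filterS => t; rewrite E ltr_norml => /andP[]; lra.
  have NN : \forall t \near (0 : R), 1 * w th (t *: u + xh) + -1 * w th (t *: v + yh) <=
     1 * w th xh + -1 * w th yh + A u v * t + B u v * (t * t) + 0 * `|t| * (t * t).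
    apply: filterS3 nn1 nn2 nn3 => t h1 h2 h3.
    have Dt : D (th, (t *: u + xh, t *: v + yh)).
      by split; [rewrite /= in_itv|split; apply: ltW].
    have := Fmax _ Dt; rewrite /F /=.
    have -> : t *: u + xh - (t *: v + yh) = t *: (u - v) + (xh - yh).
      by rewrite scalerBr opprD addrACA.
    have := enorm_touch nn r0_gt0 h3.
    set W := t *: (u - v) + (xh - yh); set ze := u - v.
    have W1 : dot n W = r0 + t * dot n ze.
      by rewrite /W dotDr dotZr xyn dotZr nn mulr1 addrC.
    have W2 : dot W W = r0 ^+ 2 + 2 * t * r0 * dot n ze + t * t * dot ze ze.
      by rewrite /W enorm_line rr xyn dotZl; ring.
    have -> : (dot W W - dot n W ^+ 2) / r0 = t * t * ((dot ze ze - dot n ze ^+ 2) / r0).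
      by rewrite W1 W2; field; rewrite gt_eqF.
    rewrite W1 W2 !enorm_line -/r0 rr => touch.
    move=> hF; apply: doubling_arith hF (ler_wpM2l (ltW K0) touch).
  have [h1 h2] := @two_point_test _ _ _ _ xh yh u v 1 (-1) (A u v) (B u v) 0 C2w C2w NN.
  by move: h1 h2; rewrite !mul1r !mulN1r.
have e0 : 0 < Lam * r0 by rewrite mulr_gt0.
pose eps := (Lam * r0 * dR) ^+ 2 / (2 * kappa).
have LK : Lam * r0 * dR <= kappa.
  rewrite -(ler_pM2l K0) Kk.
  have : Lam * dR * (K * r0) <= Lam * dR * 4 by rewrite ler_wpM2l // mulr_ge0 // ltW.
  move=> H; apply: le_trans Z1; move: H; rewrite [leLHS](_ : _ = K * (Lam * r0 * dR)); last by ring.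
  by rewrite [leRHS](_ : _ = 4 * Lam * dR) //; ring.
have epsk : eps <= kappa / 2.
  have -> : kappa / 2 = kappa ^+ 2 / (2 * kappa) by field; rewrite gt_eqF.
  rewrite ler_pM2r ?invr_gt0 ?mulr_gt0 //.
  by rewrite ler_pXn2r ?nnegrE ?mulr_ge0 // ltW.
have := @reflection_coupling R d (Q xh) (Q yh) kappa (Lam * r0) eps n
  (symQ xh) (symQ yh) kappa_gt0 e0 nn (ellQ xh) (ellQ yh) (lipQ xh1 yh1).
rewrite dRE => /(_ erefl epsk)[vs [HQ1 HQ2 Hz Hn]].
have HQ1' i j : Q xh i j = \sum_(v <- map fst vs) v ord0 i * v ord0 j.
  by rewrite big_map HQ1.
have HQ2' i j : Q yh i j = \sum_(v <- map snd vs) v ord0 i * v ord0 j.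
  by rewrite big_map HQ2.
(* The factor [1 / r0] meets only the transverse part of [v.1 - v.2], equal to [2 eps (d - 1)] with
   [eps] of order [r0^2]. The term [- K kappa] is the concavity of the profile in the reflected
   direction. *)
have sumH : \sum_(v <- vs) (Hv (w th) xh v.1 - Hv (w th) yh v.2) <=
   4 * K * eps * dR / r0 - K * kappa + 4 * (\tr (Q xh) + \tr (Q yh)).
  apply: (@le_trans _ _ (\sum_(v <- vs) 2 * B v.1 v.2)).
    by apply: ler_sum => v _; exact: (space v.1 v.2).2.
  have -> : \sum_(v <- vs) 2 * B v.1 v.2 =
     2 * (K * ((\sum_(v <- vs) dot (v.1 - v.2) (v.1 - v.2) -
       \sum_(v <- vs) dot n (v.1 - v.2) ^+ 2) / r0 -
      (\sum_(v <- vs) dot (v.1 - v.2) (v.1 - v.2)) / 4)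
      + 2 * (\sum_(v <- vs) dot v.1 v.1) + 2 * \sum_(v <- vs) dot v.2 v.2).
    rewrite -sumrB !mulr_suml -sumrB !mulr_sumr -!big_split /= mulr_sumr.
    by apply: eq_bigr => v _.
  rewrite Hz Hn (trace_decomp HQ1') (trace_decomp HQ2') !big_map.
  have eps0 : 0 <= eps by rewrite divr_ge0 ?sqr_ge0 // mulr_ge0 // ltW.
  have Ke : 0 <= K * eps by exact: mulr_ge0 (ltW K0) eps0.
  have : 0 <= K * eps / r0 by exact: divr_ge0.
  have : 0 <= K * eps * dR by exact: mulr_ge0.
  have -> : 2 * (eps * dR + kappa) - 2 * (eps + kappa) = 2 * eps * dR - 2 * eps by ring.
  lra.
have Dx : Dv (w th) xh (b xh) = K * (1 - r0 / 2) * dot n (b xh) + 4 * dot xh (b xh).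
  have [+ _] := space (b xh) 0; rewrite /A subr0.
  have -> : dot yh (0 : pt) = 0 by rewrite -(scale0r (0 : pt)) dotZr mul0r.
  have -> : Dv (w th) yh 0 = 0.
    by rewrite /Dv big1 // => i _; rewrite mxE mul0r.
  by lra.
have Dy : Dv (w th) yh (b yh) = K * (1 - r0 / 2) * dot n (b yh) - 4 * dot yh (b yh).
  have [+ _] := space 0 (b yh); rewrite /A sub0r (dotC n) dotNl (dotC _ n).
  have -> : dot xh (0 : pt) = 0 by rewrite -(scale0r (0 : pt)) dotZr mul0r.
  have -> : Dv (w th) xh 0 = 0.
    by rewrite /Dv big1 // => i _; rewrite mxE mul0r.
  by lra.
have AA : Aop Q b (w th) xh - Aop Q b (w th) yh <=
    4 * K * eps * dR / r0 - K * kappa + 8 * N + K * (Lam * r0) + 8 * N.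
  rewrite (Aop_decomp _ _ HQ1') (Aop_decomp _ _ HQ2') Dx Dy !big_map.
  move: sumH; rewrite sumrB => sumH.
  have := trQ xh1; have := trQ yh1 => tq1 tq2.
  have c1 : dot n (b xh) - dot n (b yh) <= Lam * r0.
    rewrite -dotBr (le_trans (cauchy_schwarz _ _)) // {1}enorm_dot nn sqrtr1 mul1r.
    exact: lipb.
  have c0 : 0 <= Lam * r0 by exact: ltW.
  have c2 : K * (1 - r0 / 2) * (dot n (b xh) - dot n (b yh)) <= K * (Lam * r0).
    rewrite -mulrA ler_pM2l //.
    by apply: le_trans (ler_wpM2l k1 c1) _; rewrite ler_piMl.
  have bb (y : pt) : enorm y <= 1 -> dot y (b y) <= N.
    move=> y1; rewrite (le_trans (cauchy_schwarz _ _)) // (le_trans _ (bN y1)) //.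
    by rewrite ler_piMl ?enorm_ge0.
  exact: drift_arith sumH tq2 tq1 c2 (bb xh xh1) (bb yh yh1).
have epsr : 4 * K * eps * dR / r0 <= 8 * Lam ^+ 2 * dR ^+ 3 / kappa.
  have -> : 4 * K * eps * dR / r0 = (2 * Lam ^+ 2 * dR ^+ 3 / kappa) * (K * r0).
    by rewrite /eps; field; rewrite !gt_eqF.
  have -> : 8 * Lam ^+ 2 * dR ^+ 3 / kappa = (2 * Lam ^+ 2 * dR ^+ 3 / kappa) * 4.
    by field; rewrite gt_eqF.
  by rewrite ler_wpM2l //; lra.
have KL : K * (Lam * r0) <= 4 * Lam.
  by rewrite mulrCA mulrC ler_pM2r.
have DF : is_derive th 1 (fun s => - F (s, (xh, yh)))
   (- ('D_1 (fun s => w s xh) th - 'D_1 (fun s => w s yh) th + 2)).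
  have H1 := is_derive_lin (-1) 1 (C12_is_derive xh Cw th0) (C12_is_derive yh Cw th0).
  have H2 := is_deriveD H1 (is_derive_quad (-2) 0 th).
  pose k0 := K * (r0 - r0 ^+ 2 / 4) + 2 * dot xh xh + 2 * dot yh yh + 2.
  have H3 := is_deriveD H2 (is_derive_cst k0 th 1).
  have -> : (fun s => - F (s, (xh, yh))) = (fun y => -1 * w y xh + 1 * w y yh) +
    (fun t => -2 * t + 0 * (t * t)) + cst k0.
    by apply/funext => s; rewrite !fctE /F /k0 /= -/r0 rr; ring.
  by apply: is_derive_eq H3 _; ring.
have time : - ('D_1 (fun s => w s xh) th - 'D_1 (fun s => w s yh) th + 2) <= 0.
  apply: derive_left_le0 DF _; near=> s; rewrite lerN2; apply: Fmax; split => //=.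
  rewrite in_itv /=; apply/andP; split.
    by apply: ltW; near: s; exact: nbhs_left_gt.
  by rewrite (le_trans _ (andP th01).2) //; near: s; exact: nbhs_left_le.
move: time; rewrite !PDE //.
have := zG th xh th1 xh1; have := zG th yh th1 yh1.
rewrite !ler_norml => /andP[g1 g2] /andP[g3 g4].
have := ler_norm G; move: Kk AA epsr KL; rewrite /Z; lra.
Unshelve. all: by end_near. Qed.

End InteriorLipschitz.

(** * Local boundedness, continuity and Lipschitz bounds from Hoelder conditions *)

Section Hoelder.
Variables (R : realType) (d : nat).
Local Notation pt := (pt R d).
Implicit Types f : pt -> R.

Lemma cvg_dist_le (T : Type) (F : set_system T) (FF : Filter F) (h : T -> R) (l : R) :
  (forall e, 0 < e -> \forall x \near F, `|l - h x| <= e) -> h @ F --> l.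
Proof. by move=> H; apply/cvgrPdist_le. Qed.

Lemma holder_locally_bounded (alpha : R) f : 0 < alpha -> holder_loc alpha f ->
  locally_bounded f.
Proof.
move=> al0 hf r; have r0 : 0 < `|r| + 1 by rewrite ltr_wpDl.
have [K HK] := hf _ r0; exists (`|f 0| + `|K| * (`|r| + 1) `^ alpha) => x xr.
have xr1 : enorm x <= `|r| + 1 by rewrite (le_trans xr) // (le_trans (ler_norm _)) // lerDl.
have := HK x 0 xr1; rewrite enorm0 subr0 => /(_ (ltW r0)) H.
rewrite -{1}(subrK (f 0) (f x)) addrC (le_trans (ler_normD _ _)) // lerD2l.
rewrite (le_trans H) // (@le_trans _ _ (`|K| * enorm x `^ alpha)) //.
  by rewrite ler_wpM2r ?powR_ge0 // ler_norm.
by rewrite ler_wpM2l // ge0_ler_powR ?nnegrE ?enorm_ge0 // ltW.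
Qed.

Lemma holder_continuous (alpha : R) f : 0 < alpha -> holder_loc alpha f ->
  continuous f.
Proof.
move=> al0 hf x; have r0 : 0 < enorm x + 1 by rewrite ltr_wpDl ?enorm_ge0.
have [K HK] := hf _ r0.
apply: (@cvg_dist_le pt (nbhs x) _ f (f x)) => e e0.
pose c := e / (`|K| + 1).
have K1 : 0 < `|K| + 1 by rewrite ltr_wpDl.
have c0 : 0 < c by rewrite divr_gt0.
have d0 : 0 < c `^ alpha^-1 by rewrite powR_gt0.
have cx : enorm (y - x) @[y --> x] --> enorm (x - x).
  apply: (@cvg_enorm _ _ pt (nbhs x) _ (fun y => y - x)).
  by apply: cvgB; [exact: cvg_id|exact: cvg_cst].
rewrite subrr enorm0 in cx.
have n1 : \forall y \near x, enorm (y - x) <= 1.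
  move/cvgrPdist_le: cx => /(_ _ ltr01); apply: filterS => y.
  by rewrite sub0r normrN ger0_norm ?enorm_ge0.
have n2 : \forall y \near x, enorm (y - x) <= c `^ alpha^-1.
  move/cvgrPdist_le: cx => /(_ _ d0); apply: filterS => y.
  by rewrite sub0r normrN ger0_norm ?enorm_ge0.
near=> y.
have y1 : enorm (y - x) <= 1 by near: y.
have y2 : enorm (y - x) <= c `^ alpha^-1 by near: y.
have yr : enorm y <= enorm x + 1.
  by rewrite -(subrK x y) addrC (le_trans (enormD _ _)) // lerD2l.
have xr : enorm x <= enorm x + 1 by rewrite lerDl.
apply: le_trans (HK x y xr yr) _; rewrite enormBC.
apply: (@le_trans _ _ ((`|K| + 1) * c)); last by rewrite /c mulrC mulfVK // gt_eqF.
apply: (@le_trans _ _ ((`|K| + 1) * enorm (y - x) `^ alpha)).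
  by rewrite ler_wpM2r ?powR_ge0 // (le_trans (ler_norm _)) // lerDl.
rewrite ler_pM2l //.
have -> : c = (c `^ alpha^-1) `^ alpha.
  by rewrite -powRrM mulVf ?gt_eqF // powRr1 // ltW.
by rewrite ge0_ler_powR ?nnegrE ?enorm_ge0 // ?powR_ge0 // ltW.
Unshelve. all: by end_near. Qed.

Lemma C1holder_lipschitz (alpha : R) f : 0 < alpha -> C1holder_loc alpha f ->
  exists2 L, 0 <= L & forall x y, enorm x <= 1 -> enorm y <= 1 ->
    `|f x - f y| <= L * enorm (x - y).
Proof.
move=> al0 [_ [df hdf]].
have [B B0 HB] : exists2 B, 0 <= B & forall i x, enorm x <= 1 -> `|dpart i f x| <= B.
  apply: finite_bound => [i|i M M' MM' H x x1]; last exact: le_trans (H x x1) MM'.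
  exact: (holder_locally_bounded al0 (hdf i) 1).
exists (d%:R * B); first by rewrite mulr_ge0.
move=> x y x1 y1.
have cf i : continuous (dpart i f) by exact: holder_continuous (hdf i).
have D s := is_derive_line (C1_is_derive df cf (s *: (x - y) + y) (x - y)).
have [s] := mean_value D 0 1.
rewrite (min_idPl (@ler01 R)) (max_idPr (@ler01 R)) => /andP[s0 s1].
rewrite scale1r scale0r add0r subrK subr0 mulr1 => ->.
have p1 : enorm (s *: (x - y) + y) <= 1.
  have -> : s *: (x - y) + y = s *: x + (1 - s) *: y.
    by rewrite scalerBr scalerBl scale1r -addrA (addrC y).
  have s1' : 0 <= 1 - s by lra.
  rewrite (le_trans (enormD _ _)) // !enormZ !ger0_norm //.
  have := ler_wpM2l s0 x1; have := ler_wpM2l s1' y1; lra.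
rewrite (le_trans (ler_norm_sum _ _ _)) //.
apply: (@le_trans _ _ (\sum_(i < d) enorm (x - y) * B)).
  apply: ler_sum => i _; rewrite normrM ler_pM // ?HB //; exact: coord_le_enorm.
by rewrite sumr_const card_ord -mulr_natl; lra.
Qed.

End Hoelder.

(** * Doeblin dichotomy and oscillation decay *)

Section Doeblin.
Variables (R : realType) (d m : nat).
Local Notation pt := (pt R d).
Variables (Q : pt -> 'M[R]_d) (b : pt -> 'rV[R]_d) (C : pt -> 'M[R]_m).
Variables (kappa : R) (xi : 'cV[R]_m).
Hypothesis symQ : forall x, (Q x)^T = Q x.
Hypothesis kappa_gt0 : 0 < kappa.
Hypothesis ellQ : forall x (v : pt), kappa * dot v v <= qform (Q x) (v ord0).
Hypothesis bndQ : locally_bounded (fun x => \tr (Q x)).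
Hypothesis bndb : locally_bounded (fun x => enorm (b x)).
Hypothesis bndC : forall h k, locally_bounded (fun x => C x h k).
Hypothesis contC : forall h k, continuous (fun x => C x h k).
Hypothesis coop : forall x h k, h != k -> 0 <= C x h k.
Hypothesis irred : forall K : {set 'I_m}, (0 < #|K|)%N -> (#|K| < m)%N ->
  ~ (forall i j, i \in K -> j \notin K -> forall x, C x i j = 0).

Definition nonneg_sol (u : R -> pt -> 'cV[R]_m) : Prop :=
  (exists f, system_sol Q b C u f) /\ forall t x i, 0 <= t -> 0 <= u t x i ord0.

(** The discarded coupling terms are nonnegative, so each component is a supersolution of a scalar
    equation with potential [C x i i], to which the barriers apply. *)
Lemma nonneg_sol_diag u t x i : nonneg_sol u -> 0 < t ->
  Aop Q b (fun y => u t y i ord0) x + C x i i * u t x i ord0 <=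
  'D_1 (fun s => u s x i ord0) t.
Proof.
move=> [[f [_ [_ [_ Du]]]] u0] t0; rewrite Du // mxE lerD2l (bigD1 i) //= lerDl.
by apply: sumr_ge0 => k ki; rewrite mulr_ge0 ?u0 ?(ltW t0) // coop // eq_sym.
Qed.

Lemma nonneg_sol_coupled u t x i j : nonneg_sol u -> 0 < t -> i != j ->
  Aop Q b (fun y => u t y i ord0) x + (C x i i * u t x i ord0 + C x i j * u t x j ord0)
  <= 'D_1 (fun s => u s x i ord0) t.
Proof.
move=> [[f [_ [_ [_ Du]]]] u0] t0 ij; rewrite Du // mxE lerD2l (bigD1 i) //= lerD2l.
rewrite (bigD1 j) /=; last by rewrite eq_sym.
rewrite lerDl; apply: sumr_ge0 => k /andP[ki _].
by rewrite mulr_ge0 ?u0 ?(ltW t0) // coop // eq_sym.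
Qed.

Lemma positivity_everywhere (i0 : 'I_m) (rho eta : R) : 0 < rho -> 0 < eta ->
  exists2 tau, 0 < tau & forall r, exists2 delta, 0 < delta &
    forall u, nonneg_sol u -> (forall x, enorm x <= rho -> eta <= u 0 x i0 ord0) ->
    forall i x, enorm x <= r -> delta <= u tau x i ord0.
Proof.
move=> rho0 eta0.
(* Induction invariant: from [tk] on, the components in [J] are bounded below on every ball over
   every finite time span. Since [tk] is fixed before the ball, all components end up positive at
   one common time. *)
pose claim (J : {set 'I_m}) (tk : R) := forall r T : R, exists2 delta, 0 < delta &
    forall u, nonneg_sol u -> (forall x, enorm x <= rho -> eta <= u 0 x i0 ord0) ->
    forall t x j, tk <= t <= tk + T -> j \in J -> enorm x <= r -> delta <= u t x j ord0.
have step n : (n < m)%N -> exists (J : {set 'I_m}) (tk : R), [/\ #|J| = n.+1, 1 <= tk & claim J tk].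
  elim: n => [_|n IH nm].
    exists [set i0]%SET, 1; split; rewrite ?cards1 // => r T.
    have [del del0 H] := @positivity_spreads R d Q b kappa (fun x => C x i0 i0) symQ
      kappa_gt0 ellQ bndQ bndb (bndC i0 i0) 0 rho r (1 + T) rho0.
    exists (del * eta); first exact: mulr_gt0.
    move=> u su u0 t x j tt; rewrite inE => /eqP -> xr.
    have [[f [Cu _]] upos] := su.
    apply: (H (fun t x => u t x i0 ord0) 0 eta (Cu i0)) => //.
    - by move=> s y s0; exact: upos.
    - by move=> s y s0; exact: nonneg_sol_diag.
    - by move=> y; rewrite subr0; exact: u0.
    - by rewrite !add0r.
  have [J [tk [cJ tk1 HJ]]] := IH (ltnW nm).
  have cK : #|(~: J)%SET| = (m - n.+1)%N by rewrite cardsCs finset.setCK card_ord cJ.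
  (* Irreducibility of the complement of [J] provides a component [i] outside [J] that is fed by
     some [j] in [J] near a point [xs]. *)
  have /irred : (0 < #|(~: J)%SET|)%N by rewrite cK subn_gt0.
  have ltm : (m - n.+1 < m)%N by rewrite ltn_subrL (leq_ltn_trans _ nm).
  rewrite cK => /(_ ltm) ni.
  have [i [j [xs [iJ jJ Cij]]]] : exists i j xs, [/\ i \notin J, j \in J & C xs i j != 0].
    apply: contrapT => H; apply: ni => i j; rewrite !inE negbK => iJ jJ x.
    by apply/eqP/negPn/negP => Cx; apply: H; exists i, j, x.
  have ij : i != j by apply: contraNneq iJ => ->.
  pose c0 := C xs i j.
  have c00 : 0 < c0 by rewrite lt_def Cij coop.
  have [rh rh0 Hrh] : exists2 rh : R, 0 < rh & forall x, enorm (x - xs) <= rh -> c0 / 2 <= C x i j.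
    have c20 : 0 < c0 / 2 by rewrite divr_gt0.
    have /cvgrPdist_lt/(_ _ c20)/nbhs_ballP[e /= e0 He] := @contC i j xs.
    exists (e / 2); first by rewrite divr_gt0.
    move=> x xe; have : ball xs e x.
      rewrite -ball_normE /= (@le_lt_trans _ _ (e / 2)) //; last by rewrite gtr_pMr // invf_lt1 // ltr1n.
      apply: mxnorm_le => [|k]; first by rewrite divr_ge0 // ltW.
      by rewrite (le_trans _ xe) // enormBC coord_le_enorm.
    by move=> /He; rewrite ltr_norml -/c0 => /andP[_]; lra.
  have [d1 d10 H1] := HJ (enorm xs + rh) 1.
  have [d2 d20 H2] := @source_positivity R d Q b kappa (fun x => C x i i) symQ
      kappa_gt0 ellQ bndQ bndb (bndC i i) xs rh rh0.
  have s00 : 0 < c0 / 2 * d1 by rewrite mulr_gt0 // divr_gt0.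
  have rh20 : 0 < rh / 2 by rewrite divr_gt0.
  (* One unit of time lets the source create positivity of component [i] near [xs], a second one
     spreads it to any ball. *)
  exists (i |: J)%SET, (tk + 2); split; first by rewrite cardsU1 iJ cJ.
    by rewrite (le_trans tk1) // lerDl.
  move=> r T.
  have [d3 d30 H3] := @positivity_spreads R d Q b kappa (fun x => C x i i) symQ
      kappa_gt0 ellQ bndQ bndb (bndC i i) xs (rh / 2) r (1 + T) rh20.
  have [d4 d40 H4] := HJ r (T + 2).
  have di0 : 0 < d3 * (d2 * (c0 / 2 * d1)) by rewrite !mulr_gt0.
  exists (Num.min (d3 * (d2 * (c0 / 2 * d1))) d4); first by rewrite lt_min di0.
  move=> u su u0 t x j' /andP[tl tr] jJ' xr.
  have [[f [Cu _]] upos] := su.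
  have tk0 : 0 <= tk by rewrite (le_trans _ tk1).
  move: jJ'; rewrite finset.in_setU1 => /orP[/eqP ->|jJ']; last first.
    rewrite ge_min (H4 u su u0) ?orbT //; apply/andP; split; lra.
  rewrite ge_min; apply/orP; left.
  apply: (H3 (fun t x => u t x i ord0) (tk + 1) _ (Cu i)) => //.
  - by rewrite addr_ge0.
  - by rewrite mulr_gt0.
  - by move=> s y s1; apply: upos; rewrite (le_trans _ s1) // addr_ge0.
  - by move=> s y s1; apply: nonneg_sol_diag => //; rewrite (le_lt_trans _ s1) // addr_ge0.
  - move=> y yx; apply: (H2 (fun t x => u t x i ord0) tk _ (Cu i)) => //.
      by move=> s z s1; apply: upos; rewrite (le_trans _ s1).
    move=> s z /andP[s1 s2] zx.
    have s0 : 0 < s by rewrite (le_lt_trans _ s1).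
    apply: le_trans (nonneg_sol_coupled _ su s0 ij); rewrite lerD2l lerD2l.
    apply: ler_pM; [by rewrite divr_ge0 // ltW|exact: ltW|exact: Hrh|].
    apply: (H1 u su u0) => //; first by rewrite (ltW s1).
    by rewrite -(subrK xs z) addrC (le_trans (enormD _ _)) // lerD2l.
  - by apply/andP; split; lra.
have m0 : (m.-1 < m)%N by rewrite prednK // (leq_trans _ (ltn_ord i0)).
have [J [tk [cJ tk1 HJ]]] := step _ m0.
have JT j : j \in J.
  have : J == [set: 'I_m]%SET.
    have m1 : (0 < m)%N by rewrite (leq_trans _ (ltn_ord i0)).
    by rewrite eqEcard finset.subsetT finset.cardsT card_ord cJ prednK //= leqnn.
  by move=> /eqP ->; rewrite finset.in_setT.
exists tk; first by rewrite (lt_le_trans _ tk1).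
move=> r; have [del del0 H] := HJ r 0; exists del => // u su u0 i x xr.
by apply: (H u su u0) => //; rewrite addr0 lexx.
Qed.

End Doeblin.

(** * Dichotomy, weighted oscillation and its contraction *)

Section Harris.
Variables (R : realType) (d m : nat).
Local Notation pt := (pt R d).
Variables (Q : pt -> 'M[R]_d) (b : pt -> 'rV[R]_d) (C : pt -> 'M[R]_m).
Variables (phi : pt -> R) (a c kappa : R) (xi : 'cV[R]_m) (i0 : 'I_m).
Hypothesis symQ : forall x, (Q x)^T = Q x.
Hypothesis kappa_gt0 : 0 < kappa.
Hypothesis ellQ : forall x (v : pt), kappa * dot v v <= qform (Q x) (v ord0).
Hypothesis bndQ : locally_bounded (fun x => \tr (Q x)).
Hypothesis bndb : locally_bounded (fun x => enorm (b x)).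
Hypothesis bndC : forall h k, locally_bounded (fun x => C x h k).
Hypothesis contC : forall h k, continuous (fun x => C x h k).
Hypothesis lipQb : exists2 Lam, 0 < Lam & forall x y, enorm x <= 1 -> enorm y <= 1 ->
  (forall i j, `|Q x i j - Q y i j| <= Lam * enorm (x - y)) /\
  enorm (b x - b y) <= Lam * enorm (x - y).
Hypothesis phi_gt0 : forall x, 0 < phi x.
Hypothesis C2phi : C2 phi.
Hypothesis phi_inf : forall M : R, exists r : R, forall x, r <= enorm x -> M <= phi x.
Hypothesis a_gt0 : 0 < a.
Hypothesis c_gt0 : 0 < c.
Hypothesis Aphi : forall x, Aop Q b phi x <= a - c * phi x.
Hypothesis coop : forall x h k, h != k -> 0 <= C x h k.
Hypothesis irred : forall K : {set 'I_m}, (0 < #|K|)%N -> (#|K| < m)%N ->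
  ~ (forall i j, i \in K -> j \notin K -> forall x, C x i j = 0).
Hypothesis xi_gt0 : forall h, 0 < xi h ord0.
Hypothesis xi_le1 : forall h, xi h ord0 <= 1.
Hypothesis Cxi : forall x, C x *m xi = 0.

Let psdQ := psdQ_of_elliptic kappa_gt0 ellQ.
Let sol_le := system_sol_le_xi symQ psdQ phi_gt0 C2phi phi_inf a_gt0 c_gt0
  Aphi coop xi_gt0 Cxi.
Let sol_ge := system_sol_ge_xi symQ psdQ phi_gt0 C2phi phi_inf a_gt0 c_gt0
  Aphi coop xi_gt0 Cxi.
Let sol_ge0 := system_sol_ge0 symQ psdQ phi_gt0 C2phi phi_inf a_gt0 c_gt0
  Aphi coop xi_gt0 Cxi.
Let sol_unique := system_sol_unique symQ psdQ phi_gt0 C2phi phi_inf a_gt0 c_gt0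
  Aphi coop xi_gt0 Cxi.
Let sol_lyap := system_sol_lyapunov symQ psdQ phi_gt0 C2phi phi_inf a_gt0 c_gt0
  Aphi coop xi_gt0 Cxi.

(** Time 1 is spent on regularisation: with the coupling terms treated as a bounded source, the
    Lipschitz constant depends on [u] only through [|u| <= 1]. The ball of radius [rho] on which
    component [i0] is at least [xi_i0 / 4] is thus the same for all [f]. *)
Lemma half_positive : exists2 tau, 0 < tau & forall r, exists2 delta, 0 < delta &
  forall u f, system_sol Q b C u f ->
    (forall x i, 0 <= f x i ord0 <= xi i ord0) -> xi i0 ord0 / 2 <= u 1 0 i0 ord0 ->
    forall i x, enorm x <= r -> delta <= u tau x i ord0.
Proof.
have [Lam Lam0 lip] := lipQb.
have [N [N0 NQ Nb _]] := local_constants bndQ bndb (bndC i0 i0) 1.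
have [G G0 HG] : exists2 G, 0 <= G & forall k x, enorm x <= 1 -> `|C x i0 k| <= G.
  apply: finite_bound => [k|k M M' MM' H x x1]; last exact: le_trans (H x x1) MM'.
  exact: bndC.
have lipQ x y (x1 : enorm x <= 1) (y1 : enorm y <= 1) := (lip x y x1 y1).1.
have lipb x y (x1 : enorm x <= 1) (y1 : enorm y <= 1) := (lip x y x1 y1).2.
have [K K0 HK] := interior_lipschitz symQ kappa_gt0 ellQ Lam0 lipQ lipb N0 NQ Nb (m%:R * G).
pose rho := Num.min 1 (xi i0 ord0 / (4 * K)).
have rho0 : 0 < rho by rewrite lt_min ltr01 divr_gt0 // mulr_gt0.
have eta0 : 0 < xi i0 ord0 / 4 by rewrite divr_gt0.
have [tau tau0 Htau] := positivity_everywhere symQ kappa_gt0 ellQ bndQ bndb bndC contC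
  coop irred i0 rho0 eta0.
exists (1 + tau); first by rewrite addr_gt0.
move=> r; have [delta delta0 Hd] := Htau r; exists delta => // u f su f01 u1 i x xr.
have u_ge0 : forall t x i, 0 <= t -> 0 <= u t x i ord0.
  by apply: (sol_ge0 su) => y j; have /andP[] := f01 y j.
have u_le t y j : 0 <= t -> u t y j ord0 <= xi j ord0.
  have := @sol_le u f 1 su _ t y j; rewrite mul1r; apply => z k.
  by rewrite mul1r; have /andP[] := f01 z k.
have u_abs t y j : 0 <= t -> `|u t y j ord0| <= 1.
  by move=> t0; rewrite ger0_norm ?u_ge0 // (le_trans (u_le t y j t0)).
apply: (Hd (fun t => u (1 + t))) => //.
  split; first by exists (u 1); exact: system_sol_shift su.
  by move=> t y j t0; apply: u_ge0; rewrite addr_ge0.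
move=> y yr; rewrite addr0.
have [Cu [_ [_ Du]]] := su.
have y1 : enorm y <= 1 by rewrite (le_trans yr) // /rho ge_min lexx.
have H : u 1 0 i0 ord0 - u 1 y i0 ord0 <= K * enorm y.
  apply: (HK (fun t x => u t x i0 ord0) (fun t x => \sum_k C x i0 k * u t x k ord0)
    (Cu i0)) => //.
  - by move=> t z /andP[t0 _]; exact: u_abs.
  - by move=> t z /andP[t0 _] _; rewrite Du // mxE.
  - move=> t z /andP[t0 _] z1; rewrite (le_trans (ler_norm_sum _ _ _)) //.
    apply: (@le_trans _ _ (\sum_(k < m) G)).
      apply: ler_sum => k _; rewrite normrM -[leRHS]mulr1 ler_pM // ?HG //.
      by rewrite u_abs // ltW.
    by rewrite sumr_const card_ord mulr_natl.
have : K * enorm y <= xi i0 ord0 / 4.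
  have -> : xi i0 ord0 / 4 = K * (xi i0 ord0 / (4 * K)) by field; rewrite gt_eqF.
  by rewrite ler_pM2l // (le_trans yr) // /rho ge_min lexx orbT.
lra.
Qed.

(** [half_positive] applies to [u] or to the complementary solution [xi - u]. *)
Lemma doeblin_dichotomy : exists2 tau, 0 < tau & forall r, exists2 delta, 0 < delta &
  forall u f, system_sol Q b C u f -> (forall x i, 0 <= f x i ord0 <= xi i ord0) ->
    (forall i x, enorm x <= r -> delta <= u tau x i ord0) \/
    (forall i x, enorm x <= r -> u tau x i ord0 <= xi i ord0 - delta).
Proof.
have [tau tau0 Ht] := half_positive; exists tau => // r.
have [delta delta0 Hd] := Ht r; exists delta => // u f su f01.
have [h|h] := leP (xi i0 ord0 / 2) (u 1 0 i0 ord0); first by left; exact: (Hd u f).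
right=> i x xr.
have s1 := system_sol_lin 1 (-1) (system_sol_cst Q b Cxi) su.
have := Hd _ _ s1 _ _ i x xr; rewrite !mxE !mul1r !mulN1r => H.
suff : delta <= xi i ord0 - u tau x i ord0 by lra.
apply: H; last by lra.
by move=> y j; rewrite !mxE mul1r mulN1r; have /andP[? ?] := f01 y j; apply/andP; split; lra.
Qed.

Variable T : R -> (pt -> 'cV[R]_m) -> pt -> 'cV[R]_m.
Hypothesis HT : forall f, Cbm f -> system_sol Q b C (fun t => T t f) f.

Lemma T_lin f g (k l t : R) : Cbm f -> Cbm g -> Cbm (fun x => k *: f x + l *: g x) ->
  0 <= t -> T t (fun x => k *: f x + l *: g x) = fun x => k *: T t f x + l *: T t g x.
Proof.
move=> Cf Cg Cfg t0; apply/funext => x.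
exact: (sol_unique (HT Cfg) (system_sol_lin k l (HT Cf) (HT Cg))).
Qed.

Lemma T_Cbm f t : Cbm f -> 0 < t -> Cbm (T t f).
Proof. by move=> Cf t0; exact: system_sol_Cbm t0 (HT Cf). Qed.

Lemma T_semigroup f s t : Cbm f -> 0 <= s -> 0 <= t -> T (s + t) f = T t (T s f).
Proof.
move=> Cf s0 t0; have [s00|sp] := eqVneq s 0.
  rewrite s00 add0r; congr (T t _); apply/funext => x.
  by have [_ [_ [-> _]]] := HT Cf.
have {}sp : 0 < s by rewrite lt_def sp.
apply/funext => x.
exact: (sol_unique (system_sol_shift sp (HT Cf)) (HT (T_Cbm Cf sp))).
Qed.

Lemma T_bound f (M t : R) x i : Cbm f -> (forall x i, `|f x i ord0| <= M * xi i ord0) ->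
  0 <= t -> `|T t f x i ord0| <= M * xi i ord0.
Proof.
move=> Cf fM t0; rewrite ler_norml -mulNr; apply/andP; split.
  apply: (sol_ge (HT Cf)) => // y j.
  by have := fM y j; rewrite ler_norml mulNr => /andP[].
apply: (sol_le (HT Cf)) => // y j.
by have := fM y j; rewrite ler_norml => /andP[].
Qed.

(** Truncation to [[-1, 1]], written with absolute values so that continuity is immediate. *)
Definition clamp (s : R) : R := (`|s + 1| - `|s - 1|) / 2.

Lemma clamp_norm s : `|clamp s| <= 1.
Proof.
rewrite /clamp ler_norml.
have [h1|h1] := lerP 0 (s + 1); have [h2|h2] := lerP 0 (s - 1);
  rewrite ?(ger0_norm h1) ?(ltr0_norm h1) ?(ger0_norm h2) ?(ltr0_norm h2);
  by apply/andP; split; lra.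
Qed.

Lemma clamp_dist s B : 0 <= B -> `|s| <= 1 + B -> `|s - clamp s| <= B.
Proof.
rewrite /clamp !ler_norml => B0 /andP[s1 s2].
have [h1|h1] := lerP 0 (s + 1); have [h2|h2] := lerP 0 (s - 1);
  rewrite ?(ger0_norm h1) ?(ltr0_norm h1) ?(ger0_norm h2) ?(ltr0_norm h2);
  by apply/andP; split; lra.
Qed.

Lemma clamp_continuous : continuous clamp.
Proof.
move=> s; apply: cvgM; last exact: cvg_cst.
by apply: cvgB; apply: cvg_norm; [apply: cvgD|apply: cvgB]; (exact: cvg_id || exact: cvg_cst).
Qed.

(** Lipschitz bound for the Hairer-Mattingly distance [2 + beta phi(x) + beta phi(y)] between pairs
    of a point and a component. *)
Definition osc_le (beta A : R) (f : pt -> 'cV[R]_m) : Prop := forall x y i j,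
  f x i ord0 / xi i ord0 - f y j ord0 / xi j ord0 <=
  A * (2 + beta * phi x + beta * phi y).

(** Every value of [f / xi - A (1 + beta phi)] lies below every value of
    [f / xi + A (1 + beta phi)], so the supremum of the former separates them: the seminorm is a
    weighted sup norm modulo constants. *)
Lemma osc_center beta A f : osc_le beta A f ->
  exists k, forall x i, `|f x i ord0 / xi i ord0 - k| <= A * (1 + beta * phi x).
Proof.
move=> Hf; pose E := [set s | exists x i, s = f x i ord0 / xi i ord0 - A * (1 + beta * phi x)].
have Eub y j : ubound E (f y j ord0 / xi j ord0 + A * (1 + beta * phi y)).
  by move=> s [x [i ->]]; have := Hf x y i j; lra.
have E0 : E !=set0 by exists (f 0 i0 ord0 / xi i0 ord0 - A * (1 + beta * phi 0)), 0, i0.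
have hE : has_sup E by split => //; exists (f 0 i0 ord0 / xi i0 ord0 + A * (1 + beta * phi 0)).
exists (sup E) => x i; rewrite ler_norml; apply/andP; split.
  have : sup E <= f x i ord0 / xi i ord0 + A * (1 + beta * phi x) by exact: ge_sup.
  lra.
have : f x i ord0 / xi i ord0 - A * (1 + beta * phi x) <= sup E.
  by apply: sup_upper_bound => //; exists x, i.
lra.
Qed.

Lemma harris_contraction : exists tau beta alpha, [/\ 0 < tau, 0 < beta, 0 < alpha < 1 &
  forall f A, Cbm f -> 0 < A -> osc_le beta A f -> osc_le beta (alpha * A) (T tau f)].
Proof.
have [tau tau0 Ht] := doeblin_dichotomy.
pose L := a / c; have L0 : 0 < L by rewrite divr_gt0.
pose gam := expR (- c * tau).
have gam0 : 0 < gam by exact: expR_gt0.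
have gam1 : gam < 1 by rewrite /gam -expR0 ltr_expR mulNr oppr_lt0 mulr_gt0.
have [r Hr] := phi_inf (4 * L).
have [delta delta0 Hd] := Ht r.
(* A pair with [phi x + phi y < 4 L] lies in the ball of radius [r]. There the drift part costs at
   most [6 beta L = delta], half of the gain [2 delta] from the dichotomy. *)
pose beta := delta / (6 * L).
have beta0 : 0 < beta by rewrite divr_gt0 // mulr_gt0.
have betaL : 6 * (beta * L) = delta by rewrite /beta; field; rewrite gt_eqF.
have bL0 : 0 < beta * L by exact: mulr_gt0.
(* The largest rate admissible at the threshold [beta (phi x + phi y) = 4 beta L]. As
   [al1 < 1 - gam], the inequality persists beyond the threshold. *)
pose al1 := (1 - gam) * (beta * L) / (2 * (beta * L) + 1).
have den : 0 < 2 * (beta * L) + 1 by lra.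
have al10 : 0 < al1 by rewrite !divr_gt0 // mulr_gt0 // subr_gt0.
have al1E : al1 * (2 * (beta * L) + 1) = (1 - gam) * (beta * L).
  by rewrite /al1 mulfVK // gt_eqF.
have al11 : al1 < 1.
  rewrite ltr_pdivrMr // mul1r.
  have : (1 - gam) * (beta * L) <= 1 * (beta * L) by rewrite ler_wpM2r // ?ltW //; lra.
  lra.
pose alpha := Num.max (1 - al1) (1 - delta / 2).
have alpha0 : 0 < alpha by rewrite lt_max subr_gt0 al11.
have alpha1 : alpha < 1 by rewrite gt_max; apply/andP; split; lra.
exists tau, beta, alpha; split => //; first by rewrite alpha0.
move=> f A Cf A0 osc; have [k Hk] := osc_center osc.
(* Centred and scaled, [|g| <= 1 + beta phi]. The clamped part [f1] is bounded by [xi] and left to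
   the dichotomy; the excess [f2] is bounded by [beta xi phi] and left to the drift. *)
pose g x i := (f x i ord0 / xi i ord0 - k) / A.
have gb x i : `|g x i| <= 1 + beta * phi x.
  by rewrite /g normrM normfV (gtr0_norm A0) ler_pdivrMr // [leRHS]mulrC.
have bphi x : 0 <= beta * phi x by rewrite mulr_ge0 // ltW.
pose f1 x : 'cV[R]_m := \col_i (xi i ord0 * clamp (g x i)).
pose f2 x : 'cV[R]_m := \col_i (xi i ord0 * (g x i - clamp (g x i))).
have f1b x i : `|f1 x i ord0| <= 1 * xi i ord0.
  by rewrite mxE normrM (gtr0_norm (xi_gt0 i)) mulrC ler_pM2r // clamp_norm.
have f2b x i : `|f2 x i ord0| <= beta * xi i ord0 * phi x.
  rewrite mxE normrM (gtr0_norm (xi_gt0 i)) (mulrC beta) -mulrA ler_pM2l //.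
  exact: clamp_dist.
have cg i x : g y i @[y --> x] --> g x i.
  have c1 : f y i ord0 @[y --> x] --> f x i ord0 by exact: (Cf i).1.
  have c2 : f y i ord0 / xi i ord0 @[y --> x] --> f x i ord0 / xi i ord0.
    exact: cvgM c1 (cvg_cst _).
  exact: cvgM (cvgB c2 (cvg_cst k)) (cvg_cst _).
have ccl i x : clamp (g y i) @[y --> x] --> clamp (g x i).
  by apply: (cvg_comp (g^~ i) clamp (cg i x)); exact: clamp_continuous.
have Cf1 : Cbm f1.
  move=> i; split; last by exists (1 * xi i ord0) => x; exact: f1b.
  have -> : (fun x => f1 x i ord0) = (fun x => xi i ord0 * clamp (g x i)).
    by apply/funext => x; rewrite mxE.
  by move=> x; exact: cvgM (cvg_cst _) (ccl i x).
have Cf2 : Cbm f2.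
  move=> i.
  have E : (fun x => f2 x i ord0) = (fun x => xi i ord0 * (g x i - clamp (g x i))).
    by apply/funext => x; rewrite mxE.
  rewrite E; split.
    by move=> x; exact: cvgM (cvg_cst _) (cvgB (cg i x) (ccl i x)).
  have [M HM] := (Cf i).2.
  exists (xi i ord0 * ((M / xi i ord0 + `|k|) / A + 1)) => x.
  rewrite normrM (gtr0_norm (xi_gt0 i)) ler_pM2l // (le_trans (ler_normB _ _)) //.
  rewrite lerD ?clamp_norm // /g normrM normfV (gtr0_norm A0) ler_pM2r ?invr_gt0 //.
  rewrite (le_trans (ler_normB _ _)) // lerD2r normrM normfV (gtr0_norm (xi_gt0 i)).
  by rewrite ler_pM2r ?invr_gt0.
have Ck x : C x *m (k *: xi) = 0 by rewrite -scalemxAr Cxi scaler0.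
have fE : f = fun x => 1 *: (k *: xi) + A *: (1 *: f1 x + 1 *: f2 x).
  apply/funext => x; apply/matrixP => i j; rewrite (ord1 j) !mxE /g.
  by field; rewrite !gt_eqF.
have su : system_sol Q b C (fun t x => 1 *: (k *: xi) +
    A *: (1 *: T t f1 x + 1 *: T t f2 x)) f.
  rewrite [X in system_sol _ _ _ _ X]fE; apply: system_sol_lin; first exact: system_sol_cst.
  by apply: system_sol_lin; exact: HT.
have TE x i : T tau f x i ord0 / xi i ord0 =
    k + A * (T tau f1 x i ord0 / xi i ord0 + T tau f2 x i ord0 / xi i ord0).
  rewrite (sol_unique (HT Cf) su x (ltW tau0)) !mxE.
  by field; rewrite gt_eqF.
have T1 x i : `|T tau f1 x i ord0 / xi i ord0| <= 1.
  rewrite normrM normfV (gtr0_norm (xi_gt0 i)) ler_pdivrMr //.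
  by apply: T_bound => //; exact: ltW.
have T2 x i : `|T tau f2 x i ord0 / xi i ord0| <= beta * (gam * phi x + L * (1 - gam)).
  rewrite normrM normfV (gtr0_norm (xi_gt0 i)) ler_pdivrMr //.
  have := sol_lyap (HT Cf2) (ltW beta0) f2b x i (ltW tau0); rewrite -/gam -/L.
  by rewrite [leRHS](_ : _ = beta * (gam * phi x + L * (1 - gam)) * xi i ord0) //; ring.
move=> x y i j; rewrite !TE.
set v1x := T tau f1 x i ord0 / _; set v1y := T tau f1 y j ord0 / _.
set v2x := T tau f2 x i ord0 / _; set v2y := T tau f2 y j ord0 / _.
have -> : k + A * (v1x + v2x) - (k + A * (v1y + v2y)) = A * ((v1x - v1y) + (v2x - v2y)) by ring.
rewrite (mulrC alpha) -mulrA ler_pM2l //.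
have d2 : v2x - v2y <= beta * (gam * (phi x + phi y) + 2 * L * (1 - gam)).
  have := T2 x i; have := T2 y j; rewrite -/v2x -/v2y !ler_norml => /andP[? ?] /andP[? ?].
  lra.
have px := phi_gt0 x; have py := phi_gt0 y.
have S0 : 0 < 2 + beta * phi x + beta * phi y by have := bphi x; have := bphi y; lra.
have [SL|SL] := leP (4 * L) (phi x + phi y).
  apply: (@le_trans _ _ ((1 - al1) * (2 + beta * phi x + beta * phi y))); last first.
    by rewrite ler_pM2r // /alpha le_max lexx.
  have d1 : v1x - v1y <= 2.
    have := T1 x i; have := T1 y j; rewrite -/v1x -/v1y !ler_norml => /andP[? ?] /andP[? ?].
    lra.
  set s := beta * (phi x + phi y).
  have sE : s = beta * phi x + beta * phi y by rewrite /s; ring.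
  have s4 : 4 * (beta * L) <= s by rewrite /s mulrCA ler_pM2l.
  have key : al1 * (2 + s) <= (1 - gam) * (s - 2 * (beta * L)).
    have k2 : (2 * (beta * L) + 1) * (al1 * (2 + s)) = (1 - gam) * (beta * L * (2 + s)).
      by transitivity (al1 * (2 * (beta * L) + 1) * (2 + s)); [ring|rewrite al1E; ring].
    rewrite -(ler_pM2l den) k2 [leRHS]mulrCA ler_pM2l ?subr_gt0 //.
    have : 0 <= (beta * L + 1) * (s - 4 * (beta * L)).
      by rewrite mulr_ge0 ?subr_ge0 // addr_ge0 // ltW.
    lra.
  move: d1 d2 key.
  have -> : 2 + beta * phi x + beta * phi y = 2 + s by rewrite sE; ring.
  have -> : beta * (gam * (phi x + phi y) + 2 * L * (1 - gam)) =
    gam * s + 2 * (beta * L) * (1 - gam) by rewrite /s; ring.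
  lra.
have rx : enorm x <= r.
  by rewrite leNgt; apply/negP => /ltW/Hr; lra.
have ry : enorm y <= r.
  by rewrite leNgt; apply/negP => /ltW/Hr; lra.
have d22 : v2x - v2y <= delta.
  apply: le_trans d2 _; rewrite -betaL.
  have -> : 6 * (beta * L) = beta * (6 * L) by ring.
  rewrite ler_pM2l //.
  have : gam * (phi x + phi y) <= 1 * (phi x + phi y) by rewrite ler_wpM2r ?(ltW gam1) //; lra.
  have : 0 <= L * gam by rewrite mulr_ge0 // ltW.
  lra.
have d11 : v1x - v1y <= 2 - 2 * delta.
  (* The midpoint of [xi] and [f1] is admissible for the dichotomy, which then bounds [v1y] from
     below or [v1x] from above; either one suffices for the difference. *)
  have f3 z h : 0 <= (2^-1 *: xi + 2^-1 *: f1 z) h ord0 <= xi h ord0.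
    have := f1b z h; rewrite mul1r ler_norml !mxE => /andP[h1 h2].
    by apply/andP; split; lra.
  have := T1 x i; have := T1 y j; rewrite -/v1x -/v1y !ler_norml => /andP[y1 y2] /andP[x1 x2].
  have conv z h : T tau f1 z h ord0 = xi h ord0 * (T tau f1 z h ord0 / xi h ord0).
    by rewrite mulrC mulfVK // gt_eqF.
  have scale (s : R) h : 0 < s -> s <= s / xi h ord0.
    by move=> s0; rewrite ler_pdivlMr // ler_piMr // ltW.
  have := Hd _ _ (system_sol_lin 2^-1 2^-1 (system_sol_cst Q b Cxi) (HT Cf1)) f3.
  case=> Hc.
    have := Hc j y ry; rewrite !mxE conv -/v1y => h.
    have : delta / xi j ord0 <= (2^-1 * xi j ord0 + 2^-1 * (xi j ord0 * v1y)) / xi j ord0.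
      by rewrite ler_pM2r ?invr_gt0.
    have -> : (2^-1 * xi j ord0 + 2^-1 * (xi j ord0 * v1y)) / xi j ord0 = 2^-1 * (1 + v1y).
      by field; rewrite gt_eqF.
    have := scale delta j delta0; lra.
  have := Hc i x rx; rewrite !mxE conv -/v1x => h.
  have : (2^-1 * xi i ord0 + 2^-1 * (xi i ord0 * v1x)) / xi i ord0 <=
      (xi i ord0 - delta) / xi i ord0 by rewrite ler_pM2r ?invr_gt0.
  have -> : (2^-1 * xi i ord0 + 2^-1 * (xi i ord0 * v1x)) / xi i ord0 = 2^-1 * (1 + v1x).
    by field; rewrite gt_eqF.
  have -> : (xi i ord0 - delta) / xi i ord0 = 1 - delta / xi i ord0.
    by field; rewrite gt_eqF.
  have := scale delta i delta0; lra.
apply: (@le_trans _ _ ((1 - delta / 2) * 2)); first by lra.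
apply: (@le_trans _ _ (alpha * 2)).
  by rewrite ler_pM2r // /alpha le_max lexx orbT.
by rewrite ler_pM2l // -addrA lerDl addr_ge0.
Qed.

Lemma continuous_locally_bounded (f : pt -> R) : continuous f -> locally_bounded f.
Proof.
move=> cf r.
have K0 : [set x : pt | enorm x <= `|r|] !=set0 by exists 0; rewrite /= enorm0.
have [q _|q _ Hq] := EVT_within (F := fun x => - `|f x|) K0 (@compact_eball0 R d `|r|).
  by apply: cvg_within_filter; apply: cvgN; apply: cvg_norm; exact: cf.
exists `|f q| => x xr; have := Hq x; rewrite lerN2; apply.
by rewrite /= (le_trans xr) // ler_norm.
Qed.

Lemma uniform_osc_decay (r eps : R) : 0 < eps -> exists2 t0, 0 < t0 & forall f,
  Cbm f -> (forall x i, `|f x i ord0| <= xi i ord0) -> forall t x y i j,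
  t0 <= t -> enorm x <= r -> enorm y <= r ->
  `|T t f x i ord0 / xi i ord0 - T t f y j ord0 / xi j ord0| <= eps.
Proof.
move=> eps0.
have [tau [beta [alpha [tau0 beta0 /andP[al0 al1] Hc]]]] := harris_contraction.
have [P HP] := continuous_locally_bounded C2phi.1 r.
pose Z := 2 + 2 * (beta * `|P|).
have bP0 : 0 <= beta * `|P| by rewrite mulr_ge0 // ltW.
have Z0 : 0 < Z by rewrite /Z; lra.
have [n Hn] : exists n : nat, alpha ^+ n * Z <= eps.
  have ab : `|alpha| < 1 by rewrite gtr0_norm.
  have eZ : 0 < eps / Z by rewrite divr_gt0.
  have /cvgrPdist_le/(_ _ eZ)[n _ Hn] := cvg_expr ab.
  exists n; have := Hn n (leqnn n); rewrite /= sub0r normrN ger0_norm; last first.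
    by rewrite exprn_ge0 // ltW.
  by rewrite ler_pdivlMr.
(* Peeling one period [tau] off the end of [[0, t]] covers all real times, not only the multiples of
   [tau]. *)
have decay f : Cbm f -> (forall x i, `|f x i ord0| <= xi i ord0) ->
    forall k t, k%:R * tau <= t -> osc_le beta (alpha ^+ k) (T t f).
  move=> Cf fb; elim=> [t|k IH t kt].
    rewrite mul0r expr0 => t0 x y i j; rewrite mul1r.
    have bd z h : `|T t f z h ord0 / xi h ord0| <= 1.
      rewrite normrM normfV (gtr0_norm (xi_gt0 h)) ler_pdivrMr //.
      by apply: T_bound => // w l; rewrite mul1r.
    have := bd x i; have := bd y j; rewrite !ler_norml => /andP[? ?] /andP[? ?].
    have : 0 <= beta * phi x by rewrite mulr_ge0 // ltW.
    have : 0 <= beta * phi y by rewrite mulr_ge0 // ltW.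
    lra.
  have kt' : k%:R * tau <= t - tau.
    by move: kt; rewrite -(natr1 k) mulrDl mul1r; lra.
  have t0 : 0 <= t - tau by rewrite (le_trans _ kt') // mulr_ge0 // ltW.
  have -> : T t f = T tau (T (t - tau) f).
    by rewrite -T_semigroup ?subrK // ltW.
  rewrite exprS; apply: Hc; [|by rewrite exprn_gt0|exact: IH].
  have [tt|tt] := eqVneq (t - tau) 0; last by apply: T_Cbm => //; rewrite lt_def tt.
  by rewrite tt; have [_ [_ [E _]]] := HT Cf; rewrite (_ : T 0 f = f) //; apply/funext.
exists (n%:R * tau + 1); first by rewrite ltr_wpDl // mulr_ge0 // ltW.
move=> f Cf fb t x y i j tt xr yr.
have ht : n%:R * tau <= t by lra.
have bp z : enorm z <= r -> beta * phi z <= beta * `|P|.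
  by move=> zr; rewrite ler_pM2l // (le_trans (ler_norm _)) // (le_trans (HP z zr)) // ler_norm.
have half z w h l : enorm z <= r -> enorm w <= r ->
   T t f z h ord0 / xi h ord0 - T t f w l ord0 / xi l ord0 <= eps.
  move=> zr wr; apply: le_trans (decay f Cf fb n t ht z w h l) _.
  apply: le_trans Hn; rewrite ler_wpM2l ?exprn_ge0 ?(ltW al0) // /Z.
  have := bp z zr; have := bp w wr; lra.
rewrite ler_norml half // andbT.
have := half y x j i yr xr; lra.
Qed.

End Harris.

(** * Approximation of Borel functions by continuous ones *)

Section ContinuousApproximation.
Variables (R : realType) (d : nat).
Local Notation pt := (pt R d).
Local Notation X := (Rd R d).

Lemma continuous_measurable (g : pt -> R) : continuous g ->
  measurable_fun [set: X] (g : X -> R).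
Proof.
move=> /continuousP cg; apply: (measurability _ (RGenOpens.measurableE R)).
move=> _ [_ [a [b ->] <-]]; rewrite setTI; apply: sub_sigma_algebra.
exact/cg/interval_open.
Qed.

Definition bmeas (h : X -> R) : Prop :=
  measurable_fun [set: X] h /\ exists M : R, forall x, `|h x| <= M.

Lemma bmeas_cst k : bmeas (fun=> k).
Proof. by split; [exact: measurable_cst|exists `|k|]. Qed.

Lemma bmeas_lin h h' k l : bmeas h -> bmeas h' -> bmeas (fun x => k * h x + l * h' x).
Proof.
move=> [mh [M HM]] [mh' [M' HM']]; split.
  by apply: measurable_funD; apply: measurable_funM => //; exact: measurable_cst.
exists (`|k| * M + `|l| * M') => x; rewrite (le_trans (ler_normD _ _)) // !normrM.
by rewrite lerD // ler_wpM2l.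
Qed.

Lemma bmeasB h h' : bmeas h -> bmeas h' -> bmeas (fun x => h x - h' x).
Proof.
move=> H H'; have := bmeas_lin 1 (-1) H H'; congr bmeas; apply/funext => x.
by rewrite mul1r mulN1r.
Qed.

Lemma bmeas_norm h : bmeas h -> bmeas (fun x => `|h x|).
Proof.
move=> [mh [M HM]]; split; first exact: measurableT_comp.
by exists M => x; rewrite normr_id.
Qed.

Lemma bmeas_continuous (g : pt -> R) : continuous g -> (exists M, forall x, `|g x| <= M) ->
  bmeas g.
Proof. by move=> cg bg; split => //; exact: continuous_measurable. Qed.

Lemma bmeas_indic (A : set X) : measurable A -> bmeas (\1_A : X -> R).
Proof.
move=> mA; split; first exact: measurable_indic.
by exists 1 => x; rewrite indicE; case: (_ \in _); rewrite ?normr1 ?normr0.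
Qed.

Section FiniteMeasure.
Variable nu : {measure set X -> \bar R}.
Hypothesis finnu : (nu [set: X] < +oo)%E.

Lemma bmeas_integrable h : bmeas h -> nu.-integrable [set: X] (EFin \o h).
Proof.
move=> [mh [M HM]]; apply: measurable_bounded_integrable => //.
exists M; split; first exact: num_real.
by move=> N MN x _ /=; rewrite (le_trans (HM x)) // ltW.
Qed.

Lemma Rint_le h h' : bmeas h -> bmeas h' -> (forall x, h x <= h' x) ->
  Rintegral nu [set: X] h <= Rintegral nu [set: X] h'.
Proof.
by move=> H H' hh; apply: le_Rintegral => //; exact: bmeas_integrable.
Qed.

Lemma Rint_lin h h' k l : bmeas h -> bmeas h' ->
  Rintegral nu [set: X] (fun x => k * h x + l * h' x) =
  k * Rintegral nu [set: X] h + l * Rintegral nu [set: X] h'.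
Proof.
move=> H H'.
have Z (u : X -> R) s : bmeas u -> bmeas (fun x => s * u x).
  move=> Hu; have := bmeas_lin s 0 Hu Hu; congr bmeas; apply/funext => x.
  by rewrite mul0r addr0.
rewrite RintegralD //; try by apply: bmeas_integrable; exact: Z.
by rewrite !RintegralZl //; exact: bmeas_integrable.
Qed.

Definition L1dist (h g : X -> R) : R := Rintegral nu [set: X] (fun x => `|h x - g x|).

Lemma L1dist_le2 h g h1 g1 h2 g2 k l :
  bmeas h -> bmeas g -> bmeas h1 -> bmeas g1 -> bmeas h2 -> bmeas g2 ->
  (forall x, `|h x - g x| <= k * `|h1 x - g1 x| + l * `|h2 x - g2 x|) ->
  L1dist h g <= k * L1dist h1 g1 + l * L1dist h2 g2.
Proof.
move=> H1 H2 H3 H4 H5 H6 le; rewrite /L1dist -Rint_lin; try by apply: bmeas_norm; exact: bmeasB.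
apply: Rint_le => //; first by apply: bmeas_norm; exact: bmeasB.
by apply: bmeas_lin; apply: bmeas_norm; exact: bmeasB.
Qed.

Lemma measure_tail (F : nat -> set X) (e : R) : (forall n, measurable (F n)) ->
  nondecreasing_seq F -> 0 < e ->
  exists n, fine (nu (\bigcup_k F k `\` F n)) <= e.
Proof.
move=> mF ndF e0.
have mU : measurable (\bigcup_k F k) by exact: bigcupT_measurable.
pose G n := \bigcup_k F k `\` F n.
have mG n : measurable (G n) by exact: measurableD.
have finG n : (nu (G n) < +oo)%E.
  by apply: le_lt_trans finnu; apply: le_measure; rewrite ?inE.
have G0 : \bigcap_n G n = set0.
  apply/seteqP; split=> // x Gx; have [[k _ Fk] _] := Gx 0%N I.
  by have [_] := Gx k I; apply.
have cv : nu \o G @ \oo --> nu (\bigcap_n G n).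
  apply: nonincreasing_cvg_mu => //; first by rewrite G0.
  move=> n k nk; apply/subsetPset => x [Ux nFx]; split=> // Fx; apply: nFx.
  by have /subsetPset := ndF _ _ nk; exact.
rewrite G0 measure0 in cv.
have /fine_cvgP[_ /cvgrPdist_le/(_ _ e0)[n _ Hn]] := cv.
by exists n; have := Hn n (leqnn n); rewrite /= sub0r normrN ger0_norm.
Qed.

(** The sup bound on [g] is part of the notion because the rate of convergence is uniform only over
    data with a common bound. *)
Definition approximable (h : X -> R) : Prop := forall e, 0 < e ->
  exists g : pt -> R, [/\ continuous g, (forall x, 0 <= g x <= 1) & L1dist h g <= e].

Lemma bmeas01 (g : pt -> R) : continuous g -> (forall x, 0 <= g x <= 1) -> bmeas g.
Proof.
move=> cg g01; apply: bmeas_continuous => //; exists 1 => x.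
by have /andP[g0 g1] := g01 x; rewrite ger0_norm.
Qed.

Lemma Rint_indic (A : set X) : measurable A ->
  Rintegral nu [set: X] \1_A = fine (nu A).
Proof. by move=> mA; rewrite /Rintegral integral_indic // setIT. Qed.

Lemma approximable_bigcup (A : nat -> set X) : (forall n, measurable (A n)) ->
  nondecreasing_seq A -> (forall n, approximable \1_(A n)) ->
  approximable \1_(\bigcup_n A n).
Proof.
move=> mA ndA aA e e0.
have mU : measurable (\bigcup_k A k) by exact: bigcupT_measurable.
have e20 : 0 < e / 2 by rewrite divr_gt0.
have [n Hn] := measure_tail mA ndA e20.
have [g [cg g01 Hg]] := aA n _ e20.
exists g; split => //; have mD := measurableD mU (mA n).
have := @L1dist_le2 \1_(\bigcup_k A k) g \1_(A n) g \1_(\bigcup_k A k `\` A n) (fun=> 0) 1 1.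
rewrite !mul1r => H; apply: le_trans (H _ _ _ _ _ _ _) _.
- exact: bmeas_indic.
- exact: bmeas01.
- exact: bmeas_indic.
- exact: bmeas01.
- exact: bmeas_indic.
- exact: bmeas_cst.
- move=> x; rewrite !mul1r subr0 !indicE.
  case: (boolP (x \in A n)) => xA.
    have -> : x \in \bigcup_k A k by rewrite inE; exists n => //; exact/set_mem.
    by rewrite lerDl.
  case: (boolP (x \in \bigcup_k A k)) => xU.
    have -> : x \in \bigcup_k A k `\` A n.
      rewrite inE; split; first exact/set_mem.
      by move=> /mem_set h; move/negP: xA.
    rewrite sub0r normrN normr1 (le_trans (ler_normB _ _)) // normr1.
    by rewrite addrC.
  by rewrite lerDl.
have -> : L1dist \1_(\bigcup_k A k `\` A n) (fun=> 0) = fine (nu (\bigcup_k A k `\` A n)).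
  rewrite -Rint_indic //; apply: eq_Rintegral => x _; rewrite subr0 !indicE.
  by case: (_ \in _); rewrite ?normr1 ?normr0.
have -> : e = e / 2 + e / 2 by field.
exact: lerD.
Qed.

Lemma approximable_compl (A : set X) : measurable A -> approximable \1_A ->
  approximable \1_(~` A).
Proof.
move=> mA aA e e0; have [g [cg g01 Hg]] := aA e e0.
exists (fun x => 1 - g x); split.
- by move=> x; apply: (@cvgB _ _ _ (nbhs x)); [exact: cvg_cst|exact: cg].
- by move=> x; have /andP[? ?] := g01 x; apply/andP; split; lra.
apply: le_trans Hg; rewrite le_eqVlt; apply/orP; left; apply/eqP.
apply: eq_Rintegral => x _ /=; rewrite !indicE in_setC.
by case: (_ \in _) => /=; rewrite -normrN; congr `|_|; ring.
Qed.

Lemma norm_maxB (x y z t : R) : `|Num.max x y - Num.max z t| <= `|x - z| + `|y - t|.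
Proof.
have n1 := ler_norm (x - z); have n2 := ler_norm (z - x); rewrite distrC in n2.
have n3 := ler_norm (y - t); have n4 := ler_norm (t - y); rewrite distrC in n4.
have p1 := normr_ge0 (x - z); have p2 := normr_ge0 (y - t).
rewrite ler_norml; apply/andP; split.
  by rewrite lerBrDr; case: (leP x y) => xy; case: (leP z t) => zt; lra.
by case: (leP x y) => xy; case: (leP z t) => zt; lra.
Qed.

Lemma approximable_setU (A B : set X) : measurable A -> measurable B ->
  approximable \1_A -> approximable \1_B -> approximable \1_(A `|` B).
Proof.
move=> mA mB aA aB e e0; have e20 : 0 < e / 2 by rewrite divr_gt0.
have [g [cg g01 Hg]] := aA _ e20; have [k [ck k01 Hk]] := aB _ e20.
have cm : continuous (fun x : pt => Num.max (g x) (k x)).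
  by move=> x; apply: (@continuous_max R pt g k x); [exact: cg|exact: ck].
have m01 x : 0 <= Num.max (g x) (k x) <= 1.
  have /andP[g0 g1] := g01 x; have /andP[k0 k1] := k01 x.
  by rewrite le_max g0 ge_max g1 k1.
exists (fun x => Num.max (g x) (k x)); split => //.
have := @L1dist_le2 \1_(A `|` B) (fun x => Num.max (g x) (k x)) \1_A g \1_B k 1 1.
rewrite !mul1r => H; apply: le_trans (H _ _ _ _ _ _ _) _.
- by apply: bmeas_indic; exact: measurableU.
- exact: bmeas01.
- exact: bmeas_indic.
- exact: bmeas01.
- exact: bmeas_indic.
- exact: bmeas01.
- move=> x; rewrite !mul1r.
  have -> : \1_(A `|` B) x = Num.max (\1_A x) (\1_B x) :> R.
    rewrite !indicE in_setU; case: (x \in A); case: (x \in B) => /=;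
    by rewrite /Num.max ?ltxx ?ltr01 ?ltr10.
  exact: norm_maxB.
have -> : e = e / 2 + e / 2 by field.
exact: lerD.
Qed.

(** Distance in the sup norm, which defines the topology. The infimum of the empty set is 0 by
    convention, whence [F !=set0] below and the separate treatment of the whole space. *)
Definition dist_set (F : set pt) (x : pt) : R := inf [set `|x - y| | y in F].

Lemma dist_set_ge0 F x : 0 <= dist_set F x.
Proof.
have [->|/set0P F0] := eqVneq F set0; first by rewrite /dist_set image_set0 inf0.
apply: lb_le_inf; first by case: F0 => y Fy; exists `|x - y|, y.
by move=> _ [y _ <-].
Qed.

Lemma dist_set_lip F x z : F !=set0 -> dist_set F x <= `|x - z| + dist_set F z.
Proof.
move=> [y0 Fy0]; rewrite -lerBlDl; apply: lb_le_inf; first by exists `|z - y0|, y0.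
move=> _ [y Fy <-]; rewrite lerBlDl; apply: (@le_trans _ _ `|x - y|).
  by apply: ge_inf; [exists 0 => _ [w _ <-]|exists y].
by rewrite (le_trans _ (ler_normD _ _)) // addrA subrK.
Qed.

Lemma dist_set_continuous F : F !=set0 -> continuous (dist_set F).
Proof.
move=> F0 x; apply: (@cvg_dist_le _ pt (nbhs x) _ (dist_set F)) => e e0.
apply/nbhs_ballP; exists e => //= z; rewrite -ball_normE /= => xz.
rewrite ler_norml; have h1 := dist_set_lip x z F0; have h2 := dist_set_lip z x F0.
by rewrite distrC in h2; apply/andP; split; lra.
Qed.

(** [U] is the increasing union of the sets [V n] of points at distance more than [1 / (n + 1)] from
    its complement. [min 1 ((n + 1) D)] is 1 on [V n] and 0 off [U], so the error is at most the
    measure of what [V n] leaves of [U]. *)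
Lemma approximable_open (U : set pt) : open U -> approximable (\1_U : X -> R).
Proof.
move=> oU; have [F0|/set0P F0] := eqVneq (~` U) set0.
  have -> : U = setT by rewrite -(setCK U) F0 setC0.
  move=> e e0; exists (fun=> 1); split.
  - exact: cst_continuous.
  - by move=> x; rewrite ler01 lexx.
  - rewrite /L1dist.
    have -> : (fun x : X => `|\1_[set: pt] x - 1 : R|) = (fun=> 0).
      by apply/funext => x; rewrite indicT subrr normr0.
    by rewrite Rintegral_cst // mul0r ltW.
pose D := dist_set (~` U).
pose V n := [set x : pt | n.+1%:R^-1 < D x].
have cD := dist_set_continuous F0.
have DU x : U x <-> 0 < D x.
  split=> [Ux|Dx].
    have /nbhs_ballP[e /= e0 He] : nbhs x U by apply: open_nbhs_nbhs; split.
    apply: (lt_le_trans e0); apply: lb_le_inf.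
      by case: F0 => y Fy; exists `|x - y|, y.
    move=> _ [y nUy <-]; rewrite leNgt; apply/negP => xy; apply: nUy; apply: He.
    by rewrite -ball_normE.
  apply: contrapT => nUx; move: Dx; rewrite ltNge => /negP; apply.
  by apply: ge_inf; [exists 0 => _ [w _ <-]|exists x => //; rewrite subrr normr0].
have oV n : open (V n).
  have /continuousP/(_ [set s | n.+1%:R^-1 < s]) := cD; apply; exact: open_gt.
have UV : U = \bigcup_n V n.
  apply/seteqP; split=> x.
    move=> /DU Dx; have [n _ Hn] := near_infty_natSinv_lt (PosNum Dx).
    by exists n => //; exact: Hn (leqnn n).
  by move=> [n _ Vx]; apply/DU; apply: lt_trans Vx; rewrite invr_gt0.
have mV n : measurable (V n : set X) by exact: sub_sigma_algebra.
have mU : measurable (U : set X) by exact: sub_sigma_algebra.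
have ndV : nondecreasing_seq (V : nat -> set X).
  move=> n k nk; apply/subsetPset => x; rewrite /V /= => h; apply: le_lt_trans h.
  by rewrite lef_pV2 ?posrE // ler_nat.
move=> e e0; have [n Hn] := measure_tail mV ndV e0; rewrite -UV in Hn.
pose g x := Num.min 1 (n.+1%:R * D x).
have g01 x : 0 <= g x <= 1.
  by rewrite /g le_min ler01 ge_min lexx /= andbT mulr_ge0 // dist_set_ge0.
have cg : continuous g.
  move=> x; apply: (@continuous_min R pt (fun=> 1) (fun x => n.+1%:R * D x) x).
    exact: cst_continuous.
  by apply: (@cvgM _ _ (nbhs x)); [exact: cvg_cst|exact: cD].
exists g; split => //; apply: le_trans Hn.
have mUV : measurable (U `\` V n : set X) by exact: measurableD.
rewrite -Rint_indic //; apply: Rint_le.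
- by apply: bmeas_norm; apply: bmeasB; [exact: bmeas_indic|exact: bmeas01].
- exact: bmeas_indic.
move=> x; rewrite !indicE in_setD.
have /andP[g0 g1] := g01 x.
case: (boolP (x \in V n)) => xV /=.
  have xU : x \in U by rewrite UV inE; exists n => //; exact/set_mem.
  rewrite xU /= /g.
  have -> : Num.min 1 (n.+1%:R * D x) = 1.
    apply/min_idPl; rewrite mulrC -ler_pdivrMr // div1r ltW //.
    by have := set_mem xV.
  by rewrite subrr normr0.
case: (boolP (x \in U)) => xU /=; first by rewrite ger0_norm; lra.
have D0 : D x = 0.
  apply/eqP; rewrite eq_le dist_set_ge0 andbT leNgt; apply/negP => /DU Ux.
  by move/negP: xU; apply; rewrite inE.
by rewrite /g D0 mulr0 (min_idPr ler01) subrr normr0.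
Qed.

(** The measurable sets with this property form a sigma-algebra containing the open sets; countable
    unions are turned into increasing unions of finite ones. *)
Lemma approximable_measurable (A : set X) : measurable A -> approximable \1_A.
Proof.
move=> mA; suff [] : measurable A /\ approximable (\1_A : X -> R) by [].
pose D := [set B : set X | measurable B /\ approximable (\1_B : X -> R)].
suff : @measurable _ X `<=` D by exact.
apply: smallest_sub; last first.
  by move=> U oU; split; [exact: sub_sigma_algebra|exact: approximable_open].
split.
- split; first exact: measurable0.
  by have := approximable_open open0.
- move=> B [mB aB]; rewrite setTD; split; first exact: measurableC.
  exact: approximable_compl.
- move=> B DB; have mB n := (DB n).1.
  split; first exact: bigcupT_measurable.
  pose E n : set X := \big[setU/set0]_(k < n.+1) B k.
  have mE n : measurable (E n : set X) by apply: bigsetU_measurable => k _.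
  have -> : \bigcup_n B n = \bigcup_n E n by rewrite bigcup_bigsetU_bigcup.
  apply: approximable_bigcup => //.
    by move=> n k nk; apply/subsetPset; exact: subset_bigsetU.
  elim=> [|n IH]; rewrite /E; first by rewrite big_ord1; exact: (DB 0%N).2.
  rewrite big_ord_recr; apply: approximable_setU => //; [exact: mE|exact: (DB n.+1).2].
Qed.

(* Binary digits: f = h/2 + f'/2 with h = 1_(f >= 1/2) and f' = 2 f - h. *)
Lemma approximable_step (n : nat) (f : X -> R) (e : R) :
  measurable_fun [set: X] f -> (forall x, 0 <= f x <= 1) -> 0 < e ->
  exists g : pt -> R, [/\ continuous g, (forall x, 0 <= g x <= 1) &
    L1dist f g <= e + fine (nu [set: X]) / 2 ^+ n].
Proof.
have bm01 (f' : X -> R) : measurable_fun [set: X] f' -> (forall x, 0 <= f' x <= 1) -> bmeas f'.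
  by move=> mf f01; split => //; exists 1 => x; have /andP[? ?] := f01 x; rewrite ger0_norm.
elim: n f => [|n IH] f mf f01 e0.
  exists (fun=> 0); split; [exact: cst_continuous|by move=> x; rewrite lexx ler01|].
  have -> : fine (nu [set: X]) = Rintegral nu [set: X] (fun=> 1).
    by rewrite Rintegral_cst // mul1r.
  rewrite expr0 divr1; apply: (@le_trans _ _ (Rintegral nu [set: X] (fun=> 1))); last first.
    by rewrite lerDr ltW.
  apply: Rint_le; [apply: bmeas_norm; apply: bmeasB; [exact: bm01|exact: bmeas_cst]|exact: bmeas_cst|].
  by move=> x; rewrite subr0; have /andP[? ?] := f01 x; rewrite ger0_norm.
pose A : set X := [set x | 1 / 2 <= f x].
have mA : measurable A.
  have := mf measurableT _ (@measurable_itv R `[1 / 2, +oo[%R).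
  rewrite setTI; congr measurable; apply/seteqP; split=> x /=; by rewrite in_itv /= andbT.
pose f' x := 2 * f x - \1_A x.
have f'01 x : 0 <= f' x <= 1.
  rewrite /f' indicE; have /andP[h0 h1] := f01 x.
  case: (boolP (x \in A)) => xA; first by have := set_mem xA; rewrite /A /= => ?; apply/andP; split; lra.
  have : f x < 1 / 2 by rewrite ltNge; apply/negP => h; move/negP: xA; apply; rewrite inE.
  by rewrite subr0 => ?; apply/andP; split; lra.
have mf' : measurable_fun [set: X] f'.
  have [mm _] := bmeas_lin 2 (-1) (bm01 f mf f01) (bmeas_indic mA).
  suff -> : f' = (fun x => 2 * f x + -1 * \1_A x) by [].
  by apply/funext => x; rewrite /f' mulN1r.
have [g [cg g01 Hg]] := IH f' mf' f'01 e0.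
have [k [ck k01 Hk]] := approximable_measurable mA e0.
have cgk : continuous (fun x : pt => 2^-1 * g x + 2^-1 * k x).
  by move=> x; apply: (@cvg_lin _ pt (nbhs x)); [exact: cg|exact: ck].
have gk01 x : 0 <= 2^-1 * g x + 2^-1 * k x <= 1.
  by have /andP[? ?] := g01 x; have /andP[? ?] := k01 x; apply/andP; split; lra.
exists (fun x => 2^-1 * g x + 2^-1 * k x); split => //.
have := @L1dist_le2 f (fun x => 2^-1 * g x + 2^-1 * k x) f' g \1_A k 2^-1 2^-1.
move=> H; apply: le_trans (H _ _ _ _ _ _ _) _.
- exact: bm01.
- exact: bmeas01.
- exact: bm01.
- exact: bmeas01.
- exact: bmeas_indic.
- exact: bmeas01.
- move=> x.
  have -> : f x - (2^-1 * g x + 2^-1 * k x) = 2^-1 * (f' x - g x) + 2^-1 * (\1_A x - k x).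
    by rewrite /f'; field.
  by rewrite (le_trans (ler_normD _ _)) // !normrM !(@gtr0_norm _ 2^-1) ?invr_gt0.
have -> : e + fine (nu [set: X]) / 2 ^+ n.+1 =
    2^-1 * (e + fine (nu [set: X]) / 2 ^+ n) + 2^-1 * e.
  by rewrite exprS; field; rewrite expf_neq0.
by apply: lerD; rewrite ler_pM2l ?invr_gt0.
Qed.

(** An affine change of values maps [[-M, M]] to [[0, 1]]. Half of the error is spent on finitely
    many binary digits, half on the remaining ones. *)
Lemma continuous_approximation (f : X -> R) (M e : R) : 0 < M ->
  measurable_fun [set: X] f -> (forall x, `|f x| <= M) -> 0 < e ->
  exists g : pt -> R, [/\ continuous g, (forall x, `|g x| <= M) & L1dist f g <= e].
Proof.
move=> M0 mf fM e0.
have bf : bmeas f by split => //; exists M.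
pose f' x := (2 * M)^-1 * f x + 2^-1 * 1.
have bf' : bmeas f' by apply: bmeas_lin => //; exact: bmeas_cst.
have M2 : 0 < 2 * M by rewrite mulr_gt0.
have fE x : f x = 2 * M * f' x - M by rewrite /f'; field; rewrite gt_eqF.
have f'01 x : 0 <= f' x <= 1.
  have := fM x; rewrite fE ler_norml => /andP[h1 h2]; apply/andP; split.
    by rewrite -(pmulr_rge0 _ M2); lra.
  by rewrite -(ler_pM2l M2); lra.
pose e' := e / (2 * M) / 2.
have e'0 : 0 < e' by rewrite !divr_gt0.
have n0 : 0 <= fine (nu [set: X]) by exact: fine_ge0.
have [n Hn] : exists n, fine (nu [set: X]) / 2 ^+ n <= e'.
  have e1 : 0 < e' / (fine (nu [set: X]) + 1) by rewrite divr_gt0 // ltr_wpDl.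
  have ab : `|2^-1 : R| < 1 by rewrite gtr0_norm ?invr_gt0 // invf_lt1 // ltr1n.
  have /cvgrPdist_le/(_ _ e1)[n _ Hn] := cvg_expr ab.
  exists n; have := Hn n (leqnn n); rewrite /= sub0r normrN ger0_norm; last first.
    by rewrite exprn_ge0 // invr_ge0.
  rewrite exprVn ler_pdivlMr ?ltr_wpDl // => H; apply: le_trans H.
  by rewrite [leRHS]mulrC ler_wpM2r ?invr_ge0 ?exprn_ge0 // lerDl.
have [g [cg g01 Hg]] := approximable_step n bf'.1 f'01 e'0.
have cG : continuous (fun x : pt => 2 * M * g x + (-1) * M).
  by move=> x; apply: (@cvg_lin _ pt (nbhs x)); [exact: cg|exact: cvg_cst].
have GM x : `|2 * M * g x + (-1) * M| <= M.
  have /andP[h1 h2] := g01 x; rewrite ler_norml; apply/andP; split.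
    have : 0 <= 2 * M * g x by rewrite mulr_ge0 // ltW.
    lra.
  have : 2 * M * g x <= 2 * M * 1 by rewrite ler_pM2l.
  lra.
exists (fun x => 2 * M * g x + (-1) * M); split => //.
have := @L1dist_le2 f (fun x => 2 * M * g x + (-1) * M) f' g f' g (2 * M) 0.
move=> H; apply: le_trans (H _ _ _ _ _ _ _) _ => //.
- by apply: bmeas_continuous => //; exists M.
- exact: bmeas01.
- exact: bmeas01.
- move=> x; rewrite mul0r addr0 fE.
  have -> : 2 * M * f' x - M - (2 * M * g x + -1 * M) = 2 * M * (f' x - g x) by ring.
  by rewrite normrM gtr0_norm.
rewrite mul0r addr0.
have -> : e = 2 * M * (e' + e') by rewrite /e'; field; rewrite gt_eqF.
by rewrite ler_pM2l // (le_trans Hg) // lerD2l.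
Qed.

End FiniteMeasure.
End ContinuousApproximation.

(** * Identification of the limit *)

Section ScalarReduction.
Variables (R : realType) (d m : nat).
Local Notation pt := (pt R d).
Variables (Q : pt -> 'M[R]_d) (b : pt -> 'rV[R]_d) (C : pt -> 'M[R]_m).
Variables (phi : pt -> R) (a c : R) (xi : 'cV[R]_m).
Hypothesis symQ : forall x, (Q x)^T = Q x.
Hypothesis psdQ : forall x (v : pt), 0 <= qform (Q x) (v ord0).
Hypothesis phi_gt0 : forall x, 0 < phi x.
Hypothesis C2phi : C2 phi.
Hypothesis phi_inf : forall M : R, exists r : R, forall x, r <= enorm x -> M <= phi x.
Hypothesis a_gt0 : 0 < a.
Hypothesis c_gt0 : 0 < c.
Hypothesis Aphi : forall x, Aop Q b phi x <= a - c * phi x.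
Hypothesis xiC : forall x k, \sum_j xi j ord0 * C x j k = 0.

(** A scalar solution is a system of one equation with zero coupling and kernel vector 1, so
    uniqueness for systems applies. *)
Lemma scalar_sol_unique w w' g : scalar_sol Q b w g -> scalar_sol Q b w' g ->
  forall t x, 0 <= t -> w t x = w' t x.
Proof.
have sys v : scalar_sol Q b v g -> system_sol Q b (fun=> (0 : 'M[R]_1))
    (fun t x => const_mx (v t x)) (fun x => const_mx (g x)).
  have E (h : 'I_1) : (fun t x => (const_mx (v t x) : 'cV[R]_1) h ord0) = v.
    by apply/funext => t; apply/funext => x; rewrite mxE.
  move=> [Cv [Bv [v0 Dv']]]; split; first by move=> h; rewrite E.
  split; first by move=> h; rewrite E.
  split; first by move=> x; rewrite v0.
  move=> t x h t0; rewrite mxE.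
  have -> : (fun s => (const_mx (v s x) : 'cV[R]_1) h ord0) = v^~ x.
    by apply/funext => s; rewrite mxE.
  have -> : (fun y => (const_mx (v t y) : 'cV[R]_1) h ord0) = v t.
    by apply/funext => y; rewrite mxE.
  by rewrite Dv' // big1 ?addr0 // => k _; rewrite mxE mul0r.
move=> /sys s1 /sys s2 t x t0.
have coop1 (y : pt) (h k : 'I_1) : h != k -> 0 <= (0 : 'M[R]_1) h k by rewrite !ord1.
have pos1 (h : 'I_1) : 0 < (const_mx 1 : 'cV[R]_1) h ord0 by rewrite mxE.
have ker1 (y : pt) : (0 : 'M[R]_1) *m (const_mx 1 : 'cV[R]_1) = 0 by rewrite mul0mx.
have := system_sol_unique symQ psdQ phi_gt0 C2phi phi_inf a_gt0 c_gt0 Aphi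
  coop1 pos1 ker1 s1 s2 x t0.
by move=> /matrixP/(_ ord0 ord0); rewrite !mxE.
Qed.

Lemma weighted_sum_sol u f (s : seq 'I_m) : system_sol Q b C u f ->
  let w t (x : pt) := \sum_(j <- s) xi j ord0 * u t x j ord0 in
  [/\ C12 w, strip_bounded w & forall t x, 0 < t ->
    'D_1 (fun r => w r x) t = \sum_(j <- s) xi j ord0 * 'D_1 (fun r => u r x j ord0) t /\
    Aop Q b (w t) x = \sum_(j <- s) xi j ord0 * Aop Q b (fun y => u t y j ord0) x].
Proof.
move=> [Cu [Bu _]]; elim: s => [|j s [IC IB ID]] /=.
  have E : (fun t (x : pt) => \sum_(j <- [::]) xi j ord0 * u t x j ord0) = (fun _ _ => 0).
    by apply/funext => t; apply/funext => x; rewrite big_nil.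
  split; rewrite ?E; [exact: C12_cst|by move=> T; exists 0 => t x _; rewrite normr0|].
  move=> t x t0; rewrite !big_nil; split.
    have -> : (fun r => \sum_(j <- [::]) xi j ord0 * u r x j ord0) = (fun=> 0).
      by apply/funext => r; rewrite big_nil.
    exact: derive_cst.
  have -> : (fun y => \sum_(j <- [::]) xi j ord0 * u t y j ord0) = (fun=> 0).
    by apply/funext => r; rewrite big_nil.
  exact: Aop_cst.
have E : (fun t (x : pt) => \sum_(k <- j :: s) xi k ord0 * u t x k ord0) =
    (fun t x => xi j ord0 * u t x j ord0 + 1 * \sum_(k <- s) xi k ord0 * u t x k ord0).
  by apply/funext => t; apply/funext => x; rewrite big_cons mul1r.
split; rewrite ?E.
- exact: (C12_lin (xi j ord0) 1 (Cu j) IC).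
- exact: (strip_bounded_lin (xi j ord0) 1 (Bu j) IB).
- move=> t x t0; have [D1 A1] := ID t x t0; rewrite !big_cons; split.
    have -> : (fun r => \sum_(k <- j :: s) xi k ord0 * u r x k ord0) =
      (fun r => xi j ord0 * u r x j ord0 + 1 * \sum_(k <- s) xi k ord0 * u r x k ord0).
      by apply/funext => r; rewrite big_cons mul1r.
    have [_ ->] := is_derive_lin (xi j ord0) 1 (C12_is_derive x (Cu j) t0) (C12_is_derive x IC t0).
    by rewrite D1 mul1r.
  have -> : (fun y => \sum_(k <- j :: s) xi k ord0 * u t y k ord0) =
    (fun y => xi j ord0 * u t y j ord0 + 1 * \sum_(k <- s) xi k ord0 * u t y k ord0).
    by apply/funext => r; rewrite big_cons mul1r.
  by rewrite (Aop_lin _ _ _ _ _ (C12_C2 (Cu j) t0) (C12_C2 IC t0)) A1 mul1r.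
Qed.

Lemma weighted_scalar_sol u f : system_sol Q b C u f ->
  scalar_sol Q b (fun t x => \sum_j xi j ord0 * u t x j ord0)
    (fun x => \sum_j xi j ord0 * f x j ord0).
Proof.
move=> su; have [Cw Bw Dw] := weighted_sum_sol (index_enum _) su.
have [_ [_ [u0 Du]]] := su.
split => //; split => //; split; first by move=> x; rewrite u0.
move=> t x t0; have [-> ->] := Dw t x t0.
under eq_bigr => j _ do rewrite Du // mxE mulrDr mulr_sumr.
rewrite big_split /= exchange_big /= [X in _ + X]big1 ?addr0 // => k _.
under eq_bigr => j _ do rewrite mulrA.
by rewrite -mulr_suml xiC mul0r.
Qed.

End ScalarReduction.

(** * Limit for continuous and for bounded Borel data *)

Section Limit.
Variables (R : realType) (d m : nat).
Local Notation pt := (pt R d).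
Local Notation X := (Rd R d).
Variables (xi : 'cV[R]_m) (mu : probability X R).
Variable T : R -> (pt -> 'cV[R]_m) -> pt -> 'cV[R]_m.
Hypothesis xi_gt0 : forall h, 0 < xi h ord0.
Hypothesis xi_le1 : forall h, xi h ord0 <= 1.
Hypothesis xi_norm : \sum_j xi j ord0 * xi j ord0 = 1.
Hypothesis T_lin : forall f (k t : R), Cbm f -> 0 <= t ->
  T t (fun x => k *: f x) = fun x => k *: T t f x.
Hypothesis T_Cbm : forall f t, Cbm f -> 0 < t -> Cbm (T t f).
Hypothesis T_bound : forall f (M t : R) x i, Cbm f ->
  (forall x i, `|f x i ord0| <= M * xi i ord0) -> 0 <= t ->
  `|T t f x i ord0| <= M * xi i ord0.
Hypothesis decay : forall r eps : R, 0 < eps -> exists2 t0, 0 < t0 & forall f,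
  Cbm f -> (forall x i, `|f x i ord0| <= xi i ord0) -> forall t x y i j,
  t0 <= t -> enorm x <= r -> enorm y <= r ->
  `|T t f x i ord0 / xi i ord0 - T t f y j ord0 / xi j ord0| <= eps.
Hypothesis T_mean : forall f t, Cbm f -> 0 < t -> Mf mu xi (T t f) = Mf mu xi f.

Lemma finmu : (mu [set: X] < +oo)%E.
Proof. by rewrite probability_setT ltry. Qed.

Lemma Cbm_bmeas (f : pt -> 'cV[R]_m) h : Cbm f -> bmeas (fun x : X => f x h ord0).
Proof. by move=> Cf; apply: bmeas_continuous; [exact: (Cf h).1|exact: (Cf h).2]. Qed.

Lemma Mf_E (f : pt -> 'cV[R]_m) : Mf mu xi f = \sum_j xi j ord0 * Rintegral mu [set: X] (fun x => f x j ord0).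
Proof. by []. Qed.

Lemma mu_tail (e : R) : 0 < e ->
  exists2 rho, 0 <= rho & fine (mu [set x : X | ~ enorm (x : pt) <= rho]) <= e.
Proof.
move=> e0.
pose F n : set X := [set x : X | enorm (x : pt) <= n%:R].
have mF n : measurable (F n).
  rewrite -(setCK (F n)); apply: measurableC; apply: sub_sigma_algebra.
  have -> : ~` F n = (fun x : pt => enorm x) @^-1` [set s | n%:R < s].
    by apply/seteqP; split=> x /=; rewrite /F /= ltNge => /negP.
  by have /continuousP := @enorm_continuous R d; apply; exact: open_gt.
have ndF : nondecreasing_seq F.
  move=> n k nk; apply/subsetPset => x; rewrite /F /= => h; apply: le_trans h _.
  by rewrite ler_nat.
have [n Hn] := measure_tail finmu mF ndF e0.
exists n%:R => //; apply: le_trans Hn; rewrite le_eqVlt; apply/orP; left; apply/eqP.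
congr (fine (mu _)); apply/seteqP; split=> x /=.
  move=> nx; split => //; exists (Num.truncn (enorm (x : pt))).+1 => //.
  by rewrite /F /= ltW // truncnS_gt // enorm_ge0.
by move=> [_ nx].
Qed.

Lemma Cb_limit_unit (r eps : R) : 0 < eps -> exists2 t0, 0 < t0 & forall f,
  Cbm f -> (forall x i, `|f x i ord0| <= xi i ord0) -> forall t x i,
  t0 <= t -> enorm x <= r -> `|T t f x i ord0 - Mf mu xi f * xi i ord0| <= eps.
Proof.
move=> eps0; have e4 : 0 < eps / 4 by rewrite divr_gt0.
have e2 : 0 < eps / 2 by rewrite divr_gt0.
have [rho rho0 Hrho] := mu_tail e4.
have [t0 t00 Ht0] := decay (Num.max r rho) e2.
exists t0 => // f Cf fb t x i tt xr.
have tp : 0 < t by apply: lt_le_trans tt.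
pose v := T t f x i ord0 / xi i ord0.
have Cg := T_Cbm Cf tp; set g := T t f in Cg v *.
have gb y h : `|g y h ord0 / xi h ord0| <= 1.
  rewrite normrM normfV (gtr0_norm (xi_gt0 h)) ler_pdivrMr //.
  by apply: T_bound => //; [move=> z k; rewrite mul1r|exact: ltW].
pose E : set X := [set y : X | ~ enorm (y : pt) <= rho].
have mE : measurable E.
  apply: sub_sigma_algebra.
  have -> : E = (fun x : pt => enorm x) @^-1` [set s | rho < s].
    by apply/seteqP; split=> y /=; rewrite /E /= ltNge => /negP.
  by have /continuousP := @enorm_continuous R d; apply; exact: open_gt.
have RZ (k : R) : Rintegral mu [set: X] (fun=> k) = k.
  have E1 : fine (mu [set: X]) = 1 by rewrite probability_setT.
  by rewrite Rintegral_cst // [X in k * X]E1 mulr1.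
(* By invariance and [sum xi_j^2 = 1], [v - M_f] is [sum xi_j] times the [mu]-integral of
   [xi_j v - g_j]. Ratios inside radius [rho] differ from [v] by at most [eps / 2]; outside they
   differ by at most 2, on a set of measure at most [eps / 4]. *)
have vM : `|v - Mf mu xi f| <= eps.
  rewrite -(T_mean Cf tp) Mf_E.
  have -> : v - \sum_j xi j ord0 * Rintegral mu [set: X] (fun y => g y j ord0) =
     \sum_j xi j ord0 * Rintegral mu [set: X] (fun y => xi j ord0 * v - g y j ord0).
    rewrite -[v in LHS]mul1r -xi_norm mulr_suml -sumrB; apply: eq_bigr => j _.
    rewrite RintegralB //; first by rewrite RZ; ring.
      by apply: (bmeas_integrable finmu); exact: bmeas_cst.
    by apply: (bmeas_integrable finmu); exact: Cbm_bmeas.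
  rewrite (le_trans (ler_norm_sum _ _ _)) //.
  have -> : eps = \sum_j xi j ord0 * (xi j ord0 * eps).
    by under eq_bigr => j _ do rewrite mulrA; rewrite -mulr_suml xi_norm mul1r.
  apply: ler_sum => j _; rewrite normrM (gtr0_norm (xi_gt0 j)) ler_pM2l //.
  have bm1 : bmeas (fun y : X => xi j ord0 * v - g y j ord0).
    by apply: bmeasB; [exact: bmeas_cst|exact: Cbm_bmeas].
  apply: le_trans (le_normr_Rintegral _ (bmeas_integrable finmu bm1)) _ => //.
  have bm2 := bmeas_lin (xi j ord0 * (eps / 2)) (xi j ord0 * 2) (bmeas_cst d 1) (bmeas_indic mE).
  apply: (@le_trans _ _ (Rintegral mu [set: X]
     (fun y => xi j ord0 * (eps / 2) * 1 + xi j ord0 * 2 * \1_E y))).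
    apply: (Rint_le finmu) => //; first exact: bmeas_norm.
    move=> y; rewrite indicE.
    have -> : xi j ord0 * v - g y j ord0 = xi j ord0 * (v - g y j ord0 / xi j ord0).
      by field; rewrite gt_eqF.
    rewrite normrM (gtr0_norm (xi_gt0 j)) -!mulrA -mulrDr ler_pM2l //.
    case: (boolP (y \in E)) => yE.
      rewrite mulr1 (le_trans (ler_normB _ _)) //.
      by have := gb x i; have := gb y j; rewrite -/v /=; lra.
    rewrite mulr0 addr0 mulr1; apply: Ht0 => //; first by rewrite le_max xr.
    rewrite le_max; apply/orP; right; apply: contrapT => ny.
    by move/negP: yE; apply; rewrite inE.
  rewrite (Rint_lin finmu) //; [|exact: bmeas_cst|exact: bmeas_indic].
  rewrite RZ Rint_indic //.
  have : xi j ord0 * fine (mu E) <= xi j ord0 * (eps / 4) by rewrite ler_pM2l.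
  lra.
have -> : g x i ord0 - Mf mu xi f * xi i ord0 = (v - Mf mu xi f) * xi i ord0.
  by rewrite /v; field; rewrite gt_eqF.
rewrite normrM (gtr0_norm (xi_gt0 i)) (le_trans _ vM) // ler_piMr //.
Qed.

Lemma Cbm_scale (k : R) (f : pt -> 'cV[R]_m) : Cbm f -> Cbm (fun x => k *: f x).
Proof.
move=> Cf h; have -> : (fun x => (k *: f x) h ord0) = (fun x => k * f x h ord0).
  by apply/funext => x; rewrite mxE.
split.
  move=> x; have c1 : f y h ord0 @[y --> x] --> f x h ord0 by exact: (Cf h).1.
  exact: cvgM (cvg_cst k) c1.
by have [M HM] := (Cf h).2; exists (`|k| * M) => x; rewrite normrM ler_wpM2l.
Qed.

Lemma Cb_limit (r eps K : R) : 0 < eps -> 0 < K -> exists2 t0, 0 < t0 & forall f,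
  Cbm f -> (forall x i, `|f x i ord0| <= K * xi i ord0) -> forall t x i,
  t0 <= t -> enorm x <= r -> `|T t f x i ord0 - Mf mu xi f * xi i ord0| <= eps.
Proof.
move=> eps0 K0; have eK : 0 < eps / K by rewrite divr_gt0.
have [t0 t00 Ht0] := Cb_limit_unit r eK; exists t0 => // f Cf fb t x i tt xr.
have := Ht0 (fun x => K^-1 *: f x) (Cbm_scale K^-1 Cf) _ t x i tt xr.
rewrite T_lin //; last by rewrite ltW // (lt_le_trans t00).
have -> : Mf mu xi (fun x => K^-1 *: f x) = K^-1 * Mf mu xi f.
  rewrite !Mf_E mulr_sumr; apply: eq_bigr => j _.
  have -> : Rintegral mu [set: X] (fun x => (K^-1 *: f x) j ord0) =
      K^-1 * Rintegral mu [set: X] (fun x => f x j ord0).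
    rewrite -RintegralZl //; last by apply: (bmeas_integrable finmu); exact: Cbm_bmeas.
    by apply: eq_Rintegral => y _; rewrite mxE.
  by ring.
rewrite mxE => H.
have -> : T t f x i ord0 - Mf mu xi f * xi i ord0 =
    K * (K^-1 * T t f x i ord0 - K^-1 * Mf mu xi f * xi i ord0).
  by field; rewrite gt_eqF.
rewrite normrM gtr0_norm // mulrC -ler_pdivlMr //; apply: H => y j.
by rewrite mxE normrM normfV (gtr0_norm K0) ler_pdivrMl.
Qed.

Variable p : R -> pt -> 'I_m -> 'I_m -> {measure set X -> \bar R}.
Hypothesis finp : forall t x i j, 0 < t -> (p t x i j [set: X] < +oo)%E.
Hypothesis T_ker : forall t f x i, 0 < t -> Cbm f -> T t f x i ord0 = Tker p t f x i ord0.

Lemma L1_add (nu1 nu2 : {measure set X -> \bar R}) h : (nu1 [set: X] < +oo)%E ->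
  (nu2 [set: X] < +oo)%E -> bmeas h ->
  Rintegral (measure_add nu1 nu2) [set: X] h =
  Rintegral nu1 [set: X] h + Rintegral nu2 [set: X] h.
Proof.
move=> f1 f2 bh; have i1 := bmeas_integrable f1 bh; have i2 := bmeas_integrable f2 bh.
rewrite /Rintegral integral_measure_add //.
by rewrite fineD //; exact: integrable_fin_num.
Qed.

Lemma Bb_limit (f : pt -> 'cV[R]_m) : Bbm f -> forall r eps : R, 0 < eps -> exists t0 : R, forall t x h,
  0 < t -> t0 <= t -> enorm x <= r ->
  `|Tker p t f x h ord0 - Mf mu xi f * xi h ord0| <= eps.
Proof.
move=> Bf r eps eps0.
have [K' K'0 HK'] : exists2 K, 0 <= K & forall h x, `|f x h ord0| <= K * xi h ord0.
  apply: finite_bound => [h|h M M' MM' H x].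
    have [M HM] := (Bf h).2; exists (M / xi h ord0) => x.
    by rewrite mulfVK ?gt_eqF.
  by rewrite (le_trans (H x)) // ler_pM2r.
pose K := K' + 1; have K0 : 0 < K by rewrite ltr_wpDl.
have HK h x : `|f x h ord0| <= K * xi h ord0.
  by rewrite (le_trans (HK' h x)) // ler_pM2r // lerDl.
have e2 : 0 < eps / 2 by rewrite divr_gt0.
have [t0 t00 Ht0] := Cb_limit r e2 K0.
exists t0 => t x i tp tt xr.
(* There are [m] errors in the kernel and [m] in the mean, each at most [eta]; together they stay
   within [eps / 2]. *)
pose eta := eps / 2 / (2 * (m%:R + 1)).
have m0 : (0 : R) < m%:R + 1 by rewrite ltr_wpDl.
have eta0 : 0 < eta by rewrite !divr_gt0 // mulr_gt0.
have bf h : bmeas (fun x : X => f x h ord0) := Bf h.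
have /choice[g Hg] j : exists g : pt -> R, [/\ continuous g,
    (forall x, `|g x| <= K * xi j ord0),
    L1dist (p t x i j) (fun x => f x j ord0) g <= eta &
    L1dist mu (fun x => f x j ord0) g <= eta].
  (* One approximant must serve both the kernel and [mu], hence approximation with respect to the
     sum. *)
  pose nu := measure_add (p t x i j) mu.
  have finnu : (nu [set: X] < +oo)%E.
    by rewrite /nu measure_addE lte_add_pinfty // ?finp // finmu.
  have Kx : 0 < K * xi j ord0 by rewrite mulr_gt0.
  have [g [cg gb Hg]] := continuous_approximation finnu Kx (Bf j).1 (HK j) eta0.
  have bg : bmeas g by apply: bmeas_continuous => //; exists (K * xi j ord0).
  have bd := bmeas_norm (bmeasB (bf j) bg).
  move: Hg; rewrite /L1dist L1_add //; [|exact: finp|exact: finmu].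
  have := Rintegral_ge0 (p t x i j) (fun y (_ : [set: X] y) => normr_ge0 (f y j ord0 - g y)).
  have := Rintegral_ge0 mu (fun y (_ : [set: X] y) => normr_ge0 (f y j ord0 - g y)).
  by move=> n1 n2 Hg; exists g; split => //; rewrite /L1dist; lra.
pose G x : 'cV[R]_m := \col_j g j x.
have CG : Cbm G.
  move=> j; have -> : (fun x => G x j ord0) = g j by apply/funext => y; rewrite mxE.
  by have [? ? _ _] := Hg j; split => //; exists (K * xi j ord0).
have GK y j : `|G y j ord0| <= K * xi j ord0 by rewrite mxE; have [_ H _ _] := Hg j.
have main := Ht0 G CG GK t x i tt xr.
rewrite T_ker // in main.
have diff (nu : {measure set X -> \bar R}) j : (nu [set: X] < +oo)%E ->
    `|Rintegral nu [set: X] (fun y => f y j ord0) -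
      Rintegral nu [set: X] (fun y => G y j ord0)| <=
    L1dist nu (fun x => f x j ord0) (g j).
  move=> fin; have bG := Cbm_bmeas j CG.
  rewrite -RintegralB //; try exact: bmeas_integrable.
  apply: le_trans (le_normr_Rintegral _ (bmeas_integrable fin (bmeasB (bf j) bG))) _ => //.
  rewrite le_eqVlt; apply/orP; left; apply/eqP; apply: eq_Rintegral => y _.
  by rewrite mxE.
have d1 : `|Tker p t f x i ord0 - Tker p t G x i ord0| <= m%:R * eta.
  rewrite !mxE -sumrB (le_trans (ler_norm_sum _ _ _)) //.
  rewrite mulr_natl -[X in _ *+ X]card_ord -sumr_const; apply: ler_sum => j _.
  by have [_ _ H _] := Hg j; apply: le_trans H; apply: diff; exact: finp.
have d2 : `|Mf mu xi f - Mf mu xi G| <= m%:R * eta.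
  rewrite !Mf_E -sumrB (le_trans (ler_norm_sum _ _ _)) //.
  rewrite mulr_natl -[X in _ *+ X]card_ord -sumr_const; apply: ler_sum => j _.
  rewrite -mulrBr normrM (gtr0_norm (xi_gt0 j)).
  have [_ _ _ H] := Hg j; apply: (@le_trans _ _ (1 * eta)); last by rewrite mul1r.
  apply: ler_pM => //; first exact: ltW.
  by apply: le_trans H; apply: diff; exact: finmu.
have -> : Tker p t f x i ord0 - Mf mu xi f * xi i ord0 =
   (Tker p t f x i ord0 - Tker p t G x i ord0) +
   (Tker p t G x i ord0 - Mf mu xi G * xi i ord0) -
   (Mf mu xi f - Mf mu xi G) * xi i ord0 by ring.
rewrite (le_trans (ler_normB _ _)) //.
have n1 := ler_normD (Tker p t f x i ord0 - Tker p t G x i ord0)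
   (Tker p t G x i ord0 - Mf mu xi G * xi i ord0).
have n2 : `|(Mf mu xi f - Mf mu xi G) * xi i ord0| <= m%:R * eta.
  by rewrite normrM (gtr0_norm (xi_gt0 i)) (le_trans _ d2) // ler_piMr.
have me : m%:R * eta + m%:R * eta <= eps / 2.
  have -> : eps / 2 = 2 * (m%:R + 1) * eta by rewrite /eta; field; rewrite gt_eqF.
  lra.
lra.
Qed.

End Limit.

(** * Convergence in L^q *)

Section Powers.
Variables (R : realType) (q : R).
Hypothesis q_ge1 : 1 <= q.

Let q_gt0 : 0 < q. Proof. exact: lt_le_trans q_ge1. Qed.

Lemma powR_split (a : R) : 0 <= a -> a `^ q = a * a `^ (q - 1).
Proof.
move=> a0; have [->|an0] := eqVneq a 0; first by rewrite powR0 ?gt_eqF // mul0r.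
transitivity (a `^ (1 + (q - 1))); first by congr (_ `^ _); ring.
by rewrite [LHS]powRD ?an0 ?implybT // powRr1.
Qed.

(* Young's inequality with exponents q / (q - 1) and q. *)
Lemma powR_tangent (a s : R) : 0 <= a ->
  q * (a `^ (q - 1) * s) <= `|s| `^ q + (q - 1) * a `^ q.
Proof.
move=> a0.
apply: (@le_trans _ _ (q * (a `^ (q - 1) * `|s|))).
  by rewrite ler_pM2l // ler_wpM2l ?powR_ge0 // ler_norm.
have [q1|q1] := eqVneq q 1.
  by rewrite q1 subrr powRr0 powRr1 // !mul1r mul0r addr0.
have q10 : 0 < q - 1 by rewrite subr_gt0 lt_def q1.
pose p := q / (q - 1).
have p0 : 0 < p by rewrite divr_gt0.
have pq : p^-1 + q^-1 = 1 by rewrite /p; field; rewrite !gt_eqF.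
have := conjugate_powR (powR_ge0 a (q - 1)) (normr_ge0 s) p0 q_gt0 pq.
rewrite -powRrM (_ : (q - 1) * p = q); last by rewrite /p; field; rewrite gt_eqF.
move=> H; have := ler_wpM2l (ltW q_gt0) H.
have -> : q * (a `^ q / p + `|s| `^ q / q) = `|s| `^ q + (q - 1) * a `^ q.
  by rewrite /p; field; rewrite !gt_eqF.
exact.
Qed.

(** The tangent inequality provides a Lipschitz constant for the power on [[0, |a| + 1]]. *)
Lemma abs_powR_continuous : continuous (fun s : R => `|s| `^ q).
Proof.
move=> a; apply: (@cvg_dist_le _ R (nbhs a) _ (fun s : R => `|s| `^ q)) => e e0.
pose L := q * (`|a| + 1) `^ (q - 1) + 1.
have L0 : 0 < L by rewrite ltr_wpDl // mulr_ge0 ?powR_ge0 // ltW.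
have lip (u v : R) : 0 <= u -> 0 <= v -> u <= `|a| + 1 -> u `^ q - v `^ q <= L * `|u - v|.
  move=> u0 v0 ua.
  have := powR_tangent v u0; rewrite (ger0_norm v0) => H.
  have H1 : u `^ q - v `^ q <= q * (u `^ (q - 1) * (u - v)).
    have := powR_split u0 => E; rewrite mulrBr.
    have -> : u `^ (q - 1) * u = u `^ q by rewrite E mulrC.
    move: H; move: (u `^ q) (v `^ q) (u `^ (q - 1) * v) => A B C; lra.
  apply: le_trans H1 _; apply: (@le_trans _ _ (q * (u `^ (q - 1) * `|u - v|))).
    by rewrite ler_pM2l // ler_wpM2l ?powR_ge0 // ler_norm.
  rewrite mulrA ler_wpM2r // /L (@le_trans _ _ (q * (`|a| + 1) `^ (q - 1))) //.
    by rewrite ler_pM2l // ge0_ler_powR ?nnegrE ?subr_ge0 // addr_ge0.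
  by rewrite lerDl.
apply/nbhs_ballP; exists (Num.min 1 (e / L)); first by rewrite /= lt_min ltr01 divr_gt0.
move=> s; rewrite /ball /= lt_min => /andP[s1 s2].
have sa : `|s| <= `|a| + 1.
  rewrite -(subrK a s) (le_trans (ler_normD _ _)) // addrC lerD2l distrC ltW //.
have dd : `| `|a| - `|s| | <= `|a - s| by exact: ler_dist_dist.
have Le : L * `|a - s| <= e by rewrite mulrC -ler_pdivlMr // ltW.
have aa : `|a| <= `|a| + 1 by rewrite lerDl.
have l1 := lip _ _ (normr_ge0 a) (normr_ge0 s) aa.
have l2 := lip _ _ (normr_ge0 s) (normr_ge0 a) sa.
rewrite distrC in l2.
have := ler_wpM2l (ltW L0) dd; rewrite ler_norml => h; apply/andP; split; lra.
Qed.

Lemma powR_add_le (x y : R) : `|x + y| `^ q <= 2 `^ q * (`|x| `^ q + `|y| `^ q).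
Proof.
have q0 := ltW q_gt0.
wlog xy : x y / `|x| <= `|y|.
  move=> H; case: (leP `|x| `|y|) => [|/ltW] h; first exact: H.
  by rewrite addrC (addrC (`|x| `^ q)); exact: H.
apply: (@le_trans _ _ ((2 * `|y|) `^ q)).
  rewrite ge0_ler_powR ?nnegrE ?mulr_ge0 // (le_trans (ler_normD _ _)) //; lra.
by rewrite powRM // ler_wpM2l ?powR_ge0 // lerDr powR_ge0.
Qed.

End Powers.

Section LqDistance.
Variables (R : realType) (d : nat) (q : R).
Local Notation pt := (pt R d).
Local Notation X := (Rd R d).
Variable mu : probability X R.
Hypothesis q_ge1 : 1 <= q.
Implicit Types u v w : X -> R.

(** The [q]-th power of the distance in [L^q(mu)]. Without the root, the triangle inequality is used
    in a form with the factor [2^q]. *)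
Definition Iq u v : \bar R := (\int[mu]_(y in [set: X]) (`|u y - v y| `^ q)%:E)%E.

Lemma measurable_powq u : measurable_fun [set: X] u ->
  measurable_fun [set: X] (fun y => (`|u y| `^ q)%:E).
Proof.
move=> mu'; apply/measurable_EFinP; apply: (measurableT_comp (measurable_powR q)).
exact: measurableT_comp.
Qed.

Lemma measurable_powqB u v : measurable_fun [set: X] u -> measurable_fun [set: X] v ->
  measurable_fun [set: X] (fun y => (`|u y - v y| `^ q)%:E).
Proof.
by move=> m1 m2; apply: (@measurable_powq (fun y => u y - v y)); exact: measurable_funB.
Qed.

Lemma Iq_ge0 u v : (0 <= Iq u v)%E.
Proof. by apply: integral_ge0 => y _; rewrite lee_fin powR_ge0. Qed.

Lemma Iq_sym u v : Iq u v = Iq v u.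
Proof. by apply: eq_integral => y _; rewrite distrC. Qed.

Lemma Iq_triangle u v w (e1 e2 : R) : measurable_fun [set: X] u ->
  measurable_fun [set: X] v -> measurable_fun [set: X] w ->
  (Iq u v <= e1%:E)%E -> (Iq v w <= e2%:E)%E -> (Iq u w <= (2 `^ q * (e1 + e2))%:E)%E.
Proof.
move=> mU mV mW h1 h2.
have m1 := measurable_powqB mU mV; have m2 := measurable_powqB mV mW.
have m3 := measurable_powqB mU mW.
have n1 (z : R) : (0 <= (`|z| `^ q)%:E)%E by rewrite lee_fin powR_ge0.
apply: (@le_trans _ _ (\int[mu]_(y in [set: X]) ((2 `^ q)%:E *
   ((`|u y - v y| `^ q)%:E + (`|v y - w y| `^ q)%:E)))%E).
  apply: ge0_le_integral => //.
  - by apply: measurable_funeM; exact: emeasurable_funD.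
  - move=> y _; rewrite -EFinD -EFinM lee_fin.
    have -> : u y - w y = (u y - v y) + (v y - w y) by rewrite addrA subrK.
    exact: powR_add_le.
have m4 : measurable_fun [set: X]
    (fun y => ((`|u y - v y| `^ q)%:E + (`|v y - w y| `^ q)%:E)%E).
  exact: emeasurable_funD.
rewrite ge0_integralZl //; last by move=> y _; rewrite adde_ge0.
rewrite ge0_integralD // EFinM EFinD.
by apply: lee_wpmul2l => //; rewrite ?lee_fin ?powR_ge0 // leeD.
Qed.

Lemma Iq_tail u (e : R) : measurable_fun [set: X] u ->
  (\int[mu]_(y in [set: X]) (`|u y| `^ q)%:E < +oo)%E -> 0 < e ->
  exists n : nat, (\int[mu]_(y in [set: X])
    (`|u y| `^ q * \1_[set z | n.+1%:R < `|u z| :> R] y)%:E <= e%:E)%E.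
Proof.
move=> mU fU e0.
pose A n : set X := [set z | n.+1%:R < `|u z| :> R].
have mA n : measurable (A n).
  have mn : measurable_fun [set: X] (fun y => `|u y|) by exact: measurableT_comp.
  have := mn measurableT _ (@measurable_itv R `]n.+1%:R, +oo[%R).
  by rewrite setTI; congr measurable; apply/seteqP; split=> y /=; rewrite in_itv /= andbT.
pose f_ n (y : X) := (`|u y| `^ q * \1_(A n) y)%:E.
have mf n : measurable_fun [set: X] (f_ n).
  apply/measurable_EFinP; apply: measurable_funM; last exact: measurable_indic.
  by have /measurable_EFinP := measurable_powq mU.
have ig : mu.-integrable [set: X] (fun y => (`|u y| `^ q)%:E).
  apply/integrableP; split; first exact: measurable_powq.
  under eq_integral => y _ do rewrite gee0_abs ?lee_fin ?powR_ge0 //.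
  exact: fU.
have cv y : [set: X] y -> f_^~ y @ \oo --> 0%E.
  move=> _; apply: cvg_near_cst.
  exists (Num.truncn `|u y|).+1 => // n /= hn; rewrite /f_ indicE.
  suff -> : (y \in A n) = false by rewrite mulr0.
  apply/negbTE; rewrite notin_setE /A /= => h.
  have h1 : ((Num.truncn `|u y|).+1%:R : R) <= n.+1%:R by rewrite ler_nat ltnW.
  by have := lt_trans h (lt_le_trans (truncnS_gt `|u y|) h1); rewrite ltxx.
have fing y : [set: X] y -> ((`|u y| `^ q)%:E : \bar R) \is a fin_num by [].
have dom n y : [set: X] y -> (`|f_ n y| <= (`|u y| `^ q)%:E)%E.
  move=> _; rewrite /f_ gee0_abs ?lee_fin ?mulr_ge0 ?powR_ge0 //.
  by rewrite ler_piMr ?powR_ge0 // indicE; case: (_ \in _).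
have := dominated_cvg measurableT mf cv fing ig dom.
rewrite integral0 => /fine_cvgP[fn /cvgrPdist_le/(_ _ e0)[n2 _ H2]].
have [n1 _ H1] := fn; pose n := maxn n1 n2; exists n.
have := H2 n (leq_maxr _ _); rewrite /= sub0r normrN => h.
rewrite -(fineK (H1 n (leq_maxl _ _))) lee_fin; apply: le_trans h.
exact: ler_norm.
Qed.

(** Truncate at a level [M >= 1], then approximate in [L^1]: between functions bounded by [M], the
    [q]-th power of the difference is at most [(2 M)^(q - 1)] times the difference. The [L^1]
    conclusion serves to control [M_f]; on the truncated set it follows from [|u| <= |u|^q]. *)
Lemma Lq_density u (e : R) : measurable_fun [set: X] u ->
  (\int[mu]_(y in [set: X]) (`|u y| `^ q)%:E < +oo)%E -> 0 < e ->
  exists g : pt -> R, [/\ continuous g, (exists M, forall x, `|g x| <= M),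
    (Iq u g <= e%:E)%E &
    (\int[mu]_(y in [set: X]) `|u y - g y|%:E <= e%:E)%E].
Proof.
move=> mU fU e0.
have q0 : 0 < q by exact: lt_le_trans q_ge1.
have c0 : 0 < 2 `^ q :> R by rewrite powR_gt0.
pose e1 := Num.min (e / 2) (e / (2 `^ q) / 2).
have e10 : 0 < e1 by rewrite lt_min !divr_gt0.
have [n Hn] := Iq_tail mU fU e10.
pose A : set X := [set z | n.+1%:R < `|u z| :> R].
pose M : R := n.+1%:R.
have M0 : 0 < M by rewrite ltr0n.
have mA : measurable A.
  have mn : measurable_fun [set: X] (fun y => `|u y|) by exact: measurableT_comp.
  have := mn measurableT _ (@measurable_itv R `]n.+1%:R, +oo[%R).
  by rewrite setTI; congr measurable; apply/seteqP; split=> y /=; rewrite in_itv /= andbT.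
pose uM y := u y * \1_(~` A) y.
have muM : measurable_fun [set: X] uM.
  by apply: measurable_funM => //; apply: measurable_indic; exact: measurableC.
have uMM y : `|uM y| <= M.
  rewrite /uM indicE in_setC; case: (boolP (y \in A)) => yA /=.
    by rewrite mulr0 normr0 ltW.
  rewrite mulr1 leNgt; apply/negP => h; move/negP: yA; apply; rewrite inE; exact: h.
pose L : R := (2 * M) `^ (q - 1) + 1.
have L0 : 0 < L by rewrite ltr_wpDl ?powR_ge0.
pose e2 := e1 / L.
have e20 : 0 < e2 by rewrite divr_gt0.
have L1 : 1 <= L by rewrite lerDr powR_ge0.
have e21 : e2 <= e1 by rewrite ler_pdivrMr // ler_peMr // ltW.
have [g [cg gM Hg]] := continuous_approximation (@finmu R d mu) M0 muM uMM e20.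
have mg := continuous_measurable cg.
have bg : bmeas g by apply: bmeas_continuous => //; exists M.
have buM : bmeas uM by split => //; exists M.
have Hg' : (\int[mu]_(y in [set: X]) `|uM y - g y|%:E <= e2%:E)%E.
  have := integrable_fin_num measurableT
    (bmeas_integrable (@finmu R d mu) (bmeas_norm (bmeasB buM bg))).
  by move=> /fineK <-; rewrite lee_fin.
have uE y : `|u y - uM y| = `|u y| * \1_A y.
  rewrite /uM !indicE in_setC; case: (y \in A) => /=.
    by rewrite mulr0 subr0 mulr1.
  by rewrite mulr1 subrr normr0 mulr0.
have h1 : (Iq u uM <= e1%:E)%E.
  apply: le_trans Hn; rewrite le_eqVlt; apply/orP; left; apply/eqP.
  apply: eq_integral => y _; rewrite uE indicE; congr EFin.
  rewrite /A; case: (y \in _); rewrite ?mulr1 //.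
  by rewrite !mulr0 powR0 // gt_eqF.
have mng : measurable_fun [set: X] (fun y => `|uM y - g y|%:E).
  apply/measurable_EFinP; apply: measurableT_comp => //; exact: measurable_funB.
have h2 : (Iq uM g <= e1%:E)%E.
  apply: (@le_trans _ _ (\int[mu]_(y in [set: X]) (L%:E * `|uM y - g y|%:E))%E).
    apply: ge0_le_integral => //.
    - exact: measurable_powqB.
    - exact: measurable_funeM.
    - move=> y _; rewrite -EFinM lee_fin (powR_split q_ge1) // mulrC ler_wpM2r //.
      apply: (@le_trans _ _ ((2 * M) `^ (q - 1))); last by rewrite lerDl.
      rewrite ge0_ler_powR ?nnegrE ?subr_ge0 ?mulr_ge0 ?(ltW M0) //.
      by rewrite (le_trans (ler_normB _ _)) // mulr2n mulrDl mul1r lerD.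
  rewrite ge0_integralZl //; last by rewrite lee_fin ltW.
  have -> : e1%:E = (L%:E * e2%:E)%E :> \bar R.
    by rewrite -EFinM; congr EFin; rewrite /e2 mulrC mulfVK // gt_eqF.
  by apply: lee_wpmul2l => //; rewrite lee_fin ltW.
exists g; split => //; first by exists M.
  have := Iq_triangle mU muM mg h1 h2; move=> /le_trans; apply; rewrite lee_fin.
  have e1e : e1 <= e / (2 `^ q) / 2 by rewrite ge_min lexx orbT.
  have : 2 `^ q * e1 <= 2 `^ q * (e / (2 `^ q) / 2) by rewrite ler_pM2l.
  have -> : 2 `^ q * (e / (2 `^ q) / 2) = e / 2 by field; rewrite gt_eqF.
  by rewrite mulrDr; lra.
have mnu : measurable_fun [set: X] (fun y => (`|u y| `^ q * \1_A y)%:E).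
  apply/measurable_EFinP; apply: measurable_funM; last exact: measurable_indic.
  by have /measurable_EFinP := measurable_powq mU.
apply: (@le_trans _ _ (\int[mu]_(y in [set: X])
   ((`|u y| `^ q * \1_A y)%:E + `|uM y - g y|%:E))%E).
  apply: ge0_le_integral => //.
  - by apply/measurable_EFinP; apply: measurableT_comp => //; exact: measurable_funB.
  - by apply: emeasurable_funD.
  - move=> y _; rewrite -EFinD lee_fin.
    have -> : u y - g y = (u y - uM y) + (uM y - g y) by rewrite addrA subrK.
    rewrite (le_trans (ler_normD _ _)) // lerD2r uE indicE.
    case: (boolP (y \in A)) => yA; last by rewrite !mulr0.
    rewrite !mulr1 (powR_split q_ge1) // ler_peMr //.
    have y1 : 1 <= `|u y|.
      by have := set_mem yA; rewrite /A /= => /ltW; apply: le_trans; rewrite ler1n.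
    by rewrite -[leLHS](powRr0 `|u y|) ler_powR // subr_ge0.
rewrite ge0_integralD //.
have -> : e%:E = ((e / 2)%:E + (e / 2)%:E)%E :> \bar R.
  by rewrite -EFinD; congr EFin; field.
have e1e : e1 <= e / 2 by rewrite ge_min lexx.
apply: leeD; first by apply: le_trans Hn _; rewrite lee_fin.
by apply: le_trans Hg' _; rewrite lee_fin (le_trans e21).
Qed.

End LqDistance.

Section LqLimit.
Variables (R : realType) (d m : nat) (q : R).
Local Notation pt := (pt R d).
Local Notation X := (Rd R d).
Variables (xi : 'cV[R]_m) (mu : probability X R).
Variable T : R -> (pt -> 'cV[R]_m) -> pt -> 'cV[R]_m.
Hypothesis q_ge1 : 1 <= q.
Hypothesis xi_gt0 : forall h, 0 < xi h ord0.
Hypothesis xi_le1 : forall h, xi h ord0 <= 1.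
Hypothesis T_lin : forall f g (k l t : R), Cbm f -> Cbm g ->
  Cbm (fun x => k *: f x + l *: g x) -> 0 <= t ->
  T t (fun x => k *: f x + l *: g x) = fun x => k *: T t f x + l *: T t g x.
Hypothesis T_le : forall f g (t : R) x i, Cbm f -> Cbm g ->
  (forall x i, f x i ord0 <= g x i ord0) -> 0 <= t -> T t f x i ord0 <= T t g x i ord0.
Hypothesis T_xi : forall t, 0 <= t -> T t (fun=> xi) = fun=> xi.
Hypothesis T_Cbm : forall f t, Cbm f -> 0 < t -> Cbm (T t f).
Hypothesis T_bound : forall f (M t : R) x i, Cbm f ->
  (forall x i, `|f x i ord0| <= M * xi i ord0) -> 0 <= t ->
  `|T t f x i ord0| <= M * xi i ord0.
Hypothesis T_mean : forall f t, Cbm f -> 0 < t -> Mf mu xi (T t f) = Mf mu xi f.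
Hypothesis T_limit : forall r eps K : R, 0 < eps -> 0 < K ->
  exists2 t0, 0 < t0 & forall f, Cbm f ->
  (forall x i, `|f x i ord0| <= K * xi i ord0) -> forall t x i,
  t0 <= t -> enorm x <= r -> `|T t f x i ord0 - Mf mu xi f * xi i ord0| <= eps.

Let q_gt0 : 0 < q. Proof. exact: lt_le_trans q_ge1. Qed.

Lemma Cbm_lin (k l : R) (f g : pt -> 'cV[R]_m) : Cbm f -> Cbm g ->
  Cbm (fun x => k *: f x + l *: g x).
Proof.
move=> Cf Cg h.
have -> : (fun x => (k *: f x + l *: g x) h ord0) =
    (fun x => k * f x h ord0 + l * g x h ord0) by apply/funext => x; rewrite !mxE.
have [cf [M HM]] := Cf h; have [cg [N HN]] := Cg h; split.
  move=> x; have c1 : f y h ord0 @[y --> x] --> f x h ord0 by exact: cf.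
  have c2 : g y h ord0 @[y --> x] --> g x h ord0 by exact: cg.
  exact: cvgD (cvgM (cvg_cst k) c1) (cvgM (cvg_cst l) c2).
exists (`|k| * M + `|l| * N) => x; rewrite (le_trans (ler_normD _ _)) // !normrM.
by rewrite lerD // ler_wpM2l.
Qed.

Lemma Cbm_cst (v : 'cV[R]_m) : Cbm (fun _ : pt => v).
Proof. by move=> h; split; [exact: cst_continuous|exists `|v h ord0|]. Qed.

(** The power is taken of the ratio to [xi], because it is relative to [xi] that [T(t)] acts as an
    averaging operator. *)
Definition relative_power (g : pt -> 'cV[R]_m) (x : pt) : 'cV[R]_m :=
  \col_i (xi i ord0 * `|g x i ord0 / xi i ord0| `^ q).

Lemma Cbm_relative_power g : Cbm g -> Cbm (relative_power g).
Proof.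
move=> Cg h.
have -> : (fun x => relative_power g x h ord0) =
    (fun x => xi h ord0 * `|g x h ord0 / xi h ord0| `^ q).
  by apply/funext => x; rewrite mxE.
have [cg [M HM]] := Cg h; split.
  move=> x; have c1 : g y h ord0 @[y --> x] --> g x h ord0 by exact: cg.
  have c2 : g y h ord0 / xi h ord0 @[y --> x] --> g x h ord0 / xi h ord0.
    exact: cvgM c1 (cvg_cst _).
  have c3 := cvg_comp _ _ c2 (@abs_powR_continuous R q q_ge1 (g x h ord0 / xi h ord0)).
  exact: cvgM (cvg_cst (xi h ord0)) c3.
exists (xi h ord0 * (M / xi h ord0) `^ q) => x.
rewrite normrM (gtr0_norm (xi_gt0 h)) ler_pM2l // ger0_norm ?powR_ge0 //.
have M0 : 0 <= M by apply: le_trans (HM x).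
rewrite ge0_ler_powR ?nnegrE ?divr_ge0 ?(ltW q_gt0) ?(ltW (xi_gt0 h)) //.
by rewrite normrM normfV (gtr0_norm (xi_gt0 h)) ler_pM2r ?invr_gt0.
Qed.

(* Jensen's inequality for the positive operator T(t), which fixes xi: the
   tangent line at the point |T(t)g|/xi is a combination of g and xi. *)
Lemma T_jensen g t x i : Cbm g -> 0 <= t ->
  relative_power (T t g) x i ord0 <= T t (relative_power g) x i ord0.
Proof.
move=> Cg t0; pose A := `|T t g x i ord0 / xi i ord0|.
have A0 : 0 <= A by exact: normr_ge0.
have [s s1 sA] : exists2 s : R, `|s| = 1 & s * (T t g x i ord0 / xi i ord0) = A.
  rewrite /A; case: (ger0P (T t g x i ord0 / xi i ord0)) => _.
    by exists 1; rewrite ?normr1 ?mul1r.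
  by exists (-1); rewrite ?normrN1 ?mulN1r.
(* The sign [s] makes the tangent linear in [g] itself; [l] makes its value at [A] equal to [A^q],
   so equality holds for [T t g] at [(x, i)]. *)
pose k := q * A `^ (q - 1) * s; pose l := - ((q - 1) * A `^ q).
have Cl := Cbm_lin k l Cg (Cbm_cst xi).
have := @T_le _ _ t x i Cl (Cbm_relative_power Cg).
rewrite T_lin //; last exact: Cbm_cst.
rewrite T_xi // => /(_ _ t0) H.
have -> : relative_power (T t g) x i ord0 = (k *: T t g x + l *: xi) i ord0.
  rewrite !mxE -/A.
  have -> : T t g x i ord0 = xi i ord0 * (T t g x i ord0 / xi i ord0).
    by field; rewrite gt_eqF.
  have -> : k * (xi i ord0 * (T t g x i ord0 / xi i ord0)) =
     xi i ord0 * (q * ((s * (T t g x i ord0 / xi i ord0)) * A `^ (q - 1))).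
    by rewrite /k; ring.
  by rewrite sA -(powR_split q_ge1) // /l; ring.
apply: H => y j; rewrite !mxE.
have := powR_tangent q_ge1 (s * (g y j ord0 / xi j ord0)) A0.
rewrite normrM s1 mul1r => H; have {}H := ler_wpM2l (ltW (xi_gt0 j)) H.
have -> : k * g y j ord0 + l * xi j ord0 =
    xi j ord0 * (q * (A `^ (q - 1) * (s * (g y j ord0 / xi j ord0)))) + l * xi j ord0.
  by rewrite /k; field; rewrite gt_eqF.
by move: H; rewrite /l mulrDr; lra.
Qed.

(** What matters is independence of [t]. The first factor removes the weight [xi_i] when one
    component is extracted from the invariant mean; the second converts [|g / xi|^q] into
    [|g|^q]. *)
Definition contraction_constant : R :=
  (\sum_i (xi i ord0)^-1) * \sum_i ((xi i ord0)^-1) `^ q.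

Lemma inv_xi_le i : (xi i ord0)^-1 <= \sum_i (xi i ord0)^-1.
Proof. by rewrite (bigD1 i) //= lerDl sumr_ge0 // => j _; rewrite invr_ge0 ltW. Qed.

Lemma contraction_constant_ge0 : 0 <= contraction_constant.
Proof.
apply: mulr_ge0; apply: sumr_ge0 => i _; first by rewrite invr_ge0 ltW.
exact: powR_ge0.
Qed.

Lemma bmeas_powR (h : X -> R) : bmeas h -> bmeas (fun x => `|h x| `^ q).
Proof.
move=> [mh [M HM]]; split; first by have /measurable_EFinP := measurable_powq q mh.
exists (M `^ q) => x; rewrite ger0_norm ?powR_ge0 //.
have M0 : 0 <= M by apply: le_trans (HM x).
by rewrite ge0_ler_powR ?nnegrE ?(ltW q_gt0).
Qed.

Lemma Iq_Rintegral (h h' : X -> R) : bmeas h -> bmeas h' ->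
  Iq q mu h h' = (Rintegral mu [set: X] (fun x => `|h x - h' x| `^ q))%:E.
Proof.
move=> bh bh'; rewrite /Rintegral fineK //.
apply: integrable_fin_num => //.
exact: (bmeas_integrable (@finmu R d mu) (bmeas_powR (bmeasB bh bh'))).
Qed.

Lemma powR_ge_id_le1 (s : R) : 0 < s -> s <= 1 -> s `^ q <= s.
Proof.
move=> s0 s1; have s0' := ltW s0; rewrite (powR_split q_ge1) // ler_piMr //.
have E : 1 `^ (q - 1) = 1 :> R by rewrite powR1.
by rewrite -[leRHS]E ge0_ler_powR ?nnegrE ?subr_ge0.
Qed.

Lemma T_contraction g t (e : R) i : Cbm g -> 0 < t ->
  (forall j, (Iq q mu (fun x => g x j ord0) (fun=> 0%R) <= e%:E)%E) ->
  (Iq q mu (fun x => T t g x i ord0) (fun=> 0%R) <= (contraction_constant * e)%:E)%E.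
Proof.
move=> Cg t0 Hg; have t0' := ltW t0.
have b0 : bmeas (fun _ : X => 0 : R) by exact: bmeas_cst.
have Cv := Cbm_relative_power Cg; have CTg := T_Cbm Cg t0; have CTv := T_Cbm Cv t0.
have fin := @finmu R d mu.
have {}Hg j : Rintegral mu [set: X] (fun x => `|g x j ord0| `^ q) <= e.
  have := Hg j; rewrite Iq_Rintegral //; last exact: Cbm_bmeas.
  by rewrite lee_fin; under eq_Rintegral => x _ do rewrite subr0.
rewrite Iq_Rintegral //; last exact: Cbm_bmeas.
rewrite lee_fin; under eq_Rintegral => x _ do rewrite subr0.
have Tv_ge0 x j : 0 <= T t (relative_power g) x j ord0.
  apply: le_trans (T_jensen x j Cg t0'); rewrite mxE mulr_ge0 ?powR_ge0 //.
  exact: ltW.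
apply: (@le_trans _ _ (Rintegral mu [set: X]
    (fun x => T t (relative_power g) x i ord0))).
  apply: (Rint_le fin); [by apply: bmeas_powR; exact: Cbm_bmeas|exact: Cbm_bmeas|].
  move=> x; apply: le_trans (T_jensen x i Cg t0'); rewrite mxE.
  have -> : `|T t g x i ord0| `^ q =
      xi i ord0 `^ q * `|T t g x i ord0 / xi i ord0| `^ q.
    rewrite -powRM ?(ltW (xi_gt0 i)) //; congr (_ `^ _).
    by rewrite normrM normfV (gtr0_norm (xi_gt0 i)); field; rewrite gt_eqF.
  by rewrite ler_wpM2r ?powR_ge0 // powR_ge_id_le1.
have I0 j : 0 <= Rintegral mu [set: X] (fun x => T t (relative_power g) x j ord0).
  by apply: Rintegral_ge0 => x _.
have Mv : Mf mu xi (T t (relative_power g)) <= e * \sum_j ((xi j ord0)^-1) `^ q.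
  rewrite T_mean // Mf_E mulr_sumr; apply: ler_sum => j _.
  have e0 : 0 <= e by apply: le_trans (Hg j); apply: Rintegral_ge0 => x _; exact: powR_ge0.
  apply: (@le_trans _ _ (1 * Rintegral mu [set: X] (fun x => relative_power g x j ord0))).
    by rewrite ler_wpM2r // Rintegral_ge0 // => x _; rewrite mxE mulr_ge0 ?powR_ge0 ?(ltW (xi_gt0 j)).
  rewrite mul1r.
  apply: (@le_trans _ _ (Rintegral mu [set: X]
     (fun x => ((xi j ord0)^-1) `^ q * `|g x j ord0| `^ q))).
    have bg : bmeas (fun x : X => `|g x j ord0| `^ q).
      by apply: bmeas_powR; exact: Cbm_bmeas.
    apply: (Rint_le fin); first exact: Cbm_bmeas.
      have := bmeas_lin (((xi j ord0)^-1) `^ q) 0 bg b0; congr bmeas.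
      by apply/funext => x; rewrite mul0r addr0.
    move=> x; rewrite mxE normrM normfV (gtr0_norm (xi_gt0 j)).
    rewrite powRM ?invr_ge0 ?(ltW (xi_gt0 j)) // [X in xi j ord0 * X]mulrC.
    by rewrite ler_piMl // mulr_ge0 ?powR_ge0.
  rewrite RintegralZl //; last first.
    by apply: (bmeas_integrable fin); apply: bmeas_powR; exact: Cbm_bmeas.
  by rewrite mulrC ler_wpM2r ?powR_ge0.
have : xi i ord0 * Rintegral mu [set: X] (fun x => T t (relative_power g) x i ord0) <=
    e * \sum_j ((xi j ord0)^-1) `^ q.
  apply: le_trans Mv; rewrite Mf_E (bigD1 i) //= lerDl; apply: sumr_ge0 => j _.
  by rewrite mulr_ge0 // ltW.
rewrite mulrC -ler_pdivlMr // => /le_trans; apply.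
have e0 : 0 <= e by apply: le_trans (Hg i); apply: Rintegral_ge0 => x _; exact: powR_ge0.
rewrite /contraction_constant mulrC -[leRHS]mulrA [X in _ <= _ * X]mulrC.
rewrite ler_wpM2r ?inv_xi_le // mulr_ge0 // sumr_ge0 // => j _; exact: powR_ge0.
Qed.

Lemma Cbm_Iq_limit g (eps : R) : Cbm g -> 0 < eps -> exists2 t0, 0 < t0 & forall t i,
  t0 <= t ->
  (Iq q mu (fun x => T t g x i ord0) (fun=> (Mf mu xi g * xi i ord0)%R) <= eps%:E)%E.
Proof.
move=> Cg eps0; have fin := @finmu R d mu.
have [K' K'0 HK'] : exists2 K, 0 <= K & forall h x, `|g x h ord0| <= K * xi h ord0.
  apply: finite_bound => [h|h M M' MM' H x].
    have [M HM] := (Cg h).2; exists (M / xi h ord0) => x.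
    by rewrite mulfVK ?gt_eqF.
  by rewrite (le_trans (H x)) // ler_pM2r.
pose K := K' + 1; have K0 : 0 < K by rewrite ltr_wpDl.
have HK x h : `|g x h ord0| <= K * xi h ord0.
  by rewrite (le_trans (HK' h x)) // ler_pM2r // lerDl.
(* [B] bounds the integrand everywhere and is multiplied by the small measure outside the ball;
   inside, [del <= 1] gives [del^q <= del]. *)
pose B := (K + `|Mf mu xi g|) `^ q + 1.
have B0 : 0 < B by rewrite ltr_wpDl ?powR_ge0.
have e1 : 0 < eps / 2 / B by rewrite !divr_gt0.
have [rho rho0 Hrho] := mu_tail mu e1.
pose del := Num.min 1 (eps / 2).
have del0 : 0 < del by rewrite lt_min ltr01 divr_gt0.
have delq : del `^ q <= eps / 2.
  apply: (@le_trans _ _ del); last by rewrite ge_min lexx orbT.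
  by rewrite powR_ge_id_le1 // ge_min lexx.
have [t0 t00 Ht0] := T_limit rho del0 K0.
exists t0 => // t i tt; have tp : 0 < t by exact: lt_le_trans tt.
rewrite Iq_Rintegral; [|by apply: Cbm_bmeas; exact: T_Cbm|exact: bmeas_cst].
rewrite lee_fin.
pose E : set X := [set y : X | ~ enorm (y : pt) <= rho].
have mE : measurable E.
  apply: sub_sigma_algebra.
  have -> : E = (fun x : pt => enorm x) @^-1` [set s | rho < s].
    by apply/seteqP; split=> y /=; rewrite /E /= ltNge => /negP.
  by have /continuousP := @enorm_continuous R d; apply; exact: open_gt.
have bT : bmeas (fun x : X => T t g x i ord0).
  by apply: Cbm_bmeas; exact: T_Cbm.
apply: (@le_trans _ _ (Rintegral mu [set: X] (fun y => eps / 2 * 1 + B * \1_E y))).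
  apply: (Rint_le fin).
  - by apply: bmeas_powR; apply: bmeasB => //; exact: bmeas_cst.
  - by apply: bmeas_lin; [exact: bmeas_cst|exact: bmeas_indic].
  - move=> y; rewrite indicE mulr1; case: (boolP (y \in E)) => yE.
      rewrite mulr1 (@le_trans _ _ B) //; last by rewrite lerDr divr_ge0 // ltW.
      rewrite (@le_trans _ _ ((K + `|Mf mu xi g|) `^ q)) //; last by rewrite lerDl.
      rewrite ge0_ler_powR ?nnegrE ?(ltW q_gt0) ?addr_ge0 ?(ltW K0) //.
      rewrite (le_trans (ler_normB _ _)) // lerD //.
        rewrite (le_trans (T_bound y i Cg HK (ltW tp))) // ler_piMr //; exact: ltW.
      by rewrite normrM (gtr0_norm (xi_gt0 i)) ler_piMr.
    rewrite mulr0 addr0 (le_trans _ delq) // ge0_ler_powR ?nnegrE ?(ltW q_gt0) ?(ltW del0) //.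
    apply: Ht0 => //; apply: contrapT => ny.
    by move/negP: yE; apply; rewrite inE.
rewrite (Rint_lin fin) //; [|exact: bmeas_cst|exact: bmeas_indic].
have E1 : fine (mu [set: X]) = 1 by rewrite probability_setT.
rewrite Rintegral_cst // [X in 1 * X]E1 Rint_indic //.
have : B * fine (mu E) <= B * (eps / 2 / B) by rewrite ler_pM2l.
have -> : B * (eps / 2 / B) = eps / 2 by field; rewrite gt_eqF.
lra.
Qed.

Lemma Lpdist_ge0 (f g : pt -> 'cV[R]_m) : (0 <= Lpdist mu xi q f g)%E.
Proof.
apply: sume_ge0 => j _; rewrite mule_ge0 ?lee_fin ?(ltW (xi_gt0 j)) //.
by apply: integral_ge0 => y _; rewrite lee_fin powR_ge0.
Qed.

Lemma Lpdist_le (f g : pt -> 'cV[R]_m) (e : R) :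
  (forall j, (Iq q mu (fun x => f x j ord0) (fun x => g x j ord0) <= e%:E)%E) ->
  (Lpdist mu xi q f g <= (m%:R * e)%:E)%E.
Proof.
move=> H; apply: (@le_trans _ _ (\sum_(j < m) e%:E)%E).
  apply: lee_sum => j _; apply: le_trans (H j).
  rewrite -[leRHS]mul1e; apply: lee_wpmul2r; last by rewrite lee_fin.
  exact: Iq_ge0.
by rewrite sumEFin sumr_const card_ord mulr_natl.
Qed.

Lemma Iq_le_Lpdist (f g : pt -> 'cV[R]_m) j :
  ((xi j ord0)%:E * Iq q mu (fun x => f x j ord0) (fun x => g x j ord0) <=
   Lpdist mu xi q f g)%E.
Proof.
rewrite /Lpdist (bigD1 j) //= leeDl //; apply: sume_ge0 => i _.
rewrite mule_ge0 ?lee_fin ?(ltW (xi_gt0 i)) //; exact: Iq_ge0.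
Qed.

Lemma Cbm_Lpm (g : pt -> 'cV[R]_m) : Cbm g -> Lpm mu q g.
Proof.
move=> Cg h; have bg := Cbm_bmeas h Cg; split; first exact: bg.1.
have := Iq_Rintegral bg (bmeas_cst d 0).
rewrite /Iq; under eq_integral => y _ do rewrite subr0.
by move=> ->; rewrite ltry.
Qed.

Lemma Lpm_density (f : pt -> 'cV[R]_m) (e : R) : Lpm mu q f -> 0 < e ->
  exists g : pt -> 'cV[R]_m, [/\ Cbm g,
    forall j, (Iq q mu (fun x => f x j ord0) (fun x => g x j ord0) <= e%:E)%E &
    `|Mf mu xi f - Mf mu xi g| <= m%:R * e].
Proof.
move=> Lf e0.
have /choice[g Hg] j := Lq_density q_ge1 (Lf j).1 (Lf j).2 e0.
pose G x : 'cV[R]_m := \col_j g j x.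
have GE j : (fun x => G x j ord0) = g j by apply/funext => x; rewrite mxE.
have CG : Cbm G by move=> j; rewrite GE; have [? ? _ _] := Hg j.
exists G; split => // [j|]; first by rewrite GE; have [_ _ ? _] := Hg j.
rewrite !Mf_E -sumrB (le_trans (ler_norm_sum _ _ _)) //.
rewrite mulr_natl -[X in _ *+ X]card_ord -sumr_const; apply: ler_sum => j _.
rewrite -mulrBr normrM (gtr0_norm (xi_gt0 j)).
have bG := Cbm_bmeas j CG; have iG := bmeas_integrable (@finmu R d mu) bG.
have mf : measurable_fun [set: X] (fun x : X => f x j ord0) := (Lf j).1.
have id : mu.-integrable [set: X] (EFin \o (fun x : X => f x j ord0 - G x j ord0)).
  apply/integrableP; split.
    by apply/measurable_EFinP; apply: measurable_funB => //; exact: bG.1.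
  have [_ _ _ H] := Hg j; apply: (le_lt_trans _ (ltry e)); apply: le_trans H.
  by rewrite le_eqVlt; apply/orP; left; apply/eqP; apply: eq_integral => y _; rewrite /= mxE.
have if' : mu.-integrable [set: X] (EFin \o (fun x : X => f x j ord0)).
  have := integrableD measurableT id iG; congr (integrable _ _ _).
  by apply/funext => x /=; rewrite -EFinD subrK.
rewrite -RintegralB //; apply: (@le_trans _ _ (1 * e)); last by rewrite mul1r.
apply: ler_pM => //; first exact: ltW.
apply: le_trans (le_normr_Rintegral _ id) _ => //.
have [_ _ _ H] := Hg j.
have fn : (\int[mu]_(y in [set: X]) `|f y j ord0 - g j y|%:E)%E \is a fin_num.
  rewrite ge0_fin_numE; first exact: le_lt_trans H (ltry e).
  by apply: integral_ge0 => y _; rewrite lee_fin.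
rewrite /Rintegral; under eq_integral => y _ do rewrite mxE.
by rewrite -lee_fin fineK.
Qed.

Variable p : R -> pt -> 'I_m -> 'I_m -> {measure set X -> \bar R}.
Hypothesis T_ker : forall t f x i, 0 < t -> Cbm f -> T t f x i ord0 = Tker p t f x i ord0.
Variable Tp : R -> (pt -> 'cV[R]_m) -> pt -> 'cV[R]_m.
Hypothesis Tp_Lpm : forall t f, 0 < t -> Lpm mu q f -> Lpm mu q (Tp t f).
Hypothesis Tp_ker : forall t f, 0 < t -> Bbm f ->
  {ae mu, forall x, Tp t f x = Tker p t f x}.
Hypothesis Tp_bounded : forall t, 0 < t -> exists K : R, forall f g,
  Lpm mu q f -> Lpm mu q g ->
  (Lpdist mu xi q (Tp t f) (Tp t g) <= K%:E * Lpdist mu xi q f g)%E.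

(** [g] is allowed to depend on [t], as does the norm bound of the extension. On continuous data the
    extension agrees with [T t] almost everywhere, so [T t g] may stand for [Tp t g]. *)
Lemma Tp_approximation f t (e : R) : Lpm mu q f -> 0 < t -> 0 < e ->
  exists g : pt -> 'cV[R]_m, [/\ Cbm g,
    forall j, (Iq q mu (fun x => f x j ord0) (fun x => g x j ord0) <= e%:E)%E &
    forall j, (Iq q mu (fun x => Tp t f x j ord0) (fun x => T t g x j ord0) <= e%:E)%E].
Proof.
move=> Lf t0 e0; have [K' HK'] := Tp_bounded t0.
pose K := `|K'| + 1; have K1 : 1 <= K by rewrite lerDr.
pose Z := \sum_i (xi i ord0)^-1 + 1.
have Z1 : 1 <= Z by rewrite lerDr sumr_ge0 // => i _; rewrite invr_ge0 ltW.
pose N : R := m%:R + 1; have N1 : 1 <= N by rewrite lerDr.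
have D1 : 1 <= Z * K * N by rewrite !mulr_ege1.
have D0 : 0 < Z * K * N by exact: lt_le_trans D1.
have eta0 : 0 < e / (Z * K * N) by rewrite divr_gt0.
have [g [Cg Hg _]] := Lpm_density Lf eta0.
exists g; split => // j.
  by apply: le_trans (Hg j) _; rewrite lee_fin ler_pdivrMr // ler_peMr // ltW.
have Lg := Cbm_Lpm Cg.
have h1 : (Lpdist mu xi q (Tp t f) (Tp t g) <= (e / Z)%:E)%E.
  apply: le_trans (HK' _ _ Lf Lg) _.
  apply: (@le_trans _ _ (K%:E * (m%:R * (e / (Z * K * N)))%:E)%E).
    apply: (@le_trans _ _ (K%:E * Lpdist mu xi q f g)%E).
      apply: lee_wpmul2r; first exact: Lpdist_ge0.
      by rewrite lee_fin (le_trans (ler_norm _)) // lerDl.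
    apply: lee_wpmul2l; first by rewrite lee_fin (le_trans _ K1).
    exact: Lpdist_le.
  rewrite -EFinM lee_fin.
  have -> : K * (m%:R * (e / (Z * K * N))) = e / Z * (m%:R / N).
    by field; rewrite !gt_eqF // (lt_le_trans ltr01).
  rewrite ler_piMr ?divr_ge0 ?(ltW e0) ?(le_trans _ Z1) //.
  by rewrite ler_pdivrMr ?(lt_le_trans _ N1) // mul1r lerDl.
have -> : Iq q mu (fun x => Tp t f x j ord0) (fun x => T t g x j ord0) =
    Iq q mu (fun x => Tp t f x j ord0) (fun x => Tp t g x j ord0).
  apply: ge0_ae_eq_integral => //.
  - apply: measurable_powqB; first exact: (Tp_Lpm t0 Lf j).1.
    by apply: continuous_measurable; exact: (T_Cbm Cg t0 j).1.
  - apply: measurable_powqB; first exact: (Tp_Lpm t0 Lf j).1.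
    exact: (Tp_Lpm t0 Lg j).1.
  - have Bg : Bbm g by move=> h; exact: Cbm_bmeas.
    have [A [mA A0 sA]] := Tp_ker t0 Bg; exists A; split => // x nE.
    by apply: sA => E; apply: nE => _; rewrite E T_ker.
have xj := xi_gt0 j.
have h2 := le_trans (Iq_le_Lpdist (Tp t f) (Tp t g) j) h1.
rewrite -(@lee_pmul2l _ (xi j ord0)%:E) // ?lte_fin //.
apply: le_trans h2 _; rewrite -EFinM lee_fin.
rewrite ler_pdivrMr ?(lt_le_trans _ Z1) // mulrAC -[leLHS]mul1r ler_wpM2r ?(ltW e0) //.
rewrite -(@mulfV _ (xi j ord0)) ?gt_eqF // ler_pM2l // (le_trans (inv_xi_le j)) //.
by rewrite lerDl.
Qed.

Lemma Lq_limit (f : pt -> 'cV[R]_m) : Lpm mu q f -> forall eps : R, 0 < eps ->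
  exists t0 : R, forall t, 0 < t -> t0 <= t ->
  (Lpdist mu xi q (Tp t f) (fun _ => Mf mu xi f *: xi) <= eps%:E)%E.
Proof.
move=> Lf eps eps0.
pose N : R := m%:R + 1; have N1 : 1 <= N by rewrite lerDr.
have N0 : 0 < N by exact: lt_le_trans N1.
pose c : R := 2 `^ q; have c0 : 0 < c by rewrite powR_gt0.
pose G := contraction_constant; have G0 : 0 <= G := contraction_constant_ge0.
(* The coefficient of [e] after the nested uses of [Iq_triangle], each costing a factor
   [c = 2^q]. *)
pose D := c * c * (3 + 2 * (G * c)).
have D0 : 0 < D.
  have Gc : 0 <= G * c by apply: mulr_ge0 => //; exact: ltW.
  by apply: mulr_gt0; [exact: mulr_gt0|lra].
pose e := Num.min 1 (eps / N / D).
have e0 : 0 < e by rewrite lt_min ltr01 !divr_gt0.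
have eD : e * D <= eps / N.
  by rewrite -ler_pdivlMr // ge_min lexx orbT.
have e1 : e <= 1 by rewrite ge_min lexx.
have eN0 : 0 < e / N by rewrite divr_gt0.
have eNe : e / N <= e by rewrite ler_pdivrMr // ler_peMr // ltW.
have [g [Cg Hg HM]] := Lpm_density Lf eN0.
have [t0 t00 Ht0] := Cbm_Iq_limit Cg e0.
exists t0 => t tp tt.
suff H j : (Iq q mu (fun x => Tp t f x j ord0) (fun x => (Mf mu xi f *: xi) j ord0) <=
    (eps / N)%:E)%E.
  apply: le_trans (Lpdist_le H) _; rewrite lee_fin mulrA ler_pdivrMr // mulrC.
  by rewrite ler_pM2l // lerDl.
(* [g] was fixed before [t] and carries the limit; [g'] depends on [t] and represents [Tp t f]. They
   are joined through [f] by [T_contraction], whose constant is uniform in [t]. *)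
have [g' [Cg' Hg' HT]] := Tp_approximation Lf tp e0.
have mT h : Cbm h -> measurable_fun [set: X] (fun x : X => T t h x j ord0).
  by move=> Ch; apply: continuous_measurable; exact: (T_Cbm Ch tp j).1.
have mC (h : pt -> 'cV[R]_m) i : Cbm h -> measurable_fun [set: X] (fun x : X => h x i ord0).
  by move=> Ch; exact: (Cbm_bmeas i Ch).1.
have mTp : measurable_fun [set: X] (fun x : X => Tp t f x j ord0).
  exact: (Tp_Lpm tp Lf j).1.
have mf i : measurable_fun [set: X] (fun x : X => f x i ord0) := (Lf i).1.
have mk (k : R) : measurable_fun [set: X] (fun _ : X => k) by exact: measurable_cst.
have a2 : (Iq q mu (fun x => T t g' x j ord0) (fun x => T t g x j ord0) <=
    (G * (c * (e + e)))%:E)%E.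
  have Cd := Cbm_lin 1 (-1) Cg' Cg.
  have := T_contraction (e := c * (e + e)) j Cd tp.
  rewrite T_lin ?(ltW tp) // => H.
  have IE (h h' : pt -> 'cV[R]_m) i : Iq q mu (fun x => h x i ord0) (fun x => h' x i ord0) =
      Iq q mu (fun x => (1 *: h x + (-1) *: h' x) i ord0) (fun=> 0).
    by apply: eq_integral => y _; rewrite !mxE mul1r mulN1r subr0.
  rewrite IE; apply: H => i; rewrite -(IE g' g).
  have h1 : (Iq q mu (fun x => g' x i ord0) (fun x => f x i ord0) <= e%:E)%E.
    by rewrite Iq_sym.
  have h2 : (Iq q mu (fun x => f x i ord0) (fun x => g x i ord0) <= e%:E)%E.
    by apply: le_trans (Hg i) _; rewrite lee_fin.
  exact: (Iq_triangle q_ge1 (mC g' i Cg') (mf i) (mC g i Cg) h1 h2).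
have a4 : (Iq q mu (fun _ => Mf mu xi g * xi j ord0)%R
    (fun x => (Mf mu xi f *: xi) j ord0) <= e%:E)%E.
  rewrite Iq_Rintegral; [|exact: bmeas_cst|exact: bmeas_cst].
  have E1 : fine (mu [set: X]) = 1 by rewrite probability_setT.
  rewrite Rintegral_cst // [X in _ * X]E1 mulr1 lee_fin mxE -mulrBl normrM.
  rewrite (gtr0_norm (xi_gt0 j)) distrC.
  apply: (@le_trans _ _ (e `^ q)); last exact: powR_ge_id_le1.
  rewrite ge0_ler_powR ?nnegrE ?(ltW q_gt0) ?mulr_ge0 ?(ltW e0) ?(ltW (xi_gt0 j)) //.
  apply: (@le_trans _ _ `|Mf mu xi f - Mf mu xi g|); first by rewrite ler_piMr.
  by rewrite (le_trans HM) // mulrA ler_pdivrMr // mulrC ler_pM2l // lerDl.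
have b1 := Iq_triangle q_ge1 mTp (mT _ Cg') (mT _ Cg) (HT j) a2.
have b2 := Iq_triangle q_ge1 (mT _ Cg) (mk _) (mk _) (Ht0 t j tt) a4.
have b3 := Iq_triangle q_ge1 mTp (mT _ Cg) (mk _) b1 b2.
apply: le_trans b3 _; rewrite lee_fin -/c (le_trans _ eD) // /D.
by rewrite le_eqVlt; apply/orP; left; apply/eqP; ring.
Qed.

End LqLimit.

(** * Bounds on the coefficients and the left kernel of the coupling matrix *)

Section Coefficients.
Variables (R : realType) (d m : nat).
Local Notation pt := (pt R d).

Lemma enorm_le_sum (v : pt) : enorm v <= \sum_i `|v ord0 i|.
Proof.
have s0 : 0 <= \sum_i `|v ord0 i| by apply: sumr_ge0.
rewrite -(@ler_pXn2r _ 2) ?nnegrE ?enorm_ge0 // enorm2 expr2 mulr_suml.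
apply: ler_sum => i _; rewrite (le_trans (ler_norm _)) // normrM ler_wpM2l //.
by rewrite (bigD1 i) //= lerDl sumr_ge0.
Qed.

Lemma locally_bounded_sum (I : finType) (f : I -> pt -> R) (g : pt -> R) :
  (forall i, locally_bounded (f i)) -> (forall x, `|g x| <= \sum_i `|f i x|) ->
  locally_bounded g.
Proof.
move=> bf gf r; have [M _ HM] : exists2 M, 0 <= M & forall i x, enorm x <= r -> `|f i x| <= M.
  apply: finite_bound => [i|i M M' MM' H x xr]; first exact: bf.
  exact: le_trans (H x xr) MM'.
exists (\sum_(i : I) M) => x xr; apply: le_trans (gf x) _.
by apply: ler_sum => i _; exact: HM.
Qed.

Lemma locally_lipschitz_coefficients (Q : pt -> 'M[R]_d) (b : pt -> 'rV[R]_d) (alpha : R) :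
  0 < alpha -> (forall i j, C1holder_loc alpha (fun x => Q x i j)) ->
  (forall i, C1holder_loc alpha (fun x => b x ord0 i)) ->
  exists2 Lam, 0 < Lam & forall x y, enorm x <= 1 -> enorm y <= 1 ->
    (forall i j, `|Q x i j - Q y i j| <= Lam * enorm (x - y)) /\
    enorm (b x - b y) <= Lam * enorm (x - y).
Proof.
move=> al0 hQ hb.
have [L L0 HL] : exists2 L, 0 <= L & forall (ij : 'I_d * 'I_d) (x y : pt),
    enorm x <= 1 -> enorm y <= 1 -> `|Q x ij.1 ij.2 - Q y ij.1 ij.2| <= L * enorm (x - y).
  apply: finite_bound => [[i j]|i M M' MM' H x y x1 y1].
    by have [L _ HL] := C1holder_lipschitz al0 (hQ i j); exists L.
  by apply: le_trans (H x y x1 y1) _; rewrite ler_wpM2r ?enorm_ge0.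
have [N N0 HN] : exists2 L, 0 <= L & forall i (x y : pt),
    enorm x <= 1 -> enorm y <= 1 -> `|b x ord0 i - b y ord0 i| <= L * enorm (x - y).
  apply: finite_bound => [i|i M M' MM' H x y x1 y1].
    by have [L' _ HL'] := C1holder_lipschitz al0 (hb i); exists L'.
  by apply: le_trans (H x y x1 y1) _; rewrite ler_wpM2r ?enorm_ge0.
have dN : 0 <= d%:R * N by rewrite mulr_ge0.
exists (L + d%:R * N + 1); first by rewrite ltr_wpDl // addr_ge0.
move=> x y x1 y1; split=> [i j|].
  apply: le_trans (HL (i, j) x y x1 y1) _; rewrite ler_wpM2r ?enorm_ge0 //; lra.
apply: le_trans (enorm_le_sum _) _.
apply: (@le_trans _ _ (d%:R * N * enorm (x - y))); last first.
  by rewrite ler_wpM2r ?enorm_ge0 //; lra.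
rewrite -mulrA mulr_natl -[X in _ *+ X]card_ord -sumr_const; apply: ler_sum => i _.
by rewrite !mxE; exact: HN.
Qed.

(* At xi + s e_k the quadratic form is s <xi, C e_k> + O(s^2) for s near 0. *)
Lemma dissipative_left_kernel (C : 'M[R]_m) (xi : 'cV[R]_m) :
  (forall y : 'cV[R]_m, (y^T *m C *m y) ord0 ord0 <= 0) -> C *m xi = 0 ->
  forall k, \sum_j xi j ord0 * C j k = 0.
Proof.
move=> dis Cxi k; set be := \sum_j _.
have qf (s : R) : s * be + s * s * C k k <= 0.
  pose y : 'cV[R]_m := xi + s *: delta_mx k ord0.
  have := dis y; rewrite /y -mulmxA mulmxDr Cxi add0r -scalemxAr.
  rewrite (_ : C *m delta_mx k ord0 = col k C); last by rewrite colE.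
  have -> : (xi + s *: delta_mx k ord0)^T = xi^T + s *: delta_mx ord0 k.
    by apply/matrixP => i j; rewrite !mxE andbC.
  rewrite mulmxDl -!scalemxAr -scalemxAl -rowE.
  rewrite !mxE /= => H; apply: le_trans H; rewrite le_eqVlt; apply/orP; left; apply/eqP.
  rewrite mulrA; congr (_ + _); rewrite /be; congr (_ * _).
  by apply: eq_bigr => j _; rewrite !mxE.
apply/eqP/negPn/negP => be0.
(* With [s = be / n] the linear term [be^2 / n] outweighs the quadratic one, since
   [n + C k k >= 1]. *)
pose n := 1 + `|C k k|; have n0 : 0 < n by rewrite ltr_pwDl.
have := qf (be / n); apply/negP; rewrite -ltNge.
have -> : be / n * be + be / n * (be / n) * C k k = be ^+ 2 / n ^+ 2 * (n + C k k).
  by field; rewrite gt_eqF.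
have be2 : 0 < be ^+ 2 by rewrite exprn_even_gt0.
apply: mulr_gt0; first by rewrite divr_gt0 // exprn_gt0.
have := ler_norm (- C k k); rewrite normrN /n; lra.
Qed.

End Coefficients.

(** [M_f] is the [mu]-integral of the scalar function [ws f], and uniqueness for the scalar equation
    gives [ws (T t f) = S t (ws f)]. *)
Lemma mean_invariant (R : realType) (d m : nat) (Q : pt R d -> 'M[R]_d)
  (b : pt R d -> 'rV[R]_d) (C : pt R d -> 'M[R]_m) (phi : pt R d -> R) (a c : R)
  (xi : 'cV[R]_m) (T : R -> (pt R d -> 'cV[R]_m) -> pt R d -> 'cV[R]_m)
  (S : R -> (pt R d -> R) -> pt R d -> R) (mu : probability (Rd R d) R) :
  (forall x, (Q x)^T = Q x) -> (forall x (v : pt R d), 0 <= qform (Q x) (v ord0)) ->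
  (forall x, 0 < phi x) -> C2 phi ->
  (forall M : R, exists r : R, forall x, r <= enorm x -> M <= phi x) ->
  0 < a -> 0 < c -> (forall x, Aop Q b phi x <= a - c * phi x) ->
  (forall x k, \sum_j xi j ord0 * C x j k = 0) ->
  (forall f, Cbm f -> system_sol Q b C (fun t => T t f) f) ->
  (forall g, Cb g -> scalar_sol Q b (fun t => S t g) g) ->
  (forall g t, Cb g -> 0 <= t ->
     (\int[mu]_(y in [set: Rd R d]) (S t g y)%:E
      = \int[mu]_(y in [set: Rd R d]) (g y)%:E)%E) ->
  forall f t, Cbm f -> 0 < t -> Mf mu xi (T t f) = Mf mu xi f.
Proof.
move=> symQ psdQ phi_gt0 C2phi phi_inf a_gt0 c_gt0 Aphi xiC HT HS inv f t Cf t0.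
pose ws (f : pt R d -> 'cV[R]_m) (x : pt R d) := \sum_j xi j ord0 * f x j ord0.
have MfE g : Cbm g -> Mf mu xi g = Rintegral mu [set: Rd R d] (ws g).
  move=> Cg; have bg j : bmeas (fun x : Rd R d => g x j ord0) by exact: Cbm_bmeas.
  rewrite Mf_E /ws; elim: (index_enum _) => [|j s [IH]].
    rewrite big_nil (_ : (fun x => _) = fun=> 0); first by rewrite Rintegral_cst // mul0r.
    by apply/funext => x; rewrite big_nil.
  have bs : bmeas (fun x : Rd R d => \sum_(k <- s) xi k ord0 * g x k ord0).
    elim: s {IH} => [|k s IH].
      by have := bmeas_cst d (0 : R); congr bmeas; apply/funext => x; rewrite big_nil.
    have := bmeas_lin (xi k ord0) 1 (bg k) IH; congr bmeas; apply/funext => x.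
    by rewrite big_cons mul1r.
  have := Rint_lin (@finmu R d mu) (xi j ord0) 1 (bg j) bs.
  rewrite big_cons IH mul1r => <-; apply: eq_Rintegral => x _.
  by rewrite big_cons mul1r.
have Cw : Cb (ws f).
  rewrite /Cb /ws; elim: (index_enum _) => [|j s [IC [M HM]]].
    rewrite (_ : (fun x => _) = fun=> 0); last by apply/funext => x; rewrite big_nil.
    by split; [exact: cst_continuous|exists 0 => x; rewrite big_nil normr0].
  rewrite (_ : (fun x => _) = fun x => xi j ord0 * f x j ord0 +
      \sum_(k <- s) xi k ord0 * f x k ord0); last first.
    by apply/funext => x; rewrite big_cons.
  have [cf [N HN]] := Cf j; split.
    move=> x; have c1 : f y j ord0 @[y --> x] --> f x j ord0 by exact: cf.
    have c2 : (\sum_(k <- s) xi k ord0 * f y k ord0) @[y --> x] -->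
       (\sum_(k <- s) xi k ord0 * f x k ord0) by exact: IC.
    exact: cvgD (cvgM (cvg_cst (xi j ord0)) c1) c2.
  exists (`|xi j ord0| * N + M) => x; rewrite big_cons (le_trans (ler_normD _ _)) // lerD //.
  by rewrite normrM ler_wpM2l.
rewrite !MfE //; last by apply: system_sol_Cbm t0 (HT f Cf).
rewrite /Rintegral -(inv _ t Cw (ltW t0)); congr fine; apply: eq_integral => x _.
congr EFin; exact: (scalar_sol_unique symQ psdQ phi_gt0 C2phi phi_inf a_gt0 c_gt0 Aphi
  (weighted_scalar_sol xiC (HT f Cf)) (HS _ Cw) x (ltW t0)).
Qed.

Theorem theorem4p4 (R : realType) (d m : nat)
  (Q : pt R d -> 'M[R]_d) (b : pt R d -> 'rV[R]_d) (C : pt R d -> 'M[R]_m)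
  (alpha : R) (phi : pt R d -> R) (a c : R) (xi : 'cV[R]_m)
  (T : R -> (pt R d -> 'cV[R]_m) -> pt R d -> 'cV[R]_m)
  (p : R -> pt R d -> 'I_m -> 'I_m -> {measure set Rd R d -> \bar R})
  (S : R -> (pt R d -> R) -> pt R d -> R)
  (mu : probability (Rd R d) R) :
  (1 <= d)%N -> (2 <= m)%N ->
  (* (H)(i) *)
  0 < alpha < 1 ->
  (forall x, (Q x)^T = Q x) ->
  (forall i j, holder_loc alpha (fun x => Q x i j)) ->
  (forall i, holder_loc alpha (fun x => b x ord0 i)) ->
  (forall h k, holder_loc alpha (fun x => C x h k)) ->
  (exists x, C x != 0) ->
  (* (H)(ii) *)
  (exists kappa : R, 0 < kappa /\
     forall x (l : R), eigenvalue (Q x) l -> kappa <= l) ->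
  (* (H)(iii) *)
  (forall x (y : 'cV[R]_m), (y^T *m C x *m y) ord0 ord0 <= 0) ->
  (* (H)(iv) *)
  (forall x, 0 < phi x) -> C2 phi ->
  (forall M : R, exists r : R, forall x, r <= enorm x -> M <= phi x) ->
  0 < a -> 0 < c ->
  (forall x, Aop Q b phi x <= a - c * phi x) ->
  (* (H)(v) *)
  (forall x h k, h != k -> 0 <= C x h k) ->
  (* (H)(vi) *)
  (exists xi0 : 'cV[R]_m, xi0 != 0 /\ forall x, C x *m xi0 = 0) ->
  (* (H)(vii) *)
  (forall K : {set 'I_m}, (0 < #|K|)%N -> (#|K| < m)%N ->
     ~ (forall i j, i \in K -> j \notin K -> forall x, C x i j = 0)) ->
  (* (A) *)
  (forall i j, C1holder_loc alpha (fun x => Q x i j)) ->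
  (forall i, C1holder_loc alpha (fun x => b x ord0 i)) ->
  (forall h k, C1holder_loc alpha (fun x => C x h k)) ->
  (exists c' : R, 0 < c' /\ forall x,
     (forall i j, `|Q x i j| <= c' * (1 + enorm x ^+ 2) * phi x) /\
     (b x *m x^T) ord0 ord0 <= c' * (1 + enorm x ^+ 2) * phi x) ->
  (* xi : the vector with positive entries and unit norm spanning
     the intersection of the kernels of C(x) *)
  (forall h, 0 < xi h ord0) -> enorm xi = 1 -> (forall x, C x *m xi = 0) ->
  (* T(t) f : value at t of the bounded classical solution, f in C_b *)
  (forall f, Cbm f -> system_sol Q b C (fun t => T t f) f) ->
  (* the finite Borel measures p_ij(t,x,dy) representing T(t) *)
  (forall t x i j, 0 < t -> (p t x i j [set: Rd R d] < +oo)%E) ->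
  (forall t f x i, 0 < t -> Cbm f -> T t f x i ord0 = Tker p t f x i ord0) ->
  (* mu : invariant probability measure of the scalar semigroup *)
  (forall g, Cb g -> scalar_sol Q b (fun t => S t g) g) ->
  (forall g t, Cb g -> 0 <= t ->
     (\int[mu]_(y in [set: Rd R d]) (S t g y)%:E
      = \int[mu]_(y in [set: Rd R d]) (g y)%:E)%E) ->
  (* conclusion 1: local uniform convergence for f in B_b *)
  (forall f, Bbm f ->
     forall r eps : R, 0 < r -> 0 < eps -> exists t0 : R, forall t x h,
       0 < t -> t0 <= t -> enorm x <= r ->
       `|Tker p t f x h ord0 - Mf mu xi f * xi h ord0| <= eps)
  /\
  (* conclusion 2: convergence in L^p_mu for f in L^p_mu; Tp is the
     (unique) extension of T(t) to L^p_mu *)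
  (forall (q : R) (Tp : R -> (pt R d -> 'cV[R]_m) -> pt R d -> 'cV[R]_m),
     1 <= q ->
     (forall t f, 0 < t -> Lpm mu q f -> Lpm mu q (Tp t f)) ->
     (forall t f, 0 < t -> Bbm f ->
        {ae mu, forall x, Tp t f x = Tker p t f x}) ->
     (forall t, 0 < t -> exists K : R, forall f g, Lpm mu q f -> Lpm mu q g ->
        (Lpdist mu xi q (Tp t f) (Tp t g) <= K%:E * Lpdist mu xi q f g)%E) ->
     forall f, Lpm mu q f ->
       forall eps : R, 0 < eps -> exists t0 : R, forall t, 0 < t -> t0 <= t ->
         (Lpdist mu xi q (Tp t f) (fun _ => Mf mu xi f *: xi) <= eps%:E)%E).
Proof.
move=> d1 m2 /andP[al0 _] symQ hQ hb hC _ [kappa [kappa0 eigQ]] dis phi0 C2phi phi_inf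
  a0 c0 Aphi coop _ irred hQ1 hb1 _ _ xi0 xi1 Cxi HT finp T_ker HS inv.
have ellQ x (v : pt R d) : kappa * dot v v <= qform (Q x) (v ord0).
  exact: eigenvalue_lower_bound (symQ x) (eigQ x) v.
have psdQ := psdQ_of_elliptic kappa0 ellQ.
have bndQ : locally_bounded (fun x => \tr (Q x)).
  apply: (@locally_bounded_sum _ _ _ (fun i x => Q x i i)) => [i|x].
    exact: holder_locally_bounded al0 (hQ i i).
  exact: ler_norm_sum.
have bndb : locally_bounded (fun x => enorm (b x)).
  apply: (@locally_bounded_sum _ _ _ (fun i x => b x ord0 i)) => [i|x].
    exact: holder_locally_bounded al0 (hb i).
  by rewrite ger0_norm ?enorm_ge0 // enorm_le_sum.
have bndC h k : locally_bounded (fun x => C x h k).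
  exact: holder_locally_bounded al0 (hC h k).
have contC h k : continuous (fun x => C x h k).
  exact: holder_continuous al0 (hC h k).
have lipQb := locally_lipschitz_coefficients al0 hQ1 hb1.
have xi_norm : \sum_j xi j ord0 * xi j ord0 = 1.
  have s0 : 0 <= \sum_i \sum_j xi i j ^+ 2.
    by apply: sumr_ge0 => i _; apply: sumr_ge0 => j _; exact: sqr_ge0.
  rewrite -[RHS](expr1n _ 2) -xi1 /enorm sqr_sqrtr //.
  by apply: eq_bigr => i _; rewrite big_ord1 expr2.
have xi_le1 h : xi h ord0 <= 1.
  rewrite -(@ler_pXn2r _ 2) ?nnegrE ?(ltW (xi0 h)) // expr1n -xi_norm.
  rewrite (bigD1 h) //= expr2 lerDl; apply: sumr_ge0 => j _.
  by rewrite mulr_ge0 // ltW.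
have xiC x := dissipative_left_kernel (dis x) (Cxi x).
(* Any component can be the one tested by the dichotomy. *)
pose i0 : 'I_m := Ordinal (ltnW m2).
have decay := @uniform_osc_decay _ _ _ _ _ _ _ _ _ _ _ i0 symQ kappa0 ellQ bndQ bndb bndC contC lipQb
  phi0 C2phi phi_inf a0 c0 Aphi coop irred xi0 xi_le1 Cxi _ HT.
have Tmean := mean_invariant symQ psdQ phi0 C2phi phi_inf a0 c0 Aphi xiC HT HS inv.
have Tlin := @T_lin _ _ _ _ _ _ _ _ _ _ _ symQ kappa0 ellQ phi0 C2phi
  phi_inf a0 c0 Aphi coop xi0 Cxi _ HT.
have Tb := @T_bound _ _ _ _ _ _ _ _ _ _ _ symQ kappa0 ellQ phi0 C2phi
  phi_inf a0 c0 Aphi coop xi0 Cxi _ HT.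
have TC := @T_Cbm _ _ _ _ _ _ _ HT.
have Tscale f (k t : R) : Cbm f -> 0 <= t ->
    T t (fun x => k *: f x) = fun x => k *: T t f x.
  move=> Cf t0; have E (g : pt R d -> 'cV[R]_m) :
      (fun x => k *: g x + 0 *: g x) = fun x => k *: g x.
    by apply/funext => x; rewrite scale0r addr0.
  by have := Tlin f f k 0 t Cf Cf; rewrite !E; apply => //; exact: Cbm_scale.
have Tle f g (t : R) x i : Cbm f -> Cbm g -> (forall x i, f x i ord0 <= g x i ord0) ->
    0 <= t -> T t f x i ord0 <= T t g x i ord0.
  move=> Cf Cg fg t0.
  exact: (system_sol_le symQ psdQ phi0 C2phi phi_inf a0 c0 Aphi coop xi0 Cxi
    (HT f Cf) (HT g Cg) fg x i t0).
have Txi t : 0 <= t -> T t (fun=> xi) = fun=> xi.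
  move=> t0; apply/funext => x.
  exact: (system_sol_unique symQ psdQ phi0 C2phi phi_inf a0 c0 Aphi coop xi0 Cxi
    (HT _ (@Cbm_cst R d m xi)) (system_sol_cst Q b Cxi) x t0).
have Tlim := Cb_limit xi0 xi_le1 xi_norm Tscale TC Tb decay Tmean.
split=> [f Bf r eps _ eps0|q Tp q1 TpL Tpk Tpb f Lf eps eps0].
  exact: (Bb_limit xi0 xi_le1 xi_norm Tscale TC Tb decay Tmean finp T_ker Bf r eps0).
exact: (Lq_limit q1 xi0 xi_le1 Tlin Tle Txi TC Tb Tmean Tlim T_ker TpL Tpk Tpb Lf eps0).
Qed.
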